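(* If $C$ is a real two-dimensional submanifold of $Q\setminus 0_Q$, then $\omega|_C$ is closed if and only if $C$ is a complex analytic curve in $Q$. If $M$ is a smoothly immersed minimal surface in $\mathbb{R}^3$, provided with the complex structure which makes the Gauss map $n:M\to S$ complex analytic, then the mapping $n':M\to Q$ is also complex analytic.
   Context: $S$ is the unit sphere in $\mathbb{R}^3$, $T_sS=s^\perp\subset\mathbb{R}^3$. For $s\in S$, $Q_s$ is the real two-dimensional space of symmetric trace-zero linear maps $T_sS\to T_sS$ (nonzero elements are invertible); these form a vector bundle $\pi:Q\to S$ with zero section $0_Q$. On $Q\setminus 0_Q$, $\omega$ is the $\mathbb{R}^3$-valued one-form $\omega_q(v)=q^{-1}(T_q\pi(v))$. For an oriented immersed minimal surface $M$, $n:M\to S$ is the Gauss map and $n'(x)\in Q_{n(x)}$ is the tangent map $T_xn$ viewed as an endomorphism of $T_xM=n(x)^\perp=T_{n(x)}S$ (minimality means that it has trace zero). Complex structure. $S\setminus\{-e_3\}$ has the complex coordinate $u=u_1+iu_2\in\mathbb{C}$ with $s(u)=(1+|u|^2)^{-1}(-2u_1,-2u_2,1-|u|^2)$; near $-e_3$ the coordinate is $v=1/u$ (with $v=0$ at $-e_3$). A nonzero $A\in Q_{s(u)}$ has fiber coordinate $q\in\mathbb{C}\setminus\{0\}$ determined by $A^{-1}(T_us(\delta u))=\operatorname{Re}\left[\frac{-2\,\delta u}{q}\,(1-u^2,\,i(1+u^2),\,2u)\right]$ for all $\delta u\in\mathbb{C}$, and $A=0$ has $q=0$. Together with the coordinates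 $(v,r)=(u^{-1},u^{-4}q)$ over $S\setminus\{e_3\}$, this makes $Q$ a holomorphic line bundle over $S\simeq\mathbb{C}\mathbb{P}^1$; this is the complex structure of $Q$ (transported from $\mathrm{SO}(3,\mathbb{C})\times_B\mathbb{C}$, where $B$ is the stabilizer of the line $\mathbb{C}(e_1+ie_2)$) and of $S$. *)

(* Defs.v *)
From mathcomp Require Import all_boot all_order all_algebra.
From mathcomp Require Import all_classical all_reals all_analysis.
From mathcomp Require Import complex.
Import Order.TTheory GRing.Theory Num.Theory.
Import numFieldNormedType.Exports.

Set Implicit Arguments.
Unset Strict Implicit.
Unset Printing Implicit Defensive.

Local Open Scope classical_set_scope.
Local Open Scope ring_scope.

(* The complex numbers are R[i]^o, a normed module over R[i] itself, so that
   [derivable f z 1] is complex differentiability. For real differentiation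
   they are identified with R * R. *)
Definition toC (R : realType) (x : R * R) : R[i]^o := (x.1 +i* x.2)%C.
Definition ofC (R : realType) (z : R[i]^o) : R * R := (complex.Re z, complex.Im z).

Section Smooth.
Context {R : realType} {V W : normedModType R}.

Fixpoint class_C (k : nat) (U : set V) (f : V -> W) : Prop :=
  (forall x, U x -> {for x, continuous f}) /\
  if k is k'.+1 then
    forall h, (forall x, U x -> derivable f x h) /\
              class_C k' U (fun x => 'D_h f x)
  else True.

Definition smooth_on (U : set V) (f : V -> W) := forall k, class_C k U f.

Definition immersion_at (f : V -> W) (x : V) := forall h, 'D_h f x = 0 -> h = 0.

(* [a x h] is the value of a W-valued one-form at the point x on the vector h;
   on constant vector fields, (da)(h, k) = D_h (a k) - D_k (a h). *)
Definition closed_form_on (U : set V) (a : V -> V -> W) :=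
  forall x, U x -> forall h k,
    'D_h (fun y => a y k) x = 'D_k (fun y => a y h) x.

End Smooth.

(* For a continuous f: f is a homeomorphism of the open set U onto a relatively
   open subset of C. *)
Definition open_embedding_in (V T : topologicalType) (U : set V) (f : V -> T)
    (C : set T) :=
  set_inj U f /\
  forall U', open U' -> U' `<=` U -> exists2 W, open W & f @` U' = C `&` W.

Section Bundle.
Variable R : realType.
Local Notation R3 := 'cV[R]_3.
Local Notation CC := (R[i]^o).

Definition vec3 (K : Type) (z a b c : K) : 'cV[K]_3 :=
  \col_(i < 3) nth z [:: a; b; c] i.

Definition Re3 (w : 'cV[CC]_3) : R3 := \col_i complex.Re (w i 0).

Definition e3 : R3 := vec3 0 0 0 1.

Definition sphere : set R3 := [set s | s^T *m s = 1%:M].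
Definition tangent (s : R3) : set R3 := [set w | s^T *m w = 0].

(* A point of Q is a pair (s, A). The endomorphism of s^⊥ is encoded by its
   extension A to R^3 with A s = 0: for a symmetric A this forces A to preserve
   s^⊥, and the trace of A is that of its restriction. *)
Definition Q : set (R3 * 'M[R]_3) :=
  [set p | [/\ sphere p.1, p.2^T = p.2, p.2 *m p.1 = 0 & \tr p.2 = 0]].

Definition zero_section : set (R3 * 'M[R]_3) := [set p | p.2 = 0].

(* The inverse of p.2 as an endomorphism of T_{p.1} S. *)
Definition tangent_inv (p : R3 * 'M[R]_3) (w : R3) : R3 :=
  xget 0 [set v | tangent p.1 v /\ p.2 *m v = w].

(* Tangent vectors of Q are pairs in R^3 * M_3(R), and T pi is the first
   projection. *)
Definition omega (p v : R3 * 'M[R]_3) : R3 := tangent_inv p v.1.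

Definition sphere_param (u : CC) : R3 :=
  let n2 := complex.Re u ^+ 2 + complex.Im u ^+ 2 in
  (1 + n2)^-1 *: vec3 0 (- 2 * complex.Re u) (- 2 * complex.Im u) (1 - n2).

Definition sphere_param_inf (v : CC) : R3 :=
  if v == 0 then - e3 else sphere_param v^-1.

Definition ucoord (s : R3) : CC := xget 0 [set u | sphere_param u = s].
Definition vcoord (s : R3) : CC := if s == - e3 then 0 else (ucoord s)^-1.

(* The real differential of a map from the complex numbers to R^3. *)
Definition Tmap (f : CC -> R3) (z d : CC) : R3 :=
  'D_(ofC d) (f \o @toC R) (ofC z).

(* The q with A^{-1} (T d) = Re ((- 2 d / q) w) for all d. *)
Definition fiber_coord (p : R3 * 'M[R]_3) (T : CC -> R3) (w : 'cV[CC]_3) : CC :=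
  if p.2 == 0 then 0 else
  xget 0 [set q | q != 0 /\
                  forall d, tangent_inv p (T d) = Re3 ((- 2 * d / q) *: w)].

Definition qcoord (p : R3 * 'M[R]_3) : CC :=
  let u := ucoord p.1 in
  fiber_coord p (Tmap sphere_param u)
    (vec3 0 (1 - u ^+ 2) ('i%C * (1 + u ^+ 2)) (2 * u)).

(* Substituting u = 1/v, q = r/v^4, du = - dv/v^2 in the equation of q gives
   A^{-1} (T_v s(dv)) = Re ((- 2 dv / r) (1 - v^2, - i (1 + v^2), - 2 v)),
   which defines r at v = 0 too. *)
Definition rcoord (p : R3 * 'M[R]_3) : CC :=
  if p.1 == - e3
  then fiber_coord p (Tmap sphere_param_inf 0) (vec3 0 1 (- 'i%C) 0)
  else (ucoord p.1)^-1 ^+ 4 * qcoord p.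

Definition holomorphic_to_S (D : set CC) (f : CC -> R3) :=
  forall z, D z ->
    [/\ sphere (f z), {for z, continuous f},
        f z <> - e3 -> derivable (ucoord \o f) z 1
      & f z <> e3 -> derivable (vcoord \o f) z 1].

Definition holomorphic_to_Q (D : set CC) (f : CC -> R3 * 'M[R]_3) :=
  forall z, D z ->
    [/\ Q (f z), {for z, continuous f},
        (f z).1 <> - e3 ->
          derivable (fun y => ucoord (f y).1) z 1 /\ derivable (qcoord \o f) z 1
      & (f z).1 <> e3 ->
          derivable (fun y => vcoord (f y).1) z 1 /\ derivable (rcoord \o f) z 1].

Definition holomorphic_immersion_to_Q (D : set CC) (f : CC -> R3 * 'M[R]_3) :=
  holomorphic_to_Q D f /\
  forall z, D z ->
    ((f z).1 <> - e3 ->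
       'D_1 (fun y => ucoord (f y).1) z <> 0 \/ 'D_1 (qcoord \o f) z <> 0) /\
    ((f z).1 <> e3 ->
       'D_1 (fun y => vcoord (f y).1) z <> 0 \/ 'D_1 (rcoord \o f) z <> 0).

Definition local_param (C : set (R3 * 'M[R]_3)) (U : set (R * R))
    (phi : R * R -> R3 * 'M[R]_3) :=
  [/\ open U, smooth_on U phi, forall x, U x -> immersion_at phi x
    & open_embedding_in U phi C].

Definition real_surface_in (C : set (R3 * 'M[R]_3)) :=
  forall p, C p -> exists U phi, local_param C U phi /\ (phi @` U) p.

Definition omega_closed_on (C : set (R3 * 'M[R]_3)) :=
  forall U phi, local_param C U phi ->
    closed_form_on U (fun x h => omega (phi x) ('D_h phi x)).

(* Complex submanifolds of Q of complex dimension one. *)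
Definition complex_analytic_curve (C : set (R3 * 'M[R]_3)) :=
  forall p, C p -> exists (D : set CC) (psi : CC -> R3 * 'M[R]_3),
    [/\ open D, holomorphic_immersion_to_Q D psi, open_embedding_in D psi C
      & (psi @` D) p].

End Bundle.

Section Surface.
Variables (R : realType) (M : topologicalType).
Local Notation R3 := 'cV[R]_3.
Local Notation CC := (R[i]^o).

Record chart := Chart {
  chart_dom : set M;
  chart_cod : set CC;
  chart_coord : M -> CC;
  chart_param : CC -> M }.

Definition is_chart (c : chart) :=
  [/\ open (chart_dom c), open (chart_cod c),
      forall x, chart_dom c x ->
        [/\ chart_cod c (chart_coord c x), chart_param c (chart_coord c x) = x
          & {for x, continuous (chart_coord c)}]
    & forall z, chart_cod c z ->
        [/\ chart_dom c (chart_param c z), chart_coord c (chart_param c z) = z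
          & {for z, continuous (chart_param c)}]].

Definition riemann_surface (At : set chart) :=
  [/\ hausdorff_space M, @second_countable M,
      forall c, At c -> is_chart c,
      forall x, exists2 c, At c & chart_dom c x
    & forall c c', At c -> At c' ->
        forall z, chart_cod c z -> chart_dom c' (chart_param c z) ->
          derivable (chart_coord c' \o chart_param c) z 1].

Variable At : set chart.

Definition in_chart (T : Type) (c : chart) (f : M -> T) : R * R -> T :=
  f \o chart_param c \o @toC R.

Definition smooth_map (W : normedModType R) (f : M -> W) :=
  forall c, At c -> smooth_on (@toC R @^-1` chart_cod c) (in_chart c f).

Definition smooth_immersion (X : M -> R3) :=
  smooth_map X /\
  forall c, At c -> forall x, chart_cod c (toC x) -> immersion_at (in_chart c X) x.

(* An orientation of the immersed surface X is a choice of smooth unit normal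
   field. *)
Definition gauss_map (X n : M -> R3) :=
  [/\ smooth_map n, forall p, sphere (n p)
    & forall c, At c -> forall x, chart_cod c (toC x) ->
        forall h, tangent (in_chart c n x) ('D_h (in_chart c X) x)].

(* A p is T_p n as an endomorphism of T_p M = n(p)^⊥, extended by 0 to R^3:
   A (dX h) = dn h. *)
Definition gauss_differential (X n : M -> R3) (A : M -> 'M[R]_3) :=
  (forall p, A p *m n p = 0) /\
  forall c, At c -> forall x, chart_cod c (toC x) ->
    forall h, in_chart c A x *m 'D_h (in_chart c X) x = 'D_h (in_chart c n) x.

Definition minimal (A : M -> 'M[R]_3) := forall p, \tr (A p) = 0.

Definition analytic_to_S (f : M -> R3) :=
  forall c, At c -> holomorphic_to_S (chart_cod c) (f \o chart_param c).

Definition analytic_to_Q (f : M -> R3 * 'M[R]_3) :=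
  forall c, At c -> holomorphic_to_Q (chart_cod c) (f \o chart_param c).

End Surface.

(* Main.v *)
Require Import Defs.
From mathcomp Require Import all_boot all_order all_algebra.
From mathcomp Require Import all_classical all_reals all_analysis.
From mathcomp Require Import complex.
From mathcomp Require Import ring lra.
Import Order.TTheory GRing.Theory Num.Theory.
Import numFieldNormedType.Exports.

Set Implicit Arguments.
Unset Strict Implicit.
Unset Printing Implicit Defensive.

Local Open Scope classical_set_scope.
Local Open Scope ring_scope.

(** The two parts rest on one computation: in complex coordinates, the form
    omega is closed on a surface exactly when dq /\ du = 0 there, which is a
    Cauchy-Riemann equation.

    The isotropic vector w(u) = (1 - u^2, i (1 + u^2), 2 u) has real and
    imaginary parts that are tangent to the sphere at s(u), orthogonal, and both
    of length 1 + |u|^2. A symmetric trace-zero A on the tangent plane is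
    therefore determined by the complex number q = w^T A w / 2, and inverting A in
    this frame gives omega = Re ((- 2 du / q) w(u)) [tangent_inv_complex]. As w is
    a holomorphic function of u, its differential contributes nothing to the
    exterior derivative, d omega = Re (2 q^-2 (dq /\ du) w), and Re (c w) = 0 only
    for c = 0 [exterior_derivative_inv]. The chart at the other pole is the image
    of the first one under the rotation by pi around e1; a boolean distinguishes
    the two charts and every computation is done for both at once. The
    transition v = 1/u, r = q/u^4 follows from w(1/u) = - u^-2 w(u) (the left side
    in the other chart) and from the fact that q is quadratic in w.

    First part. On a parametrized surface, dq /\ du = 0 says that the tangent
    planes are complex lines in the coordinates (u, q). If so, one of u and q is
    a local diffeomorphism of the surface, because the parametrization is an
    immersion, and taking it as the new parameter makes the other one holomorphic
    [holomorphic_local_inverse, closed_to_curve]. Conversely, let psi be a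
    holomorphic parametrization of C. Since psi is a homeomorphism onto its image,
    each point of the surface near psi(z) is psi(w) with w near z, and comparing
    first-order expansions gives u'(z) dq = q'(z) du [dependent_of_holomorphic,
    curve_to_closed].

    Second part. In a chart of M, dn = n' dX, so that omega pulled back by
    (n, n') is dX wherever n' is nonzero; this is closed, so dq /\ du = 0, and as
    u is holomorphic with nonzero derivative there, q is holomorphic as well
    [chart_q_CR_regular]. Where n' vanishes on an open set, q = 0. These two open
    sets have a dense union and the Cauchy-Riemann defect of q is continuous,
    hence it vanishes everywhere [chart_q_CR]. That n' takes values in the bundle
    and is continuously differentiable is read off from its expression in the
    basis X_x, X_y, n and the dual basis; its symmetry is that of the second
    derivatives of X. *)

(** * Smooth maps and the mean value theorem *)

Section ClassC.
Context {R : realType} {V : normedModType R}.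

Lemma continuous_ext {W : topologicalType} (U : set V) (f g : V -> W) x :
  open U -> (forall x, U x -> f x = g x) -> U x ->
  {for x, continuous f} -> {for x, continuous g}.
Proof.
move=> oU fg Ux; rewrite /prop_for /continuous_at -(fg x Ux) => cf.
apply: cvg_trans cf; apply: near_eq_cvg.
by apply: filterS (open_nbhs_nbhs (conj oU Ux)) => y /fg ->.
Qed.

Lemma class_C_ext {W : normedModType R} k (U : set V) (f g : V -> W) :
  open U -> (forall x, U x -> f x = g x) -> class_C k U f -> class_C k U g.
Proof.
move=> oU; elim: k f g => [|k IH] f g fg /= [cf Hf].
  by split=> // x Ux; exact: continuous_ext oU fg Ux (cf x Ux).
split; first by move=> x Ux; exact: continuous_ext oU fg Ux (cf x Ux).
move=> h; have [df dC] := Hf h.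
have fgx x : U x -> \near x, f x = g x.
  by move=> Ux; apply: filterS (open_nbhs_nbhs (conj oU Ux)) => y; exact: fg.
split=> [x Ux|]; first by apply: near_eq_derivable (df x Ux); exact: fgx.
by apply: IH dC => x Ux; apply: near_eq_derive; exact: fgx.
Qed.

Lemma class_CW {W : normedModType R} k (U : set V) (f : V -> W) :
  class_C k.+1 U f -> class_C k U f.
Proof.
elim: k f => [|k IH] f [cf Hf]; first by split.
by split=> // h; have [df dC] := Hf h; split=> //; exact: IH.
Qed.

Lemma class_C_cst {W : normedModType R} k (U : set V) (a : W) :
  class_C k U (fun=> a).
Proof.
elim: k a => [|k IH] a; split=> //; do ?by move=> x _; exact: cvg_cst.
move=> h; split=> [x _|]; first exact: derivable_cst.
have -> : (fun x : V => 'D_h (fun=> a) x) = (fun=> 0); last exact: IH.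
by apply/funext => x; rewrite derive_cst.
Qed.

Lemma class_CD {W : normedModType R} k (U : set V) (f g : V -> W) : open U ->
  class_C k U f -> class_C k U g -> class_C k U (fun x => f x + g x).
Proof.
move=> oU; elim: k f g => [|k IH] f g [cf Hf] [cg Hg]; split=> //.
- by move=> x Ux; apply: cvgD; [exact: cf|exact: cg].
- by move=> x Ux; apply: cvgD; [exact: cf|exact: cg].
move=> h; have [df dCf] := Hf h; have [dg dCg] := Hg h.
split=> [x Ux|]; first by apply: derivableD; [exact: df|exact: dg].
apply: (class_C_ext (f := fun x => 'D_h f x + 'D_h g x)) => //.
  by move=> x Ux; rewrite -deriveD//; [exact: df|exact: dg].
exact: IH.
Qed.

Lemma class_CM k (U : set V) (f g : V -> R) : open U ->
  class_C k U f -> class_C k U g -> class_C k U (fun x => f x * g x).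
Proof.
move=> oU; elim: k f g => [|k IH] f g Cf Cg.
  by split=> // x Ux; apply: cvgM; [exact: Cf.1|exact: Cg.1].
have [cf Hf] := Cf; have [cg Hg] := Cg.
split=> [x Ux|h]; first by apply: cvgM; [exact: cf|exact: cg].
have [df dCf] := Hf h; have [dg dCg] := Hg h.
split=> [x Ux|]; first by apply: derivableM; [exact: df|exact: dg].
apply: (class_C_ext (f := fun x => f x * 'D_h g x + g x * 'D_h f x)) => //.
  by move=> x Ux; rewrite deriveM//; [exact: df|exact: dg].
by apply: class_CD => //; apply: IH => //; exact: class_CW.
Qed.

Lemma class_CN k (U : set V) (f : V -> R) : open U ->
  class_C k U f -> class_C k U (fun x => - f x).
Proof.
move=> oU Cf; apply: (class_C_ext (f := fun x => (-1) * f x)) => //.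
  by move=> x _; rewrite mulN1r.
by apply: class_CM => //; exact: class_C_cst.
Qed.

Lemma class_CV k (U : set V) (f : V -> R) : open U ->
  (forall x, U x -> f x != 0) ->
  class_C k U f -> class_C k U (fun x => (f x)^-1).
Proof.
move=> oU f0; elim: k => [|k IH] Cf.
  by split=> // x Ux; apply: cvgV; [exact: f0|exact: Cf.1].
have [cf Hf] := Cf.
split=> [x Ux|h]; first by apply: cvgV; [exact: f0|exact: cf].
have [df dCf] := Hf h.
split=> [x Ux|]; first by apply: derivableV; [exact: f0|exact: df].
apply: (class_C_ext (f := fun x => - ((f x)^-1 * (f x)^-1 * 'D_h f x))) => //.
  move=> x Ux; rewrite deriveV//; [|exact: f0|exact: df].
  by rewrite expr2 invfM scaleNr.
have Cf' : class_C k U (fun x => (f x)^-1) by apply: IH; exact: class_CW.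
by apply: class_CN => //; apply: class_CM => //; exact: class_CM.
Qed.

Lemma derive_linear {W W' : normedModType R} (l : {linear W -> W'}) (f : V -> W) x h :
  continuous l -> derivable f x h ->
  derivable (fun y => l (f y)) x h /\ 'D_h (fun y => l (f y)) x = l ('D_h f x).
Proof.
move=> cl df.
have H : (fun t => t^-1 *: (l (f (t *: h + x)) - l (f x))) @ 0^' --> l ('D_h f x).
  have -> : (fun t => t^-1 *: (l (f (t *: h + x)) - l (f x))) =
            l \o (fun t => t^-1 *: (f (t *: h + x) - f x)).
    by apply/funext => t /=; rewrite -linearB -linearZ_LR.
  by apply: continuous_cvg; [exact: cl|exact: df].
by split; [apply/cvg_ex; exists (l ('D_h f x))|exact: cvg_lim].
Qed.

Lemma class_C_linear {W W' : normedModType R} k (U : set V)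
    (l : {linear W -> W'}) (f : V -> W) : open U ->
  continuous l -> class_C k U f -> class_C k U (fun x => l (f x)).
Proof.
move=> oU cl; elim: k f => [|k IH] f [cf Hf]; split=> //.
- by move=> x Ux; apply: continuous_cvg; [exact: cl|exact: cf].
- by move=> x Ux; apply: continuous_cvg; [exact: cl|exact: cf].
move=> h; have [df dCf] := Hf h.
split=> [x Ux|]; first by have [] := derive_linear cl (df x Ux).
apply: (class_C_ext (f := fun x => l ('D_h f x))) => //; last exact: IH.
by move=> x Ux; have [_ ->] := derive_linear cl (df x Ux).
Qed.

Lemma directional_MVT (f : V -> R) (x h : V) (t : R) : 0 < t ->
  (forall s, 0 <= s <= t -> derivable f (s *: h + x) h) ->
  exists2 c, 0 < c < t & f (t *: h + x) - f x = t * 'D_h f (c *: h + x).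
Proof.
move=> t0 df; pose g s := f (s *: h + x).
have dg s : 0 <= s <= t -> is_derive s 1 g ('D_h f (s *: h + x)).
  move=> /df dfs.
  have E : (fun r => r^-1 *: (g (r *: (1 : R) + s) - g s)) =
           (fun r => r^-1 *: (f (r *: h + (s *: h + x)) - f (s *: h + x))).
    by apply/funext => r; rewrite /g [_%:A]mulr1 scalerDl addrA.
  by apply: DeriveDef; rewrite /derivable /derive /= E.
have [||c] := @MVT R g (fun s => 'D_h f (s *: h + x)) 0 t t0.
- by move=> s; rewrite in_itv/= => /andP[? ?]; apply: dg; rewrite !ltW.
- apply: derivable_within_continuous => s; rewrite in_itv/= => Hs.
  by have [] := dg s Hs.
- by rewrite in_itv/= /g scale0r add0r subr0 mulrC; exists c.
Qed.

End ClassC.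

(** * Symmetry of second derivatives *)

Section Schwarz.
Context {R : realType} {V : normedModType R}.

Lemma directional_MVT_signed (f : V -> R) (x h : V) (t : R) :
  (forall s, `|s| <= `|t| -> derivable f (s *: h + x) h) ->
  exists2 c, `|c| <= `|t| & f (t *: h + x) - f x = t * 'D_h f (c *: h + x).
Proof.
move=> df; have [t0|t0|->] := ltgtP t 0; last first.
- by exists 0 => //; rewrite scale0r add0r subrr mul0r.
- have [|c /andP[c0 ct] E] := @directional_MVT R V f x h t t0.
    by move=> s /andP[s0 st]; apply: df; rewrite !ger0_norm // ltW.
  by exists c => //; rewrite !ger0_norm ?ltW.
have nt0 : 0 < - t by rewrite oppr_gt0.
have [|c /andP[c0 ct] E] := @directional_MVT R V f (t *: h + x) h (- t) nt0.
  move=> s /andP[s0 st]; rewrite addrA -scalerDl; apply: df.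
  by rewrite (ltr0_norm t0) ler_norml; apply/andP; split; lra.
exists (c + t); first by rewrite (ltr0_norm t0) ler_norml; apply/andP; split; lra.
move: E; rewrite !addrA -!scalerDl addNr scale0r add0r => E.
by rewrite -opprB E mulNr opprK.
Qed.

Lemma derivable_translate (f : V -> R) (a x h : V) :
  derivable f (a + x) h -> derivable (fun y => f (a + y)) x h /\
  'D_h (fun y => f (a + y)) x = 'D_h f (a + x).
Proof.
have E : (fun r : R => r^-1 *: (f (a + (r *: h + x)) - f (a + x))) =
         (fun r => r^-1 *: (f (r *: h + (a + x)) - f (a + x))).
  by apply/funext => r; rewrite addrCA.
by rewrite /derivable /derive /= E.
Qed.

(** Two applications of the mean value theorem: one to y |-> f (t k + y) - f y in
    the direction h, one to f1 in the direction k. The second difference is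
    symmetric in h and k, which is the source of the symmetry of second
    derivatives. *)
Lemma second_difference (f f1 f12 : V -> R) (x h k : V) (t : R) (U : set V) :
  0 < t ->
  (forall r s, 0 <= r <= t -> 0 <= s <= t -> U (r *: k + (s *: h + x))) ->
  (forall y, U y -> is_derive y h f (f1 y)) ->
  (forall y, U y -> is_derive y k f1 (f12 y)) ->
  exists r s, [/\ 0 < r < t, 0 < s < t &
    f (t *: k + (t *: h + x)) - f (t *: h + x) - (f (t *: k + x) - f x) =
    t * (t * f12 (r *: k + (s *: h + x)))].
Proof.
move=> t0 HU df ddf.
have t0t : 0 <= t <= t by rewrite lexx ltW.
have o0t : 0 <= (0 : R) <= t by rewrite lexx ltW.
pose F y := f (t *: k + y) - f y.
have dF s : 0 <= s <= t -> is_derive (s *: h + x) h F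
    (f1 (t *: k + (s *: h + x)) - f1 (s *: h + x)).
  move=> Hs.
  have [dU eU] := df _ (HU _ _ t0t Hs).
  have [d1 e1] := derivable_translate dU.
  have [d2 e2] : is_derive (s *: h + x) h f (f1 (s *: h + x)).
    by apply: df; have := HU _ _ o0t Hs; rewrite scale0r add0r.
  apply: DeriveDef; first by apply: derivableB; [exact: d1|exact: d2].
  rewrite deriveB; [|exact: d1|exact: d2].
  by rewrite e1 eU e2.
have [|s Hs E] := @directional_MVT R V F x h t t0; first by move=> s /dF[].
have Hs' : 0 <= s <= t by case/andP: Hs => *; rewrite !ltW.
move: E; rewrite (@derive_val _ _ _ _ _ _ _ (dF s Hs')) {1 2}/F => E.
have [|r Hr E2] := @directional_MVT R V f1 (s *: h + x) k t t0.
  by move=> r Hr; have [] := ddf _ (HU _ _ Hr Hs').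
have Hr' : 0 <= r <= t by case/andP: Hr => *; rewrite !ltW.
exists r, s; split=> //; rewrite E E2.
by rewrite (@derive_val _ _ _ _ _ _ _ (ddf _ (HU _ _ Hr' Hs'))).
Qed.

Lemma continuous_dist {T : topologicalType} {K : numFieldType} {W : normedModType K}
    (f : T -> W) (x : T) (e : K) :
  {for x, continuous f} -> 0 < e -> \forall y \near x, `|f x - f y| < e.
Proof. by move=> cf e0; move/cvgrPdist_lt: cf => /(_ _ e0). Qed.

Lemma near_neq0 {T : topologicalType} {K : numFieldType} {W : normedModType K}
    (f : T -> W) (x : T) :
  {for x, continuous f} -> f x != 0 -> \forall y \near x, f y != 0.
Proof.
move=> cf; rewrite -normr_gt0 => f0; apply: filterS (continuous_dist cf f0) => y.
by apply: contraTneq => ->; rewrite subr0 ltxx.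
Qed.

(** Both mixed derivatives are limits of the same second difference divided by
    the square of t. *)
Lemma mixed_derivatives_comm (U : set V) (f f1 f2 f12 f21 : V -> R) (x h k : V) :
  nbhs x U ->
  (forall y, U y -> is_derive y h f (f1 y)) ->
  (forall y, U y -> is_derive y k f (f2 y)) ->
  (forall y, U y -> is_derive y k f1 (f12 y)) ->
  (forall y, U y -> is_derive y h f2 (f21 y)) ->
  {for x, continuous f12} -> {for x, continuous f21} -> f12 x = f21 x.
Proof.
move=> nU df1 df2 df12 df21 c12 c21.
apply/eqP; rewrite -subr_eq0 -normr_le0; apply/ler_addgt0Pl => e e0; rewrite addr0.
have e20 : 0 < e / 2 by rewrite divr_gt0.
have : \forall y \near x,
    [/\ U y, `|f12 x - f12 y| < e / 2 & `|f21 x - f21 y| < e / 2].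
  by apply: filterS3 nU (continuous_dist c12 e20) (continuous_dist c21 e20).
move=> /nbhs_ballP[d /= d0 Hd].
(* The parallelogram with sides t h and t k fits into the ball of radius d. *)
pose t := d / (`|h| + `|k| + 1) / 2.
have N0 : 0 < `|h| + `|k| + 1 by rewrite ltr_wpDl // addr_ge0.
have t0 : 0 < t by rewrite /t !divr_gt0.
have tN : t * (`|h| + `|k|) < d.
  rewrite /t mulrAC ltr_pdivrMr // mulrAC ltr_pdivrMr //.
  have hk0 : 0 <= `|h| + `|k| by rewrite addr_ge0.
  rewrite -mulrA ltr_pM2l //; lra.
have HB r s : 0 <= r <= t -> 0 <= s <= t -> ball x d (r *: k + (s *: h + x)).
  move=> /andP[r0 rt] /andP[s0 st].
  rewrite -ball_normE /= addrA opprD addrCA subrr addr0 normrN.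
  rewrite (le_lt_trans (ler_normD _ _)) // !normrZ !ger0_norm //.
  by rewrite (le_lt_trans _ tN) // mulrDr addrC lerD // ler_wpM2r.
have [|||r [s [Hr Hs E1]]] :=
  @second_difference f f1 f12 x h k t (ball x d) t0.
- exact: HB.
- by move=> y /Hd[Uy _ _]; exact: df1.
- by move=> y /Hd[Uy _ _]; exact: df12.
have [|||r' [s' [Hr' Hs' E2]]] :=
  @second_difference f f2 f21 x k h t (ball x d) t0.
- by move=> r' s' Hr' Hs'; rewrite addrCA; exact: HB.
- by move=> y /Hd[Uy _ _]; exact: df2.
- by move=> y /Hd[Uy _ _]; exact: df21.
have W a : 0 < a < t -> 0 <= a <= t by move=> /andP[? ?]; rewrite !ltW.
have [_ B1 _] := Hd _ (HB _ _ (W _ Hr) (W _ Hs)).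
have := Hd _ (HB _ _ (W _ Hs') (W _ Hr')); rewrite addrCA => -[_ _ B2].
have E : f12 (r *: k + (s *: h + x)) = f21 (r' *: h + (s' *: k + x)).
  have tn0 : t != 0 by rewrite gt_eqF.
  apply: (mulfI tn0); apply: (mulfI tn0).
  by apply: etrans (esym E1) (etrans _ E2); rewrite (addrCA (t *: k)); ring.
rewrite distrC in B2; rewrite E in B1.
rewrite -(subrKA (f21 (r' *: h + (s' *: k + x)))).
by rewrite (le_trans (ler_normD _ _)) // [leRHS](splitr e) lerD // ltW //.
Qed.

Lemma derive_comm (U : set V) (f : V -> R) (x h k : V) :
  open U -> class_C 2 U f -> U x ->
  'D_h (fun y => 'D_k f y) x = 'D_k (fun y => 'D_h f y) x.
Proof.
move=> oU [_ C2] Ux.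
have [dfh [cfh /(_ k)[dfhk [cfhk _]]]] := C2 h.
have [dfk [cfk /(_ h)[dfkh [cfkh _]]]] := C2 k.
apply: (@mixed_derivatives_comm U f (fun y => 'D_k f y) (fun y => 'D_h f y)
  (fun y => 'D_h (fun y => 'D_k f y) y) (fun y => 'D_k (fun y => 'D_h f y) y) x k h).
- exact: open_nbhs_nbhs.
- by move=> y Uy; apply: derivableP; exact: dfk.
- by move=> y Uy; apply: derivableP; exact: dfh.
- by move=> y Uy; apply: derivableP; exact: dfkh.
- by move=> y Uy; apply: derivableP; exact: dfhk.
- exact: cfkh.
- exact: cfhk.
Qed.

End Schwarz.

(** * Strict differentiability in the plane *)

Section StrictDerivative.
Context {R : realType}.
Implicit Types (f : R * R -> R) (x y : R * R).

Lemma prod_norm_le (p : R * R) (e : R) : (`|p| <= e) = (`|p.1| <= e) && (`|p.2| <= e).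
Proof. by rewrite prod_normE ge_max. Qed.

Lemma prod_norm_lt (p : R * R) (e : R) : (`|p| < e) = (`|p.1| < e) && (`|p.2| < e).
Proof. by rewrite prod_normE gt_max. Qed.

Lemma prod_norm_ge (p : R * R) : `|p.1| <= `|p| /\ `|p.2| <= `|p|.
Proof. by apply/andP; rewrite -prod_norm_le. Qed.

(** The strong form of differentiability, in which both points vary: unlike the
    ordinary one it makes a map with invertible differential injective near x. *)
Definition strictly_differentiable f x (a b : R) := forall e, 0 < e ->
  exists2 d, 0 < d & forall y y', ball x d y -> ball x d y' ->
    `|f y - f y' - ((y.1 - y'.1) * a + (y.2 - y'.2) * b)| <= e * `|y - y'|.

(** The difference f y - f y' is split along the corner (y'.1, y.2), and each half
    is a partial derivative at a nearby point by the mean value theorem. *)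
Lemma class_C_strictly_differentiable (U : set (R * R)) f x :
  open U -> class_C 1 U f -> U x ->
  strictly_differentiable f x ('D_(1, 0) f x) ('D_(0, 1) f x).
Proof.
move=> oU [_ C1] Ux e e0.
have [df1 [c1 _]] := C1 (1, 0); have [df2 [c2 _]] := C1 (0, 1).
pose D1 y : R := 'D_(1, 0) f y; pose D2 y : R := 'D_(0, 1) f y.
have {}c1 : {for x, continuous D1} := c1 x Ux.
have {}c2 : {for x, continuous D2} := c2 x Ux.
have e20 : 0 < e / 2 by rewrite divr_gt0.
have : \forall y \near x,
    [/\ U y, `|D1 x - D1 y| < e / 2 & `|D2 x - D2 y| < e / 2].
  apply: filterS3 (open_nbhs_nbhs (conj oU Ux))
    (continuous_dist c1 e20) (continuous_dist c2 e20) => y Uy b1 b2.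
  by split; [exact: Uy|exact: b1|exact: b2].
move=> /nbhs_ballP[r /= r0 Hr].
exists (r / 3); first by rewrite divr_gt0.
move=> y y'; rewrite -!ball_normE /= !prod_norm_lt /= => /andP[y1 y2] /andP[y1' y2'].
have n1 : `|y.1 - y'.1| < 2 * r / 3.
  by rewrite -(subrKA x.1) (le_lt_trans (ler_normD _ _)) // distrC; lra.
have n2 : `|y.2 - y'.2| < 2 * r / 3.
  by rewrite -(subrKA x.2) (le_lt_trans (ler_normD _ _)) // distrC; lra.
(* With y and y' within r/3 of x, both legs of the corner stay within r of x. *)
have B1 c : `|c| <= `|y.1 - y'.1| -> ball x r (c *: (1, 0) + (y'.1, y.2)).
  move=> Hc; rewrite -ball_normE /= prod_norm_lt /=; apply/andP; split.
    rewrite [_%:A]mulr1 opprD addrCA addrC.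
    rewrite (le_lt_trans (ler_normB _ _)) //; lra.
  by rewrite scaler0 add0r; lra.
have B2 c : `|c| <= `|y.2 - y'.2| -> ball x r (c *: (0, 1) + (y'.1, y'.2)).
  move=> Hc; rewrite -ball_normE /= prod_norm_lt /=; apply/andP; split.
    by rewrite scaler0 add0r; lra.
  rewrite [_%:A]mulr1 opprD addrCA addrC.
  by rewrite (le_lt_trans (ler_normB _ _)) //; lra.
have [|c Hc] := @directional_MVT_signed R _ f (y'.1, y.2) (1, 0) (y.1 - y'.1).
  by move=> c /B1 /Hr[Uc _ _]; exact: df1.
have -> : (y.1 - y'.1) *: (1, 0) + (y'.1, y.2) = y.
  by case: (y) => s t; congr pair => /=; rewrite ?scaler0 ?add0r // [_%:A]mulr1 subrK.
rewrite -/(D1 _) => E1.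
have [|c' Hc'] := @directional_MVT_signed R _ f (y'.1, y'.2) (0, 1) (y.2 - y'.2).
  by move=> c' /B2 /Hr[Uc _ _]; exact: df2.
have -> : (y.2 - y'.2) *: (0, 1) + (y'.1, y'.2) = (y'.1, y.2).
  by congr pair => /=; rewrite ?scaler0 ?add0r // [_%:A]mulr1 subrK.
rewrite -surjective_pairing -/(D2 _) => E2.
have [_ b1 _] := Hr _ (B1 _ Hc); have [_ _] := Hr _ (B2 _ Hc').
rewrite -surjective_pairing => b2; rewrite -/(D1 x) -/(D2 x).
move: (D1 _) (D1 x) (D2 _) (D2 x) E1 E2 b1 b2 => u a v b E1 E2 ua vb.
have [N1 N2] := prod_norm_ge (y - y').
have ET : f y - f y' - ((y.1 - y'.1) * a + (y.2 - y'.2) * b) =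
    (y.1 - y'.1) * (u - a) + (y.2 - y'.2) * (v - b).
  have -> : f y - f y' = (f y - f (y'.1, y.2)) + (f (y'.1, y.2) - f y') by ring.
  by rewrite E1 E2; ring.
suff : `|(y.1 - y'.1) * (u - a) + (y.2 - y'.2) * (v - b)| <= e * `|y - y'|.
  by rewrite -ET.
rewrite (le_trans (ler_normD _ _)) // !normrM (distrC u) (distrC v).
rewrite [e](splitr e) mulrDl mulrC; apply: lerD.
  by apply: ler_pM => //; exact: ltW.
by rewrite mulrC; apply: ler_pM => //; exact: ltW.
Qed.

Lemma strictly_differentiable_derive f x a b h : strictly_differentiable f x a b ->
  is_derive x h f (h.1 * a + h.2 * b).
Proof.
move=> sf.
have H : (fun t => t^-1 *: (f (t *: h + x) - f x)) @ 0^' --> h.1 * a + h.2 * b.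
  apply/cvgrPdist_le => e e0.
  have N0 : 0 < `|h| + 1 by rewrite ltr_wpDl.
  have [d d0 Hd] := sf _ (divr_gt0 e0 N0).
  near=> t.
  have t0 : t != 0 by near: t; exact: nbhs_dnbhs_neq.
  have bt : ball x d (t *: h + x).
    rewrite -ball_normE /= opprD addrCA subrr addr0 normrN normrZ.
    have : `|t| < d / (`|h| + 1).
      by near: t; apply: dnbhs0_lt; rewrite divr_gt0.
    rewrite ltr_pdivlMr // => /le_lt_trans; apply.
    by rewrite ler_wpM2l // lerDl.
  have := Hd _ _ bt (ballxx _ d0).
  rewrite [X in e / _ * `|X|]addrK /= !addrK => Ht.
  have -> : h.1 * a + h.2 * b - t^-1 *: (f (t *: h + x) - f x) =
     - (t^-1 * (f (t *: h + x) - f x - (t *: h.1 * a + t *: h.2 * b))).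
    rewrite /GRing.scale /=; field; exact: t0.
  rewrite normrN normrM normfV ler_pdivrMl ?normr_gt0 // (le_trans Ht) //.
  rewrite normrZ mulrCA ler_wpM2l // mulrAC ler_pdivrMr // ler_wpM2l ?ltW //.
  by rewrite ltrDl.
by apply: DeriveDef; [apply/cvg_ex; exists (h.1 * a + h.2 * b)|exact: cvg_lim].
Unshelve. all: by end_near. Qed.

Lemma class_C_deriveE (U : set (R * R)) f x h :
  open U -> class_C 1 U f -> U x ->
  'D_h f x = h.1 * 'D_(1, 0) f x + h.2 * 'D_(0, 1) f x.
Proof.
move=> oU C1 Ux.
by have [] := strictly_differentiable_derive h (class_C_strictly_differentiable oU C1 Ux).
Qed.

End StrictDerivative.

(** * Local inverses in the plane *)

Section LocalInverse.
Context {R : realType}.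
Implicit Types (x y : R * R).

(** The closed ball of the sup norm is a compact square, so the displacement
    |T p - p| has a minimum on it; the contraction property makes it at least
    halve at T p, so the minimum is zero. *)
Lemma contraction_fixpoint_on_square (T : R * R -> R * R) (y : R * R) (r : R) :
  0 <= r ->
  (forall p, `|y - p| <= r -> `|y - T p| <= r) ->
  (forall p p', `|y - p| <= r -> `|y - p'| <= r ->
     `|T p - T p'| <= 2^-1 * `|p - p'|) ->
  (forall p, `|y - p| <= r -> {for p, continuous T}) ->
  exists2 p, `|y - p| <= r & T p = p.
Proof.
move=> r0 TB TL Tc.
pose B : set (R * R) := `[y.1 - r, y.1 + r] `*` `[y.2 - r, y.2 + r].
have BE p : B p <-> `|y - p| <= r.
  rewrite prod_norm_le /B /= !in_itv /= !ler_norml.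
  split=> [[/andP[? ?] /andP[? ?]]|/andP[/andP[? ?] /andP[? ?]]].
    by apply/andP; split; apply/andP; split; lra.
  by split; apply/andP; split; lra.
pose psi p := `|T p - p|.
have [|||c] := @compact_EVT_min _ R psi B.
- by exists y; apply/BE; rewrite subrr normr0.
- by apply: compact_setX; exact: segment_compact.
- apply: continuous_in_subspaceT => p; rewrite inE => /BE Bp.
  apply: cvg_norm; apply: cvgB; first exact: Tc.
  exact: cvg_id.
rewrite inE => /BE Bc Hc; exists c => //.
have BTc := TB _ Bc.
have := Hc (T c); rewrite inE => /(_ ((BE _).2 BTc)).
have := TL _ _ BTc Bc; rewrite -/(psi c) -/(psi (T c)) => H1 H2.
have psi0 : psi c <= 0 by move: (normr_ge0 (T c - c)); rewrite -/(psi c); lra.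
by apply/eqP; rewrite -subr_eq0 -normr_le0.
Qed.

(** The inverse function theorem in the plane. With L the inverse of the
    differential at x, the map y |-> y - L (g y) contracts near x; this gives both
    the injectivity, with the Lipschitz bound K for the inverse, and, as a fixed
    point of y |-> y - L (g y) + L z, a preimage of z in any small ball. *)
Lemma local_inverse (g1 g2 : R * R -> R) x (a b c d : R) :
  strictly_differentiable g1 x a b -> strictly_differentiable g2 x c d ->
  a * d - b * c != 0 ->
  exists dlt K : R, [/\ 0 < dlt, 0 < K,
    forall y y', ball x dlt y -> ball x dlt y' ->
      `|y - y'| <= K * `|(g1 y - g1 y', g2 y - g2 y')| &
    forall y (r : R), ball x dlt y -> 0 < r -> exists2 eta : R, 0 < eta &
      forall z1 z2 : R, `|g1 y - z1| < eta -> `|g2 y - z2| < eta ->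
      exists y', [/\ ball x dlt y', ball y r y', g1 y' = z1 & g2 y' = z2]].
Proof.
move=> sg1 sg2; set D := a * d - b * c => D0.
pose Li (p : R * R) : R * R := ((d * p.1 - b * p.2) / D, (a * p.2 - c * p.1) / D).
pose M := (`|a| + `|b| + `|c| + `|d|) / `|D| + 1.
have M0 : 0 < M by rewrite /M ltr_wpDl // divr_ge0 // !addr_ge0.
have LM p e : `|p| <= e -> `|Li p| <= M * e.
  rewrite prod_norm_le => /andP[p1 p2].
  have e0 : 0 <= e by exact: le_trans p1.
  have DD : 0 < `|D| by rewrite normr_gt0.
  have HM s t : s <= (`|a| + `|b| + `|c| + `|d|) * e -> s / `|D| <= M * e.
    move=> Hs; rewrite /M mulrDl mul1r mulrAC.
    rewrite (@le_trans _ _ ((`|a| + `|b| + `|c| + `|d|) * e / `|D|)) ?lerDl //.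
    by rewrite ler_pM2r ?invr_gt0.
  have mle (u v : R) : `|v| <= e -> `|u * v| <= `|u| * e.
    by move=> Hv; rewrite normrM ler_wpM2l.
  have abs0 (u : R) : 0 <= `|u| * e by rewrite mulr_ge0.
  rewrite prod_norm_le /= !normrM normfV; apply/andP; split; apply: HM => //.
    rewrite (le_trans (ler_normB _ _)) //.
    have := mle d _ p1; have := mle b _ p2; have := abs0 a; have := abs0 c; lra.
  rewrite (le_trans (ler_normB _ _)) //.
  have := mle a _ p2; have := mle c _ p1; have := abs0 b; have := abs0 d; lra.
(* M bounds the norm of L, so the error (2 M)^-1 yields a contraction by 1/2. *)
have e0 : 0 < (2 * M)^-1 by rewrite invr_gt0 mulr_gt0.
have [d1 d10 H1] := sg1 _ e0; have [d2 d20 H2] := sg2 _ e0.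
pose dlt := Num.min d1 d2.
have dlt0 : 0 < dlt by rewrite lt_min d10.
have b1 y : ball x dlt y -> ball x d1 y.
  by apply: le_ball; rewrite ge_min lexx.
have b2 y : ball x dlt y -> ball x d2 y.
  by apply: le_ball; rewrite ge_min lexx orbT.
pose g y : R * R := (g1 y, g2 y).
pose k y : R * R := y - Li (g y).
have kL y y' : ball x dlt y -> ball x dlt y' -> `|k y - k y'| <= 2^-1 * `|y - y'|.
  move=> By By'.
  pose E : R * R := (g1 y - g1 y' - ((y.1 - y'.1) * a + (y.2 - y'.2) * b),
                     g2 y - g2 y' - ((y.1 - y'.1) * c + (y.2 - y'.2) * d)).
  have -> : k y - k y' = - Li E.
    by rewrite /k /g /Li /E /D; congr pair => /=; field.
  rewrite normrN (le_trans (LM _ ((2 * M)^-1 * `|y - y'|) _)) //.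
    by rewrite prod_norm_le /= H1 ?H2 //; first [exact: b1|exact: b2].
  have -> : M * ((2 * M)^-1 * `|y - y'|) = 2^-1 * `|y - y'|.
    by field; rewrite gt_eqF.
  exact: lexx.
have gL y y' : ball x dlt y -> ball x dlt y' ->
    `|y - y'| <= 2 * M * `|(g1 y - g1 y', g2 y - g2 y')|.
  move=> By By'.
  have E : y - y' = (k y - k y') + Li (g1 y - g1 y', g2 y - g2 y').
    by rewrite /k /g /Li; congr pair => /=; field.
  have := kL _ _ By By'.
  have := LM (g1 y - g1 y', g2 y - g2 y') _ (lexx _).
  have := ler_normD (k y - k y') (Li (g1 y - g1 y', g2 y - g2 y')); rewrite -E.
  by move: `|y - y'| `|k y - k y'| `|Li _| `|(_, _)|; move=> *; lra.
have kc y : ball x dlt y -> {for y, continuous k}.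
  move=> By; apply/cvgrPdist_lt => e ee0.
  have : nbhs y (ball x dlt) by apply: open_nbhs_nbhs; split => //; exact: ball_open.
  have : nbhs y (ball y e) by exact: nbhsx_ballx.
  rewrite -ball_normE; apply: filterS2 => t /= yt Bt0.
  have Bt : ball x dlt t by rewrite -ball_normE.
  rewrite (le_lt_trans (kL _ _ By Bt)) //.
  move: (normr_ge0 (y - t)); lra.
exists dlt, (2 * M); split => //; first by rewrite mulr_gt0.
move=> y r By r0.
have y0 : 0 < dlt - `|x - y| by move: By; rewrite subr_gt0 -ball_normE.
(* A closed ball around y inside both ball y r and ball x dlt. *)
pose r' := Num.min (r / 2) ((dlt - `|x - y|) / 2).
have r'0 : 0 < r' by rewrite lt_min !divr_gt0.
have r'r : r' < r by rewrite gt_min ltr_pdivrMr // ltr_pMr // ltr1n.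
have Br p : `|y - p| <= r' -> ball x dlt p.
  move=> yp; rewrite -ball_normE /= -(subrKA y) (le_lt_trans (ler_normD _ _)) //.
  have : r' <= (dlt - `|x - y|) / 2 by rewrite ge_min lexx orbT.
  by move: yp y0; move: `|y - p| `|x - y| => ? ?; lra.
exists (r' / (2 * M)); first by rewrite divr_gt0 // mulr_gt0.
move=> z1 z2 hz1 hz2.
pose T p : R * R := k p + Li (z1, z2).
have [|||p Hp Tp] := @contraction_fixpoint_on_square T y r' (ltW r'0).
- move=> p Hp.
  have -> : y - T p = (k y - k p) + Li (g1 y - z1, g2 y - z2).
    by rewrite /T /k /g /Li; congr pair => /=; field.
  have := kL _ _ By (Br _ Hp).
  have : `|(g1 y - z1, g2 y - z2)| <= r' / (2 * M).
    by rewrite prod_norm_le /= !ltW.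
  move=> /LM; have -> : M * (r' / (2 * M)) = r' / 2 by field; rewrite gt_eqF.
  have := ler_normD (k y - k p) (Li (g1 y - z1, g2 y - z2)).
  move: Hp; move: `|y - p| `|k y - k p| `|Li _| `|_ + _| => *; lra.
- move=> p p' Hp Hp'; rewrite /T opprD addrACA subrr addr0.
  by apply: kL; exact: Br.
- by move=> p Hp; apply: cvgD; [exact: kc (Br _ Hp)|exact: cvg_cst].
exists p; split.
- exact: Br.
- by rewrite -ball_normE /=; exact: le_lt_trans r'r.
- have := congr1 (fun w : R * R => a * w.1 + b * w.2) Tp.
  rewrite /T /k /Li /g /= => E; apply/eqP; rewrite -subr_eq0; apply/eqP.
  have -> : g1 p - z1 = (a * p.1 + b * p.2) -
     (a * (p.1 - (d * g1 p - b * g2 p) / D + (d * z1 - b * z2) / D) +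
      b * (p.2 - (a * g2 p - c * g1 p) / D + (a * z2 - c * z1) / D)).
    by rewrite /D; field.
  by rewrite E subrr.
- have := congr1 (fun w : R * R => c * w.1 + d * w.2) Tp.
  rewrite /T /k /Li /g /= => E; apply/eqP; rewrite -subr_eq0; apply/eqP.
  have -> : g2 p - z2 = (c * p.1 + d * p.2) -
     (c * (p.1 - (d * g1 p - b * g2 p) / D + (d * z1 - b * z2) / D) +
      d * (p.2 - (a * g2 p - c * g1 p) / D + (a * z2 - c * z1) / D)).
    by rewrite /D; field.
  by rewrite E subrr.
Qed.

End LocalInverse.

(** * Vectors of dimension three *)

Section Vec3.
Context {K : comPzRingType}.
Implicit Types v w : 'cV[K]_3.

Lemma sum3 (F : 'I_3 -> K) : \sum_i F i = F 0 + F 1 + F 2.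
Proof.
by rewrite !big_ord_recl big_ord0 addr0 addrA; do 2?[congr +%R]; congr F; exact: val_inj.
Qed.

Lemma vec3E (z a b c : K) :
  (vec3 z a b c 0 0 = a) * (vec3 z a b c 1 0 = b) * (vec3 z a b c 2 0 = c).
Proof. by rewrite /vec3 !mxE. Qed.

Lemma col3P v w : v 0 0 = w 0 0 -> v 1 0 = w 1 0 -> v 2 0 = w 2 0 -> v = w.
Proof.
move=> h0 h1 h2; apply/matrixP => i j; rewrite ord1.
by case: i => [[|[|[|//]]]] hi; [rewrite (_ : Ordinal hi = 0) //
  |rewrite (_ : Ordinal hi = 1) //|rewrite (_ : Ordinal hi = 2) //]; exact: val_inj.
Qed.

Definition dot v w : K := (v^T *m w) 0 0.

Lemma dotE v w : dot v w = v 0 0 * w 0 0 + v 1 0 * w 1 0 + v 2 0 * w 2 0.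
Proof. by rewrite /dot mxE sum3 !mxE. Qed.

Lemma mul_dot (x y z : 'cV[K]_3) : x *m y^T *m z = dot y z *: x.
Proof.
by rewrite -mulmxA [y^T *m z]mx11_scalar -/(dot y z) mul_mx_scalar.
Qed.

Lemma dotC v w : dot v w = dot w v.
Proof. by rewrite !dotE; ring. Qed.

Lemma dotDr v w w' : dot v (w + w') = dot v w + dot v w'.
Proof. by rewrite /dot mulmxDr mxE. Qed.

Lemma dotZr v a w : dot v (a *: w) = a * dot v w.
Proof. by rewrite /dot -scalemxAr mxE. Qed.

Lemma dotBr v w w' : dot v (w - w') = dot v w - dot v w'.
Proof. by rewrite /dot mulmxBr !mxE. Qed.

Lemma dot0r v : dot v 0 = 0.
Proof. by rewrite /dot mulmx0 mxE. Qed.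

Lemma dot_sym (A : 'M[K]_3) v w : A^T = A -> dot v (A *m w) = dot (A *m v) w.
Proof. by move=> sA; rewrite /dot trmx_mul sA mulmxA. Qed.

End Vec3.

(** * Stereographic charts and isotropic frames *)

Section Frame.
Variable R : realType.
Local Notation R3 := 'cV[R]_3.
Local Notation CC := (R[i]^o).
Implicit Types (b : bool) (u : R) (s t : R3) (A : 'M[R]_3).

Lemma sphereE s : sphere s <-> dot s s = 1.
Proof.
rewrite /sphere /dot /=; split=> [->|H]; first by rewrite mxE eqxx.
by rewrite [LHS]mx11_scalar H.
Qed.

Lemma tangentE s t : tangent s t <-> dot s t = 0.
Proof.
rewrite /tangent /dot /=; split=> [->|H]; first by rewrite mxE.
by rewrite [LHS]mx11_scalar H; apply/matrixP => i j; rewrite !mxE mul0rn.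
Qed.

(** The chart at the pole e3 is the case true; the case false is its image under
    the rotation (x, y, z) |-> (x, -y, -z), with coordinate v = 1/u. *)
Definition chart_sign b : R := if b then 1 else -1.

Definition sq_norm1 u1 u2 : R := 1 + u1 ^+ 2 + u2 ^+ 2.

(** The real and imaginary parts of the isotropic vector
    (1 - u^2, i (1 + u^2), 2 u), with the two last entries negated in the other
    chart. *)
Definition isotropic_re b u1 u2 : R3 :=
  vec3 0 (1 - u1 ^+ 2 + u2 ^+ 2) (- (chart_sign b * (2 * u1 * u2))) (chart_sign b * (2 * u1)).

Definition isotropic_im b u1 u2 : R3 :=
  vec3 0 (- (2 * u1 * u2)) (chart_sign b * (1 + u1 ^+ 2 - u2 ^+ 2)) (chart_sign b * (2 * u2)).

Definition inv_stereo b u1 u2 : R3 :=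
  (sq_norm1 u1 u2)^-1 *: vec3 0 (- 2 * u1) (chart_sign b * (- 2 * u2))
                          (chart_sign b * (1 - (u1 ^+ 2 + u2 ^+ 2))).

(** Vanishes on the sphere only at the pole that the chart omits. *)
Definition stereo_den b s : R := 1 + chart_sign b * s 2 0.
Definition stereo_re b s : R := - (s 0 0) / stereo_den b s.
Definition stereo_im b s : R := - (chart_sign b * s 1 0) / stereo_den b s.

Lemma sq_norm1_gt0 u1 u2 : 0 < sq_norm1 u1 u2.
Proof. by rewrite /sq_norm1 -addrA ltr_pwDl // addr_ge0 // sqr_ge0. Qed.

Lemma sq_norm1_neq0 u1 u2 : sq_norm1 u1 u2 != 0.
Proof. by rewrite gt_eqF // sq_norm1_gt0. Qed.

Section FixChart.
Variables (b : bool) (u1 u2 : R).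
Let n := sq_norm1 u1 u2.
Let W1 := isotropic_re b u1 u2.
Let W2 := isotropic_im b u1 u2.
Let s := inv_stereo b u1 u2.

Lemma inv_stereoE : (s 0 0 = - 2 * u1 / n) * (s 1 0 = chart_sign b * (- 2 * u2) / n) *
  (s 2 0 = chart_sign b * (1 - (u1 ^+ 2 + u2 ^+ 2)) / n).
Proof. by rewrite /s /inv_stereo !mxE /=; split; [split|]; rewrite mulrC. Qed.

Let nE : n = 1 + u1 ^+ 2 + u2 ^+ 2. Proof. by []. Qed.
Let n0 : 1 + u1 ^+ 2 + u2 ^+ 2 != 0. Proof. exact: (sq_norm1_neq0 u1 u2). Qed.

Lemma dot_isotropic_re : dot W1 W1 = n ^+ 2.
Proof. by rewrite dotE /W1 /isotropic_re !vec3E nE /chart_sign; case: b; ring. Qed.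

Lemma dot_isotropic_im : dot W2 W2 = n ^+ 2.
Proof. by rewrite dotE /W2 /isotropic_im !vec3E nE /chart_sign; case: b; ring. Qed.

Lemma dot_isotropic_re_im : dot W1 W2 = 0.
Proof. by rewrite dotE /W1 /W2 /isotropic_re /isotropic_im !vec3E /chart_sign; case: b; ring. Qed.

Lemma dot_inv_stereo_re : dot s W1 = 0.
Proof. by rewrite dotE !inv_stereoE /W1 /isotropic_re !vec3E nE /chart_sign; case: b; field. Qed.

Lemma dot_inv_stereo_im : dot s W2 = 0.
Proof. by rewrite dotE !inv_stereoE /W2 /isotropic_im !vec3E nE /chart_sign; case: b; field. Qed.

Lemma stereo_den_inv_stereo : stereo_den b s = 2 / n.
Proof. by rewrite /stereo_den !inv_stereoE nE /chart_sign; case: b; field. Qed.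

(** The vectors W1/n, W2/n and s form an orthonormal basis. *)
Lemma frame_resolution :
  W1 *m W1^T + W2 *m W2^T + n ^+ 2 *: (s *m s^T) = (n ^+ 2)%:M.
Proof.
apply/matrixP => i j; rewrite !mxE !big_ord1 !mxE.
case: i => [[|[|[|//]]]] hi; case: j => [[|[|[|//]]]] hj; rewrite /= ?mulr1n ?mulr0n;
  by rewrite -/n nE /chart_sign; case: b; field.
Qed.

Lemma frame_decomp (x : R3) :
  n ^+ 2 *: x = dot W1 x *: W1 + dot W2 x *: W2 + (n ^+ 2 * dot s x) *: s.
Proof.
rewrite -mul_scalar_mx -frame_resolution !mulmxDl !mul_dot -scalemxAl mul_dot.
by rewrite scalerA.
Qed.

End FixChart.

Lemma stereoK b s : sphere s -> stereo_den b s != 0 ->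
  inv_stereo b (stereo_re b s) (stereo_im b s) = s.
Proof.
move=> /sphereE; rewrite dotE => S1 D0.
have N : sq_norm1 (stereo_re b s) (stereo_im b s) = 2 / stereo_den b s.
  rewrite /sq_norm1 /stereo_re /stereo_im.
  have -> : (2 : R) = 2 * (s 0 0 * s 0 0 + s 1 0 * s 1 0 + s 2 0 * s 2 0).
    by rewrite S1 mulr1.
  rewrite -[X in X + _ + _]S1.
  suff E : stereo_den b s ^+ 2 * (s 0 0 * s 0 0 + s 1 0 * s 1 0 + s 2 0 * s 2 0) +
     (s 0 0) ^+ 2 + (chart_sign b * s 1 0) ^+ 2 =
     2 * stereo_den b s * (s 0 0 * s 0 0 + s 1 0 * s 1 0 + s 2 0 * s 2 0).
    apply: (mulIf (expf_neq0 2 D0)).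
    transitivity (stereo_den b s ^+ 2 * (s 0 0 * s 0 0 + s 1 0 * s 1 0 + s 2 0 * s 2 0) +
     (s 0 0) ^+ 2 + (chart_sign b * s 1 0) ^+ 2); first by field.
    by rewrite E; field.
  rewrite S1; move: S1 => /(canRL (addrK _)) S1.
  have -> : s 0 0 ^+ 2 = 1 - s 2 0 * s 2 0 - s 1 0 * s 1 0.
    by rewrite expr2; apply: (canRL (addrK _)); apply: (canRL (addrK _)); rewrite S1; ring.
  by rewrite /stereo_den /chart_sign; case: (b); ring.
apply: col3P; rewrite !inv_stereoE N /stereo_re /stereo_im.
- by field.
- by move: (stereo_den b s) D0 => D D0; rewrite /chart_sign; case: (b); field.
have -> : (- s 0 0 / stereo_den b s) ^+ 2 +
    (- (chart_sign b * s 1 0) / stereo_den b s) ^+ 2 = 2 / stereo_den b s - 1.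
  by rewrite -N /sq_norm1 /stereo_re /stereo_im; ring.
have -> : s 2 0 = chart_sign b * (stereo_den b s - 1).
  by rewrite /stereo_den /chart_sign; case: (b); ring.
by move: (stereo_den b s) D0 => D D0; field.
Qed.

Lemma inv_stereoK b u1 u2 :
  stereo_re b (inv_stereo b u1 u2) = u1 /\ stereo_im b (inv_stereo b u1 u2) = u2.
Proof.
have n0 : 1 + u1 ^+ 2 + u2 ^+ 2 != 0 := sq_norm1_neq0 u1 u2.
rewrite /stereo_re /stereo_im stereo_den_inv_stereo !inv_stereoE /sq_norm1.
by rewrite /chart_sign; case: b; split; field.
Qed.

(** Since s has length one, s_3 = - chart_sign b leaves no room for the other
    two entries. *)
Lemma stereo_den_neq0 b s : sphere s -> (stereo_den b s != 0) <-> s <> - (chart_sign b *: e3 R).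
Proof.
move=> /sphereE; rewrite dotE => S1; split.
  move=> D0 E; move: D0; have s2 : s 2 0 = - chart_sign b by rewrite E !mxE /= mulr1.
  by rewrite /stereo_den s2 /chart_sign; case: (b); rewrite ?mul1r ?mulN1r ?opprK subrr eqxx.
move=> H; apply/eqP => D0; apply: H.
have s2 : s 2 0 = - chart_sign b.
  by move: D0; rewrite /stereo_den /chart_sign; case: (b) => ?; lra.
have E : s 0 0 ^+ 2 + s 1 0 ^+ 2 = 0.
  by move: S1; rewrite s2 /chart_sign; case: (b) => ?; lra.
have /eqP := E; rewrite paddr_eq0 ?sqr_ge0 // !sqrf_eq0 => /andP[/eqP s0 /eqP s1].
by apply: col3P; rewrite ?s0 ?s1 ?s2 !mxE /= ?mulr0 ?oppr0 ?mulr1.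
Qed.

End Frame.

(** * Symmetric trace-zero maps in an isotropic frame *)

Section FiberCoordinate.
Variable R : realType.
Local Notation R3 := 'cV[R]_3.
Local Notation CC := (R[i]^o).
Implicit Types (b : bool) (s t : R3) (A : 'M[R]_3).

(** The real and imaginary parts of w^T A w / 2 for w the isotropic vector
    and A symmetric. *)
Definition fiber_re b u1 u2 A : R :=
  2^-1 * (dot (isotropic_re b u1 u2) (A *m isotropic_re b u1 u2) -
          dot (isotropic_im b u1 u2) (A *m isotropic_im b u1 u2)).
Definition fiber_im b u1 u2 A : R := dot (isotropic_re b u1 u2) (A *m isotropic_im b u1 u2).

Lemma scale_scaleC (V : lmodType R) (x y : R) (v : V) : x *: (y *: v) = y *: (x *: v).
Proof. by rewrite !scalerA mulrC. Qed.

Section OnQ.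
Variables (b : bool) (u1 u2 : R) (A : 'M[R]_3).
Let n := sq_norm1 u1 u2.
Let W1 := isotropic_re b u1 u2.
Let W2 := isotropic_im b u1 u2.
Let s := inv_stereo b u1 u2.
Let q1 := fiber_re b u1 u2 A.
Let q2 := fiber_im b u1 u2 A.
Hypotheses (sA : A^T = A) (As : A *m s = 0) (tA : \tr A = 0).

Let nE : n != 0 := sq_norm1_neq0 u1 u2.
Let n2E : n ^+ 2 != 0. Proof. by rewrite expf_neq0. Qed.

(** The trace of A computed in the orthogonal basis W1, W2, s, the last vector
    being in the kernel. *)
Lemma dot_isotropic_trace : dot W1 (A *m W1) + dot W2 (A *m W2) = 0.
Proof.
have : \tr ((n ^+ 2)%:M *m A) = 0 by rewrite mul_scalar_mx linearZ /= tA mulr0.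
rewrite -(frame_resolution b) -/W1 -/W2 -/s !mulmxDl !linearD /=.
rewrite -scalemxAl linearZ /= -!mulmxA !(mxtrace_mulC _ (_^T *m A)) -!mulmxA As.
rewrite mulmx0 linear0 mulr0 addr0 /dot => <-.
by rewrite /mxtrace !big_ord1.
Qed.

Lemma fiber_reE : q1 = dot W1 (A *m W1) /\ q1 = - dot W2 (A *m W2).
Proof. by have := dot_isotropic_trace; rewrite /q1 /fiber_re -/W1 -/W2; split; lra. Qed.

Lemma mul_isotropic_re : n ^+ 2 *: (A *m W1) = q1 *: W1 + q2 *: W2.
Proof.
rewrite (frame_decomp b u1 u2) -/W1 -/W2 -/s (dot_sym s _ sA) As.
by rewrite (dotC 0) dot0r mulr0 scale0r addr0 -fiber_reE.1 (dot_sym W2 _ sA) dotC.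
Qed.

Lemma mul_isotropic_im : n ^+ 2 *: (A *m W2) = q2 *: W1 - q1 *: W2.
Proof.
rewrite (frame_decomp b u1 u2) -/W1 -/W2 -/s (dot_sym s _ sA) As.
by rewrite (dotC 0) dot0r mulr0 scale0r addr0 fiber_reE.2 scaleNr opprK.
Qed.

Lemma fiber_decomp : n ^+ 4 *: A =
  q1 *: (W1 *m W1^T - W2 *m W2^T) + q2 *: (W1 *m W2^T + W2 *m W1^T).
Proof.
have -> : n ^+ 4 *: A = n ^+ 2 *: (A *m (n ^+ 2)%:M).
  by rewrite mul_mx_scalar scalerA -exprD.
rewrite -(frame_resolution b) -/W1 -/W2 -/s !mulmxDr -scalemxAr !mulmxA As.
rewrite mul0mx scaler0 addr0 scalerDr.
rewrite (scalemxAl _ (A *m W1)) (scalemxAl _ (A *m W2)) mul_isotropic_re mul_isotropic_im.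
rewrite !mulmxDl mulNmx -!scalemxAl !scalerDr scalerN.
by rewrite addrACA [RHS]addrACA; congr (_ + _); rewrite addrC.
Qed.

Lemma frame_independent x y : x *: W1 + y *: W2 = 0 -> x = 0 /\ y = 0.
Proof.
move=> E; split; apply: (mulIf n2E); rewrite mul0r.
  have := congr1 (dot W1) E.
  by rewrite dotDr !dotZr dot_isotropic_re dot_isotropic_re_im mulr0 addr0 dot0r.
have := congr1 (dot W2) E.
by rewrite dotDr !dotZr dot_isotropic_im (dotC W2) dot_isotropic_re_im mulr0 add0r dot0r.
Qed.

Lemma fiber_eq0 : (q1 = 0 /\ q2 = 0) <-> A = 0.
Proof.
split=> [[E1 E2]|A0]; last by rewrite /q1 /q2 /fiber_re /fiber_im A0 !mul0mx !dot0r subrr mulr0.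
have := fiber_decomp; rewrite E1 E2 !scale0r addr0 => /eqP.
by rewrite scaler_eq0 expf_eq0 (negbTE nE) /= => /eqP.
Qed.

Lemma fiber_norm_neq0 : A != 0 -> q1 ^+ 2 + q2 ^+ 2 != 0.
Proof.
move=> A0; apply/eqP => /eqP; rewrite paddr_eq0 ?sqr_ge0 // !sqrf_eq0.
by move=> /andP[/eqP ? /eqP ?]; move/eqP: A0; apply; apply/fiber_eq0.
Qed.

Lemma mul_isotropic_combination x y : n ^+ 2 *: (A *m (x *: W1 + y *: W2)) =
  (x * q1 + y * q2) *: W1 + (x * q2 - y * q1) *: W2.
Proof.
rewrite mulmxDr -!scalemxAr scalerDr !(scale_scaleC (n ^+ 2)) mul_isotropic_re mul_isotropic_im.
by rewrite !scalerDr !scalerN !scalerA addrACA -scalerDl -scalerBl.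
Qed.

Lemma injective_on_tangent z : A != 0 -> dot s z = 0 -> A *m z = 0 -> z = 0.
Proof.
move=> A0 zs Az; have m0 := fiber_norm_neq0 A0.
have := frame_decomp b u1 u2 z; rewrite -/W1 -/W2 -/s zs mulr0 scale0r addr0 => Ez.
have : n ^+ 2 *: (A *m (n ^+ 2 *: z)) = 0 by rewrite -scalemxAr Az !scaler0.
rewrite Ez mul_isotropic_combination => /frame_independent[e1 e2].
have z1 : dot W1 z = 0.
  apply: (mulIf m0); rewrite mul0r.
  transitivity (q1 * (dot W1 z * q1 + dot W2 z * q2) + q2 * (dot W1 z * q2 - dot W2 z * q1)).
    by ring.
  by rewrite e1 e2 !mulr0 addr0.
have z2 : dot W2 z = 0.
  apply: (mulIf m0); rewrite mul0r.
  transitivity (q2 * (dot W1 z * q1 + dot W2 z * q2) - q1 * (dot W1 z * q2 - dot W2 z * q1)).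
    by ring.
  by rewrite e1 e2 !mulr0 subr0.
by apply: (scalerI n2E); rewrite scaler0 Ez z1 z2 !scale0r addr0.
Qed.

Lemma tangent_inv_eq v t : A != 0 -> dot s v = 0 -> A *m v = t ->
  tangent_inv (s, A) t = v.
Proof.
move=> A0 sv Av; apply: xget_unique => /= [|y [/tangentE ys Ay]].
  by split=> //; apply/tangentE.
apply/eqP; rewrite -subr_eq0; apply/eqP; apply: injective_on_tangent => //.
  by rewrite dotBr ys sv subrr.
by rewrite mulmxBr Ay Av subrr.
Qed.

(** By mul_isotropic_combination, A acts on x W1 + y W2 as z |-> q z^* / n^2 does on
    x + i y; the inverse is read off from this. *)
Lemma tangent_inv_frame d1 d2 t : A != 0 ->
  n ^+ 2 *: t = - 2 *: (d1 *: W1 + d2 *: W2) ->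
  let m := q1 ^+ 2 + q2 ^+ 2 in
  let a1 := - 2 * q1 / m in let a2 := 2 * q2 / m in
  tangent_inv (s, A) t = (a1 * d1 - a2 * d2) *: W1 - (a1 * d2 + a2 * d1) *: W2.
Proof.
move=> A0 Ht m a1 a2; have m0 : m != 0 := fiber_norm_neq0 A0.
apply: tangent_inv_eq => //.
  by rewrite dotBr !dotZr dot_inv_stereo_re dot_inv_stereo_im !mulr0 subrr.
apply: (scalerI n2E); rewrite -(scaleNr _ W2) Ht mul_isotropic_combination scalerDr !scalerA.
by congr (_ *: _ + _ *: _); rewrite /a1 /a2 /m; field.
Qed.

End OnQ.

(** The differential of the stereographic projection at s maps the tangent
    vector t to (d1, d2). As t is orthogonal to s, the first terms of its
    expansion in the isotropic frame suffice, and the two sides differ by a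
    multiple of the product of s and t. *)
Lemma tangent_frame b s t : sphere s -> stereo_den b s != 0 -> dot s t = 0 ->
  let u1 := stereo_re b s in let u2 := stereo_im b s in
  let d1 := - t 0 0 / stereo_den b s +
            s 0 0 * (chart_sign R b * t 2 0) / stereo_den b s ^+ 2 in
  let d2 := - (chart_sign R b * t 1 0) / stereo_den b s +
            chart_sign R b * s 1 0 * (chart_sign R b * t 2 0) / stereo_den b s ^+ 2 in
  sq_norm1 u1 u2 ^+ 2 *: t = - 2 *: (d1 *: isotropic_re b u1 u2 + d2 *: isotropic_im b u1 u2).
Proof.
move=> Ss D0 st u1 u2.
have sE := stereoK Ss D0; rewrite -/u1 -/u2 in sE.
rewrite -sE stereo_den_inv_stereo !inv_stereoE => d1 d2.
have n0 : 1 + u1 ^+ 2 + u2 ^+ 2 != 0 := sq_norm1_neq0 u1 u2.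
rewrite (frame_decomp b u1 u2) sE st mulr0 scale0r addr0 scalerDr !scalerA.
move: st; rewrite -sE dotE !inv_stereoE => st.
(* The orthogonality of s and t, cleared of the denominator of s. *)
have rel : -2 * u1 * t 0 0 + chart_sign R b * (-2 * u2) * t 1 0 +
   chart_sign R b * (1 - (u1 ^+ 2 + u2 ^+ 2)) * t 2 0 = 0.
  transitivity (sq_norm1 u1 u2 * (-2 * u1 / sq_norm1 u1 u2 * t 0 0 +
    chart_sign R b * (-2 * u2) / sq_norm1 u1 u2 * t 1 0 +
    chart_sign R b * (1 - (u1 ^+ 2 + u2 ^+ 2)) / sq_norm1 u1 u2 * t 2 0)); last by rewrite st mulr0.
  by rewrite /sq_norm1; field.
congr (_ *: _ + _ *: _); rewrite dotE /isotropic_re /isotropic_im !vec3E;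
  apply/eqP; rewrite -subr_eq0; apply/eqP.
  apply: etrans (_ : u1 * (-2 * u1 * t 0 0 + chart_sign R b * (-2 * u2) * t 1 0 +
   chart_sign R b * (1 - (u1 ^+ 2 + u2 ^+ 2)) * t 2 0) = 0); last by rewrite rel mulr0.
  by rewrite /d1 /sq_norm1 /chart_sign; case: (b); field.
apply: etrans (_ : u2 * (-2 * u1 * t 0 0 + chart_sign R b * (-2 * u2) * t 1 0 +
   chart_sign R b * (1 - (u1 ^+ 2 + u2 ^+ 2)) * t 2 0) = 0); last by rewrite rel mulr0.
by rewrite /d2 /sq_norm1 /chart_sign; case: (b); field.
Qed.

End FiberCoordinate.

(** * Complex coordinates of the sphere and of the bundle *)

Section ComplexCoordinates.
Variable R : realType.
Local Notation R3 := 'cV[R]_3.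
Local Notation CC := (R[i]^o).
Local Notation Re := complex.Re.
Local Notation Im := complex.Im.

Lemma CC_eq (x y : CC) : Re x = Re y -> Im x = Im y -> x = y.
Proof. by case: x => a b; case: y => c d /= -> ->. Qed.

Lemma Re_add (x y : CC) : Re (x + y) = Re x + Re y. Proof. by case: x; case: y. Qed.
Lemma Im_add (x y : CC) : Im (x + y) = Im x + Im y. Proof. by case: x; case: y. Qed.
Lemma Re_opp (x : CC) : Re (- x) = - Re x. Proof. by case: x. Qed.
Lemma Im_opp (x : CC) : Im (- x) = - Im x. Proof. by case: x. Qed.
Lemma Re_mul (x y : CC) : Re (x * y) = Re x * Re y - Im x * Im y.
Proof. by case: x; case: y. Qed.
Lemma Im_mul (x y : CC) : Im (x * y) = Re x * Im y + Im x * Re y.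
Proof. by case: x; case: y. Qed.
Lemma Re_one : Re (1 : CC) = 1. Proof. by []. Qed.
Lemma Im_one : Im (1 : CC) = 0. Proof. by []. Qed.
Lemma Re_two : Re (2 : CC) = 2. Proof. by []. Qed.
Lemma Im_two : Im (2 : CC) = 0. Proof. by rewrite /= addr0. Qed.
Lemma Re_inv (x : CC) : Re x^-1 = Re x / (Re x ^+ 2 + Im x ^+ 2).
Proof. by case: x. Qed.
Lemma Im_inv (x : CC) : Im x^-1 = - Im x / (Re x ^+ 2 + Im x ^+ 2).
Proof. by case: x => a b; rewrite /= mulNr. Qed.

Definition ReImE := (Re_add, Im_add, Re_opp, Im_opp, Re_mul, Im_mul,
  Re_one, Im_one, Re_two, Im_two, Re_inv, Im_inv, expr2).

Lemma CC_eq0 (x : CC) : (x == 0) = ((Re x == 0) && (Im x == 0)).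
Proof. by case: x => a b; rewrite eq_complex. Qed.

Definition chart_signC (b : bool) : CC := if b then 1 else -1.
Definition isotropic b (u : CC) : 'cV[CC]_3 :=
  vec3 0 (1 - u ^+ 2) (chart_signC b * ('i%C * (1 + u ^+ 2))) (chart_signC b * (2 * u)).
Definition stereo b (s : R3) : CC := toC (stereo_re b s, stereo_im b s).
Definition fiber b (p : R3 * 'M[R]_3) : CC :=
  toC (fiber_re b (stereo_re b p.1) (stereo_im b p.1) p.2,
       fiber_im b (stereo_re b p.1) (stereo_im b p.1) p.2).

(** Together with tangent_inv_complex this is omega = Re ((- 2 du / q) w). *)
Lemma Re3_isotropic b (c u : CC) :
  Re3 (c *: isotropic b u) =
  Re c *: isotropic_re b (Re u) (Im u) - Im c *: isotropic_im b (Re u) (Im u).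
Proof.
by apply: col3P; rewrite !mxE /= -/(GRing.scale _ _) ?[c *: _]/(c * _) !ReImE
  /chart_signC /chart_sign; case: (b); rewrite ?ReImE /=; ring.
Qed.

Lemma fiber_neq0 b u1 u2 (p : R3 * 'M[R]_3) : Q p -> p.1 = inv_stereo b u1 u2 -> p.2 != 0 ->
  toC (fiber_re b u1 u2 p.2, fiber_im b u1 u2 p.2) != 0.
Proof.
case: p => s A /= [/= _ sA As tA] sE A0; rewrite sE in As.
rewrite CC_eq0 /=; apply: contra (fiber_norm_neq0 sA As tA A0) => /andP[/eqP-> /eqP->].
by rewrite expr0n addr0.
Qed.

Lemma tangent_inv_complex b u1 u2 (p : R3 * 'M[R]_3) (d : CC) t :
  Q p -> p.1 = inv_stereo b u1 u2 -> p.2 != 0 ->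
  sq_norm1 u1 u2 ^+ 2 *: t = - 2 *: (Re d *: isotropic_re b u1 u2 + Im d *: isotropic_im b u1 u2) ->
  let c : CC := - 2 * d / toC (fiber_re b u1 u2 p.2, fiber_im b u1 u2 p.2) in
  tangent_inv p t = Re c *: isotropic_re b u1 u2 - Im c *: isotropic_im b u1 u2.
Proof.
case: p => s A /= [/= _ sA As tA] sE A0 Ht; rewrite sE in As *.
have m0 := fiber_norm_neq0 sA As tA A0.
rewrite (tangent_inv_frame sA As tA A0 Ht).
by congr (_ *: _ - _ *: _); rewrite !ReImE /=; field.
Qed.

(** The coordinate q that the inverse of A defines implicitly is w^T A w / 2;
    it is unique because W1 and W2 are independent. The hypotheses on T and w
    let one proof serve both charts. *)
Lemma fiber_coordE b u1 u2 (p : R3 * 'M[R]_3) (T : CC -> R3) (w : 'cV[CC]_3) :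
  Q p -> p.1 = inv_stereo b u1 u2 ->
  (forall d : CC, sq_norm1 u1 u2 ^+ 2 *: T d =
     - 2 *: (Re d *: isotropic_re b u1 u2 + Im d *: isotropic_im b u1 u2)) ->
  (forall c, Re3 (c *: w) = Re c *: isotropic_re b u1 u2 - Im c *: isotropic_im b u1 u2) ->
  fiber_coord p T w = toC (fiber_re b u1 u2 p.2, fiber_im b u1 u2 p.2).
Proof.
move=> Qp sE HT Hw; rewrite /fiber_coord; have [A0|A0] := eqVneq p.2 0.
  have [_ sA As tA] := Qp; rewrite sE in As.
  by have [-> ->] := (fiber_eq0 sA As tA).2 A0.
have TI d := tangent_inv_complex Qp sE A0 (HT d).
have q0 := fiber_neq0 Qp sE A0.
move: (toC _) TI q0 => q TI q0.
apply: xget_unique => /=; first by split=> // d; rewrite Hw TI.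
move=> q' [q'0 Hq']; have := Hq' 1; rewrite TI !Hw => /eqP.
rewrite -subr_eq0 => /eqP E.
have : (Re (-2 * 1 / q) - Re (-2 * 1 / q')) *: isotropic_re b u1 u2 +
   (Im (-2 * 1 / q') - Im (-2 * 1 / q)) *: isotropic_im b u1 u2 = 0.
  apply: etrans _ E; rewrite !scalerBl opprB addrACA [RHS]addrACA.
  by congr (_ + _); rewrite addrC.
move=> /frame_independent[/eqP]; rewrite subr_eq0 => /eqP E1 /eqP.
rewrite subr_eq0 => /eqP E2.
have : -2 * 1 / q = -2 * 1 / q' :> CC by apply: CC_eq.
move=> /mulfI; rewrite mulr1 oppr_eq0 => /(_ _)/invr_inj ->//.
Qed.

Lemma sphere_paramE (u : CC) : sphere_param u = inv_stereo true (Re u) (Im u).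
Proof. by rewrite /sphere_param /inv_stereo /sq_norm1 /chart_sign !mul1r addrA. Qed.

Lemma sphere_param_infE (v : CC) : sphere_param_inf v = inv_stereo false (Re v) (Im v).
Proof.
rewrite /sphere_param_inf; case: eqVneq => [->|].
  apply: col3P; rewrite !inv_stereoE /sq_norm1 /chart_sign !mxE /=.
  - by rewrite oppr0 mulr0 mul0r.
  - by rewrite oppr0 !mulr0 mul0r.
  by rewrite expr0n !addr0 subr0 divr1 mulr1.
rewrite CC_eq0 => H; have m0 : Re v ^+ 2 + Im v ^+ 2 != 0.
  by rewrite paddr_eq0 ?sqr_ge0 // !sqrf_eq0.
rewrite sphere_paramE Re_inv Im_inv; move: (Re v) (Im v) m0 => a b m0.
have n0 : 1 + a ^+ 2 + b ^+ 2 != 0 := sq_norm1_neq0 a b.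
have n0' : 1 + (a / (a ^+ 2 + b ^+ 2)) ^+ 2 + (- b / (a ^+ 2 + b ^+ 2)) ^+ 2 != 0 :=
  sq_norm1_neq0 _ _.
have E : 1 + (a / (a ^+ 2 + b ^+ 2)) ^+ 2 + (- b / (a ^+ 2 + b ^+ 2)) ^+ 2 =
  (1 + a ^+ 2 + b ^+ 2) / (a ^+ 2 + b ^+ 2) by field.
have n1 : a ^+ 2 + b ^+ 2 + 1 != 0 by rewrite addrC addrA.
apply: col3P; rewrite !inv_stereoE /sq_norm1 /chart_sign E; field; by rewrite ?m0 ?n0.
Qed.

Lemma stereo_den_north (s : R3) : sphere s -> s <> - e3 R -> stereo_den true s != 0.
Proof. by move=> Ss H; apply/stereo_den_neq0 => //; rewrite /chart_sign scale1r. Qed.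

Lemma ucoordE s : sphere s -> stereo_den true s != 0 -> ucoord s = stereo true s.
Proof.
move=> Ss D0; rewrite /ucoord; apply: xget_unique => /=.
  by rewrite sphere_paramE /stereo /= stereoK.
move=> u; rewrite sphere_paramE => <-.
by have [E1 E2] := inv_stereoK true (Re u) (Im u); apply: CC_eq; rewrite /stereo /= ?E1 ?E2.
Qed.

(** The product of the denominators of the two charts is s_1^2 + s_2^2 on the
    sphere. *)
Lemma stereo_flip b s : sphere s -> stereo_den b s != 0 -> stereo_den (~~ b) s != 0 ->
  stereo b s != 0 /\ stereo (~~ b) s = (stereo b s)^-1.
Proof.
move=> Ss D1 D2.
have P : s 0 0 ^+ 2 + s 1 0 ^+ 2 = stereo_den b s * stereo_den (~~ b) s.
  move: Ss => /sphereE; rewrite dotE /stereo_den /chart_sign.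
  move=> /(canRL (addrK _))/(canRL (addrK _)) E.
  by rewrite expr2 E; case: (b) => /=; ring.
have m0 : s 0 0 ^+ 2 + s 1 0 ^+ 2 != 0 by rewrite P mulf_neq0.
have z0 : stereo b s != 0.
  rewrite CC_eq0 /stereo /= /stereo_re /stereo_im; apply: contra m0 => /andP[].
  rewrite !mulf_eq0 !invr_eq0 (negbTE D1) !orbF !oppr_eq0 => /eqP ->.
  rewrite mulf_eq0 /chart_sign => /orP[|/eqP->]; last by rewrite expr0n addr0.
  by case: (b); rewrite ?oppr_eq0 oner_eq0.
split=> //; apply: CC_eq; rewrite ?Re_inv ?Im_inv /stereo /= /stereo_re /stereo_im.
  have -> : (- s 0 0 / stereo_den b s) ^+ 2 + (- (chart_sign R b * s 1 0) / stereo_den b s) ^+ 2 =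
     stereo_den (~~ b) s / stereo_den b s.
    transitivity ((s 0 0 ^+ 2 + s 1 0 ^+ 2) / stereo_den b s ^+ 2).
      by move: (stereo_den b s) D1 => D D1; rewrite /chart_sign; case: (b); field.
    by rewrite P; field.
  by field; rewrite D1.
have -> : (- s 0 0 / stereo_den b s) ^+ 2 + (- (chart_sign R b * s 1 0) / stereo_den b s) ^+ 2 =
     stereo_den (~~ b) s / stereo_den b s.
  transitivity ((s 0 0 ^+ 2 + s 1 0 ^+ 2) / stereo_den b s ^+ 2).
    by move: (stereo_den b s) D1 => D D1; rewrite /chart_sign; case: (b); field.
  by rewrite P; field.
move: (stereo_den b s) D1 (stereo_den (~~ b) s) D2 => D D1 D' D2.
by rewrite /chart_sign; case: (b) => /=; field; rewrite D1.
Qed.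

Lemma vcoordE s : sphere s -> stereo_den false s != 0 -> vcoord s = stereo false s.
Proof.
move=> Ss D0; rewrite /vcoord; case: eqVneq => [->|/eqP H].
  by apply: CC_eq; rewrite /stereo /= /stereo_re /stereo_im !mxE /= ?oppr0 ?mulr0 ?oppr0 mul0r.
have D1 := stereo_den_north Ss H.
by rewrite (ucoordE Ss D1) -(stereo_flip (b := true) Ss D1 D0).2.
Qed.

(** In this form the behaviour of the coordinate under a change of the isotropic
    vector is visible. *)
Lemma fiber_quadratic b (s : R3) (A : 'M[R]_3) : A^T = A ->
  let w := isotropic b (stereo b s) in
  fiber b (s, A) = 2^-1 * \sum_i \sum_j w i 0 * w j 0 * (A i j +i* 0)%C.
Proof.
move=> sA w.
have S i j : A i j = A j i by rewrite -{1}sA mxE.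
have wE k : w k 0 =
    (isotropic_re b (stereo_re b s) (stereo_im b s) k 0 +i*
     isotropic_im b (stereo_re b s) (stereo_im b s) k 0)%C.
  rewrite /w; move: k => [[|[|[|//]]]] hk; rewrite !mxE; apply: CC_eq;
    rewrite /= /chart_signC /chart_sign; case: (b); rewrite ?ReImE /=; ring.
have E : 2 * fiber b (s, A) = \sum_i \sum_j w i 0 * w j 0 * (A i j +i* 0)%C :> CC.
  rewrite !sum3 !wE (S 1 0) (S 2 0) (S 2 1) /fiber /fiber_re /fiber_im /= !dotE.
  move: (isotropic_re _ _ _) (isotropic_im _ _ _) => W1 W2.
  rewrite !mxE !sum3 (S 1 0) (S 2 0) (S 2 1).
  move: (W1 0 0) (W1 1 0) (W1 2 0) (W2 0 0) (W2 1 0) (W2 2 0) => x0 x1 x2 y0 y1 y2.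
  move: (A 0 0) (A 0 1) (A 0 2) (A 1 1) (A 1 2) (A 2 2) => a00 a01 a02 a11 a12 a22.
  by apply: CC_eq; rewrite !(Re_add, Im_add, Re_mul, Im_mul, Re_two, Im_two) /=; field.
have t0 : (2 : CC) != 0 by rewrite CC_eq0 Re_two pnatr_eq0.
by rewrite -E mulKf.
Qed.

(** The factor - u^-2 is the derivative of u |-> 1/u; its square accounts for
    the transition r = q/u^4. *)
Lemma isotropic_flip b (u : CC) : u != 0 -> isotropic (~~ b) u^-1 = - (u^-1 ^+ 2) *: isotropic b u.
Proof.
move=> u0; apply: col3P; rewrite !mxE /= /chart_signC; case: (b) => /=;
 rewrite ?[_ *: _]/(_ * _); field; exact: u0.
Qed.

Lemma fiber_flip b (p : R3 * 'M[R]_3) :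
  Q p -> stereo_den b p.1 != 0 -> stereo_den (~~ b) p.1 != 0 ->
  fiber (~~ b) p = (stereo b p.1)^-1 ^+ 4 * fiber b p.
Proof.
case: p => s A [/= Ss sA As tA] D1 D2.
have [z0 zE] := stereo_flip Ss D1 D2.
rewrite !fiber_quadratic // zE isotropic_flip //.
rewrite [RHS]mulrCA; congr (_ * _); rewrite big_distrr /=; apply: eq_bigr => i _.
rewrite big_distrr /=; apply: eq_bigr => j _.
by rewrite !mxE ?[_ *: _]/(_ * _); field.
Qed.

End ComplexCoordinates.

(** * Derivation rules *)

Section DeriveRules.
Context {R : realType} {V : normedModType R}.
Implicit Types (f g : V -> R) (x h : V).

Lemma is_deriveD_fun f g x h (df dg : R) : is_derive x h f df -> is_derive x h g dg ->
  is_derive x h (fun y => f y + g y) (df + dg).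
Proof. by move=> Hf Hg; exact: is_deriveD. Qed.

Lemma is_deriveN_fun f x h (df : R) : is_derive x h f df ->
  is_derive x h (fun y => - f y) (- df).
Proof. by move=> Hf; exact: is_deriveN. Qed.

Lemma is_deriveB_fun f g x h (df dg : R) : is_derive x h f df -> is_derive x h g dg ->
  is_derive x h (fun y => f y - g y) (df - dg).
Proof. by move=> Hf Hg; apply: is_deriveD_fun => //; exact: is_deriveN_fun. Qed.

Lemma is_deriveM_fun f g x h (df dg : R) : is_derive x h f df -> is_derive x h g dg ->
  is_derive x h (fun y => f y * g y) (f x * dg + g x * df).
Proof. by move=> Hf Hg; exact: is_deriveM. Qed.

Lemma is_deriveV_fun f x h (df : R) : f x != 0 -> is_derive x h f df ->
  is_derive x h (fun y => (f y)^-1) (- df / f x ^+ 2).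
Proof.
move=> f0 [Hf <-]; apply: DeriveDef; first exact: derivableV.
by rewrite deriveV // mulrC mulrN scaleNr.
Qed.

Lemma is_deriveC_fun (a : R) x h : is_derive x h (fun=> a) (0 : R).
Proof. exact: is_derive_cst. Qed.

Lemma is_derive_mx m n (f : V -> 'M[R]_(m, n)) x h (df : 'M[R]_(m, n)) :
  (forall i j, is_derive x h (fun y => f y i j) (df i j)) -> is_derive x h f df.
Proof.
move=> H; have D : derivable f x h by apply/derivable_mxP => i j; have [] := H i j.
apply: DeriveDef => //; rewrite derive_mx //; apply/matrixP => i j; rewrite mxE.
by have [] := H i j.
Qed.

End DeriveRules.

(** * Tangent maps of the charts *)

Section Tangents.
Variable R : realType.
Local Notation R3 := 'cV[R]_3.
Local Notation CC := (R[i]^o).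

Lemma fst_continuous (V W : topologicalType) : continuous (@fst V W).
Proof. by move=> x; exact: cvg_fst. Qed.

Lemma snd_continuous (V W : topologicalType) : continuous (@snd V W).
Proof. by move=> x; exact: cvg_snd. Qed.

Lemma is_derive_fst (x h : R * R) : is_derive x h (fun y : R * R => y.1) h.1.
Proof.
have [H E] := is_derive_id x h.
have [d e] := derive_linear (l := @fst R R) (@fst_continuous R R) H.
by apply: DeriveDef; [exact: d|apply: etrans e _; rewrite E].
Qed.

Lemma is_derive_snd (x h : R * R) : is_derive x h (fun y : R * R => y.2) h.2.
Proof.
have [H E] := is_derive_id x h.
have [d e] := derive_linear (l := @snd R R) (@snd_continuous R R) H.
by apply: DeriveDef; [exact: d|apply: etrans e _; rewrite E].
Qed.

(** The chart is conformal: its differential maps the standard basis to multiples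
    by - 2/n^2 of the isotropic frame. *)
Lemma inv_stereo_derive b (x h : R * R) :
  sq_norm1 x.1 x.2 ^+ 2 *: 'D_h (fun y => inv_stereo b y.1 y.2) x =
  - 2 *: (h.1 *: isotropic_re b x.1 x.2 + h.2 *: isotropic_im b x.1 x.2).
Proof.
have D1 := is_derive_fst x h; have D2 := is_derive_snd x h.
have n0 := sq_norm1_neq0 x.1 x.2.
have DM := fun f df (H : is_derive x h f df) => is_deriveM_fun H H.
have Dk := fun a : R => is_deriveC_fun (V := (R * R)%type) a x h.
have Dn : is_derive x h (fun y : R * R => sq_norm1 y.1 y.2) (2 * (x.1 * h.1 + x.2 * h.2)).
  have E := is_deriveD_fun (is_deriveD_fun (Dk 1) (DM _ _ D1)) (DM _ _ D2).
  by apply: is_derive_eq E _; ring.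
have Dv := is_deriveV_fun (f := fun y : R * R => sq_norm1 y.1 y.2) n0 Dn.
pose df0 := (- 2 * x.1) * (- (2 * (x.1 * h.1 + x.2 * h.2)) / sq_norm1 x.1 x.2 ^+ 2) +
   (sq_norm1 x.1 x.2)^-1 * (- 2 * h.1).
pose df1 := chart_sign R b *
  ((- 2 * x.2) * (- (2 * (x.1 * h.1 + x.2 * h.2)) / sq_norm1 x.1 x.2 ^+ 2) +
   (sq_norm1 x.1 x.2)^-1 * (- 2 * h.2)).
pose df2 := chart_sign R b * ((1 - (x.1 ^+ 2 + x.2 ^+ 2)) *
   (- (2 * (x.1 * h.1 + x.2 * h.2)) / sq_norm1 x.1 x.2 ^+ 2) -
   (sq_norm1 x.1 x.2)^-1 * (2 * (x.1 * h.1 + x.2 * h.2))).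
have [_ ->] : is_derive x h (fun y : R * R => inv_stereo b y.1 y.2) (vec3 0 df0 df1 df2).
  apply: is_derive_mx => i j; rewrite ord1.
  have -> : (fun y : R * R => inv_stereo b y.1 y.2 i 0) =
     (fun y : R * R => (sq_norm1 y.1 y.2)^-1 * nth 0 [:: - 2 * y.1; chart_sign R b * (- 2 * y.2);
                          chart_sign R b * (1 - (y.1 * y.1 + y.2 * y.2))] i).
    by apply/funext => y; rewrite !mxE.
  rewrite mxE; case: i => [[|[|[|//]]]] hi /=.
  - have E := is_deriveM_fun Dv (is_deriveM_fun (Dk (- 2)) D1).
    by apply: is_derive_eq E _; rewrite /df0; ring.
  - have E := is_deriveM_fun Dv
      (is_deriveM_fun (Dk (chart_sign R b)) (is_deriveM_fun (Dk (- 2)) D2)).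
    by apply: is_derive_eq E _; rewrite /df1; ring.
  have E := is_deriveM_fun Dv (is_deriveM_fun (Dk (chart_sign R b))
      (is_deriveB_fun (Dk 1) (is_deriveD_fun (DM _ _ D1) (DM _ _ D2)))).
  by apply: is_derive_eq E _; rewrite /df2; ring.
have n0' : 1 + x.1 ^+ 2 + x.2 ^+ 2 != 0 := n0.
by apply: col3P; rewrite !mxE /= /df0 /df1 /df2 /sq_norm1 /chart_sign; case: (b); field.
Qed.

Lemma Tmap_inv_stereo b (f : CC -> R3) (z d : CC) :
  (forall u, f u = inv_stereo b (complex.Re u) (complex.Im u)) ->
  sq_norm1 (complex.Re z) (complex.Im z) ^+ 2 *: Tmap f z d =
  - 2 *: (complex.Re d *: isotropic_re b (complex.Re z) (complex.Im z) +
          complex.Im d *: isotropic_im b (complex.Re z) (complex.Im z)).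
Proof.
move=> Hf; rewrite /Tmap.
have -> : f \o @toC R = (fun y => inv_stereo b y.1 y.2) by apply/funext => y; rewrite /= Hf.
exact: (inv_stereo_derive b (ofC z) (ofC d)).
Qed.

Lemma qcoordE (p : R3 * 'M[R]_3) : Q p -> stereo_den true p.1 != 0 -> qcoord p = fiber true p.
Proof.
move=> Qp D0; have [Ss _ _ _] := Qp.
rewrite /qcoord (ucoordE Ss D0); apply: fiber_coordE => //.
- by rewrite stereoK.
- by move=> d; have := @Tmap_inv_stereo true _ (stereo true p.1) d (@sphere_paramE R).
move=> c; rewrite -(Re3_isotropic true c (stereo true p.1)); congr (Re3 (_ *: vec3 _ _ _ _)).
- by rewrite /chart_signC mul1r.
- by rewrite /chart_signC mul1r.
Qed.

(** Away from the pole - e3 this is the transition rule; at the pole, v = 0 and the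
    implicit definition is solved in the second chart. *)
Lemma rcoordE (p : R3 * 'M[R]_3) : Q p -> stereo_den false p.1 != 0 -> rcoord p = fiber false p.
Proof.
move=> Qp D0; have [Ss _ _ _] := Qp.
rewrite /rcoord; case: eqVneq => [E|/eqP H]; last first.
  have D1 := stereo_den_north Ss H.
  by rewrite (qcoordE Qp D1) (ucoordE Ss D1) -(fiber_flip (b := true)).
have [c1 c2] : stereo_re false p.1 = 0 /\ stereo_im false p.1 = 0.
  by rewrite E /stereo_re /stereo_im !mxE /= ?oppr0 ?mulr0 ?oppr0 !mul0r.
rewrite /fiber c1 c2; apply: fiber_coordE => //.
- by rewrite -{1}c1 -c2 stereoK.
- by move=> d; have := @Tmap_inv_stereo false _ 0 d (@sphere_param_infE R).
move=> c; rewrite -(Re3_isotropic false c 0); congr (Re3 (_ *: vec3 _ _ _ _)).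
- by rewrite expr0n subr0.
- by rewrite expr0n addr0 mulr1 /chart_signC mulN1r.
by rewrite !mulr0.
Qed.

End Tangents.

(** * The exterior derivative of the form *)

Section ComplexValued.
Variable R : realType.
Local Notation R3 := 'cV[R]_3.
Local Notation CC := (R[i]^o).
Local Notation Re := complex.Re.
Local Notation Im := complex.Im.
Local Notation E := (R * R)%type.
Implicit Types (F G : E -> CC) (x h k : E) (U : set E).

Lemma class_CB (k : nat) U (f g : E -> R) : open U ->
  class_C k U f -> class_C k U g -> class_C k U (fun x => f x - g x).
Proof. by move=> oU Cf Cg; apply: class_CD => //; exact: class_CN. Qed.

(** Complex-valued maps are differentiated by real and imaginary parts, since the
    space of complex numbers is normed over the complex field only. *)
Definition Cderive h F x : CC :=
  ('D_h (fun y => Re (F y)) x +i* 'D_h (fun y => Im (F y)) x)%C.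

Definition complex_class_C (k : nat) U F :=
  class_C k U (fun y => Re (F y)) /\ class_C k U (fun y => Im (F y)).

Definition is_Cderive x h F (d : CC) :=
  is_derive x h (fun y => Re (F y)) (Re d) /\
  is_derive x h (fun y => Im (F y)) (Im d).

Lemma complex_class_CM (k : nat) U F G : open U ->
  complex_class_C k U F -> complex_class_C k U G -> complex_class_C k U (fun y => F y * G y).
Proof.
move=> oU [F1 F2] [G1 G2]; split.
  have -> : (fun y => Re (F y * G y)) = (fun y => Re (F y) * Re (G y) - Im (F y) * Im (G y)).
    by apply/funext => y; rewrite Re_mul.
  by apply: class_CB => //; exact: class_CM.
have -> : (fun y => Im (F y * G y)) = (fun y => Re (F y) * Im (G y) + Im (F y) * Re (G y)).
  by apply/funext => y; rewrite Im_mul.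
by apply: class_CD => //; exact: class_CM.
Qed.

Lemma complex_class_C_cst (k : nat) U (c : CC) : complex_class_C k U (fun=> c).
Proof. by split; exact: class_C_cst. Qed.

Lemma complex_class_CV (k : nat) U F : open U -> (forall y, U y -> F y != 0) ->
  complex_class_C k U F -> complex_class_C k U (fun y => (F y)^-1).
Proof.
move=> oU F0 [F1 F2].
have m0 y : U y -> Re (F y) * Re (F y) + Im (F y) * Im (F y) != 0.
  by move=> /F0; rewrite CC_eq0 -!expr2 paddr_eq0 ?sqr_ge0 // !sqrf_eq0.
have CV : class_C k U (fun y => (Re (F y) * Re (F y) + Im (F y) * Im (F y))^-1).
  by apply: class_CV => //; apply: class_CD => //; exact: class_CM.
split.
  have -> : (fun y => Re (F y)^-1) =
      (fun y => Re (F y) * (Re (F y) * Re (F y) + Im (F y) * Im (F y))^-1).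
    by apply/funext => y; rewrite Re_inv !expr2.
  exact: class_CM.
have -> : (fun y => Im (F y)^-1) =
    (fun y => - Im (F y) * (Re (F y) * Re (F y) + Im (F y) * Im (F y))^-1).
  by apply/funext => y; rewrite Im_inv !expr2.
by apply: class_CM => //; exact: class_CN.
Qed.

Lemma is_Cderive_val x h F d : is_Cderive x h F d -> Cderive h F x = d.
Proof. by move=> [[_ d1] [_ d2]]; apply: CC_eq; rewrite /= ?d1 ?d2. Qed.

Lemma is_Cderive_class (k : nat) U F x h :
  complex_class_C k.+1 U F -> U x -> is_Cderive x h F (Cderive h F x).
Proof.
move=> [[_ F1] [_ F2]] Ux; have [d1 _] := F1 h; have [d2 _] := F2 h.
by split; apply: derivableP; [exact: d1|exact: d2].
Qed.

Lemma complex_class_C_derive (k : nat) U F h :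
  complex_class_C k.+1 U F -> complex_class_C k U (Cderive h F).
Proof. by move=> [[_ F1] [_ F2]]; have [_ ?] := F1 h; have [_ ?] := F2 h. Qed.

Lemma is_CderiveD x h F G d e : is_Cderive x h F d -> is_Cderive x h G e ->
  is_Cderive x h (fun y => F y + G y) (d + e).
Proof.
move=> [F1 F2] [G1 G2]; split.
  have -> : (fun y => Re (F y + G y)) = (fun y => Re (F y) + Re (G y)).
    by apply/funext => y; rewrite Re_add.
  by rewrite Re_add; exact: is_deriveD_fun.
have -> : (fun y => Im (F y + G y)) = (fun y => Im (F y) + Im (G y)).
  by apply/funext => y; rewrite Im_add.
by rewrite Im_add; exact: is_deriveD_fun.
Qed.

Lemma is_CderiveM x h F G d e : is_Cderive x h F d -> is_Cderive x h G e ->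
  is_Cderive x h (fun y => F y * G y) (F x * e + G x * d).
Proof.
move=> [F1 F2] [G1 G2]; split.
  have -> : (fun y => Re (F y * G y)) = (fun y => Re (F y) * Re (G y) - Im (F y) * Im (G y)).
    by apply/funext => y; rewrite Re_mul.
  have H := is_deriveB_fun (is_deriveM_fun F1 G1) (is_deriveM_fun F2 G2).
  by apply: is_derive_eq H _; rewrite Re_add !Re_mul; ring.
have -> : (fun y => Im (F y * G y)) = (fun y => Re (F y) * Im (G y) + Im (F y) * Re (G y)).
  by apply/funext => y; rewrite Im_mul.
have H := is_deriveD_fun (is_deriveM_fun F1 G2) (is_deriveM_fun F2 G1).
by apply: is_derive_eq H _; rewrite Im_add !Im_mul; ring.
Qed.

Lemma is_Cderive_cst x h (c : CC) : is_Cderive x h (fun=> c) 0.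
Proof. by split; exact: is_derive_cst. Qed.

Lemma is_Cderive_eq x h F d d' : is_Cderive x h F d -> d = d' -> is_Cderive x h F d'.
Proof. by move=> H <-. Qed.

Definition isotropic_deriv b (u : CC) : 'cV[CC]_3 :=
  vec3 0 (- (2 * u)) (chart_signC R b * ('i%C * (2 * u))) (chart_signC R b * 2).

Lemma is_Cderive_isotropic b x h F d i : is_Cderive x h F d ->
  is_Cderive x h (fun y => isotropic b (F y) i 0) (isotropic_deriv b (F x) i 0 * d).
Proof.
move=> HF; have cst c := is_Cderive_cst x h c.
case: i => [[|[|[|//]]]] hi.
- have -> : (fun y => isotropic b (F y) (Ordinal hi) 0) = (fun y => 1 + (-1) * (F y * F y)).
    by apply/funext => y; rewrite mxE /= expr2 mulN1r.
  apply: is_Cderive_eq (is_CderiveD (cst 1) (is_CderiveM (cst (-1)) (is_CderiveM HF HF))) _.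
  by rewrite mxE /=; ring.
- have -> : (fun y => isotropic b (F y) (Ordinal hi) 0) =
     (fun y => (chart_signC R b * 'i%C) * (1 + F y * F y)).
    by apply/funext => y; rewrite mxE /= expr2 mulrA.
  apply: is_Cderive_eq (is_CderiveM (cst _) (is_CderiveD (cst 1) (is_CderiveM HF HF))) _.
  by rewrite mxE /=; ring.
have -> : (fun y => isotropic b (F y) (Ordinal hi) 0) = (fun y => (chart_signC R b * 2) * F y).
  by apply/funext => y; rewrite mxE /= mulrA.
apply: is_Cderive_eq (is_CderiveM (cst _) HF) _.
by rewrite mxE /=; ring.
Qed.

(** Independence of the real and imaginary parts of w; this is what turns the
    vector equation d omega = 0 into a complex one. *)
Lemma Re3_isotropic_eq0 b (c u : CC) : Re3 (c *: isotropic b u) = 0 <-> c = 0.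
Proof.
split=> [|->]; last by apply/matrixP => i j; rewrite !mxE mul0r.
rewrite Re3_isotropic -scaleNr => /frame_independent[E1 /eqP]; rewrite oppr_eq0 => /eqP E2.
exact: CC_eq.
Qed.

Lemma Cderive_comm U F x h k : open U -> complex_class_C 2 U F -> U x ->
  Cderive k (Cderive h F) x = Cderive h (Cderive k F) x.
Proof.
move=> oU [F1 F2] Ux; apply: CC_eq => /=.
  exact: derive_comm oU F1 Ux.
exact: derive_comm oU F2 Ux.
Qed.

Lemma Re3_col (f : 'I_3 -> CC) i : Re3 (\col_i f i) i 0 = Re (f i).
Proof. by rewrite mxE mxE. Qed.

Lemma Re3_scale (c : CC) (w : 'cV[CC]_3) i : Re3 (c *: w) i 0 = Re (c * w i 0).
Proof. by rewrite mxE mxE. Qed.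

Lemma Re3_sub (v w : 'cV[CC]_3) : Re3 v - Re3 w = Re3 (v - w).
Proof. by apply/colP => i; rewrite !mxE Re_add Re_opp. Qed.

(** In D_k (a du(h) w) - D_h (a du(k) w) the terms with second derivatives of u
    cancel by their symmetry, those with the derivative of w cancel because it is
    w' du, and (da /\ du) w remains. *)
Lemma exterior_derivative b (a u : E -> CC) U x h k (etah etak : E -> R3) :
  open U -> U x -> complex_class_C 2 U u -> complex_class_C 1 U a ->
  (forall y, U y -> etah y = Re3 ((a y * Cderive h u y) *: isotropic b (u y))) ->
  (forall y, U y -> etak y = Re3 ((a y * Cderive k u y) *: isotropic b (u y))) ->
  'D_k etah x = 'D_h etak x <->
  Cderive k a x * Cderive h u x = Cderive h a x * Cderive k u x.
Proof.
move=> oU Ux Cu Ca Eh Ek.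
pose dv l m : 'cV[CC]_3 :=
  \col_i ((a x * Cderive l u x) * (isotropic_deriv b (u x) i 0 * Cderive m u x) +
          isotropic b (u x) i 0 *
            (a x * Cderive m (Cderive l u) x + Cderive l u x * Cderive m a x)).
have D l m (eta : E -> R3) :
    (forall y, U y -> eta y = Re3 ((a y * Cderive l u y) *: isotropic b (u y))) ->
    'D_m eta x = Re3 (dv l m).
  move=> Eeta.
  have Hu := is_Cderive_class m Cu Ux.
  have Hul := is_Cderive_class m (complex_class_C_derive l Cu) Ux.
  have Ha := is_Cderive_class m Ca Ux.
  suff [_ ->] : is_derive x m eta (Re3 (dv l m)) by [].
  apply: is_derive_mx => i j; rewrite ord1.
  have [H _] := is_CderiveM (is_CderiveM Ha Hul) (is_Cderive_isotropic b i Hu).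
  rewrite Re3_col; apply: near_eq_is_derive H.
  apply: filterS (open_nbhs_nbhs (conj oU Ux)) => y Uy.
  by rewrite Eeta // Re3_scale.
have XY : dv h k - dv k h =
    (Cderive k a x * Cderive h u x - Cderive h a x * Cderive k u x) *: isotropic b (u x).
  rewrite /dv (Cderive_comm h k oU Cu Ux); move: (isotropic b _) (isotropic_deriv b _) => w w'.
  move: (Cderive h u x) (Cderive k u x) (Cderive h (Cderive k u) x).
  move: (Cderive h a x) (Cderive k a x) => *.
  by apply/colP => i; rewrite !mxE; ring.
clearbody dv; rewrite (D h k etah Eh) (D k h etak Ek).
split=> [H|H].
  apply/eqP; rewrite -subr_eq0; apply/eqP/(Re3_isotropic_eq0 b _ (u x)).
  by rewrite -XY -Re3_sub H subrr.
apply/eqP; rewrite -subr_eq0 Re3_sub XY H subrr.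
by apply/eqP/Re3_isotropic_eq0.
Qed.

(** The case a = - 2/q, where da is a nonzero multiple of dq. *)
Lemma exterior_derivative_inv b (q u : E -> CC) U x h k (etah etak : E -> R3) :
  open U -> U x -> complex_class_C 2 U u -> complex_class_C 1 U q -> (forall y, U y -> q y != 0) ->
  (forall y, U y -> etah y = Re3 ((- 2 * Cderive h u y / q y) *: isotropic b (u y))) ->
  (forall y, U y -> etak y = Re3 ((- 2 * Cderive k u y / q y) *: isotropic b (u y))) ->
  'D_k etah x = 'D_h etak x <-> Cderive k q x * Cderive h u x = Cderive h q x * Cderive k u x.
Proof.
move=> oU Ux Cu Cq q0 Eh Ek.
pose a y : CC := - 2 * (q y)^-1.
have Ca : complex_class_C 1 U a.
  exact: complex_class_CM oU (complex_class_C_cst _ _ _) (complex_class_CV oU q0 Cq).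
have [||H1 H2] := @exterior_derivative b a u U x h k etah etak oU Ux Cu Ca.
- by move=> y Uy; rewrite Eh //; congr (Re3 (_ *: _)); rewrite /a; ring.
- by move=> y Uy; rewrite Ek //; congr (Re3 (_ *: _)); rewrite /a; ring.
have qx := q0 x Ux.
have D m : Cderive m a x = 2 * Cderive m q x / q x ^+ 2.
  have Hm := is_CderiveM (is_Cderive_class m Ca Ux) (is_Cderive_class m Cq Ux).
  (* The derivative of a = - 2/q from that of the constant a q = - 2. *)
  have H0 : is_Cderive x m (fun y => a y * q y) 0.
    have aq : \near x, -2 = a x * q x.
      apply: filterS (open_nbhs_nbhs (conj oU Ux)) => y Uy.
      by rewrite /a mulfVK; [|exact: q0].
    split.
      apply: near_eq_is_derive (is_derive_cst (Re (- 2 : CC)) x m).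
      by apply: filterS aq => y <-.
    apply: near_eq_is_derive (is_derive_cst (Im (- 2 : CC)) x m).
    by apply: filterS aq => y <-.
  have := is_Cderive_val Hm; rewrite (is_Cderive_val H0) /a => E0.
  have : q x * (Cderive m a x - 2 * Cderive m q x / q x ^+ 2) = 0.
    by rewrite [RHS]E0; field.
  by move=> /eqP; rewrite mulf_eq0 (negbTE qx) subr_eq0 => /eqP.
have t0 : (2 : CC) != 0 by rewrite CC_eq0 Re_two pnatr_eq0.
have K : 2 / q x ^+ 2 != 0 by apply: mulf_neq0; [exact: t0|rewrite invr_eq0; exact: expf_neq0].
split.
  move=> /H1; rewrite !D => e; apply: (mulfI K).
  by transitivity (2 * Cderive k q x / q x ^+ 2 * Cderive h u x); [ring|rewrite e; ring].
move=> e; apply: H2; rewrite !D.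
transitivity (2 / q x ^+ 2 * (Cderive k q x * Cderive h u x)); first by ring.
by rewrite e; ring.
Qed.

End ComplexValued.

(** * Maps from the plane to the bundle *)

Section MapsToQ.
Variable R : realType.
Local Notation R3 := 'cV[R]_3.
Local Notation CC := (R[i]^o).
Local Notation Re := complex.Re.
Local Notation Im := complex.Im.
Local Notation E := (R * R)%type.
Implicit Types (x h : E) (U : set E).

(** For matrix-valued maps; entries keep sums and products within real-valued
    functions. *)
Definition entrywise_C m n (k : nat) U (M : E -> 'M[R]_(m, n)) :=
  forall i j, class_C k U (fun y => M y i j).

Lemma class_C_sum (k : nat) U (I : finType) (F : I -> E -> R) : open U ->
  (forall i, class_C k U (F i)) -> class_C k U (fun y => \sum_i F i y).
Proof.
move=> oU CF.
have -> : (fun y => \sum_i F i y) = (fun y => \sum_(i <- index_enum I) F i y) by [].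
elim: (index_enum I) => [|i s IH].
  have -> : (fun y => \sum_(i <- [::]) F i y) = (fun=> 0).
    by apply/funext => y; rewrite big_nil.
  exact: class_C_cst.
have -> : (fun y => \sum_(j <- i :: s) F j y) = (fun y => F i y + \sum_(j <- s) F j y).
  by apply/funext => y; rewrite big_cons.
exact: class_CD.
Qed.

Lemma entrywise_C_mul m n p (k : nat) U (M : E -> 'M[R]_(m, n)) (N : E -> 'M[R]_(n, p)) :
  open U -> entrywise_C k U M -> entrywise_C k U N ->
  entrywise_C k U (fun y => M y *m N y).
Proof.
move=> oU CM CN i j.
have -> : (fun y => (M y *m N y) i j) = (fun y => \sum_l M y i l * N y l j).
  by apply/funext => y; rewrite mxE.
by apply: class_C_sum => // l; apply: class_CM.
Qed.

Lemma entrywise_C_tr m n (k : nat) U (M : E -> 'M[R]_(m, n)) :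
  entrywise_C k U M -> entrywise_C k U (fun y => (M y)^T).
Proof.
move=> CM i j; have -> : (fun y => (M y)^T i j) = (fun y => M y j i); last exact: CM.
by apply/funext => y; rewrite mxE.
Qed.

Lemma class_C_dot (k : nat) U (v w : E -> R3) : open U ->
  entrywise_C k U v -> entrywise_C k U w -> class_C k U (fun y => dot (v y) (w y)).
Proof. by move=> oU Cv Cw; apply: entrywise_C_mul => //; exact: entrywise_C_tr. Qed.

Lemma entrywise_C_vec3 (k : nat) U (a b c : E -> R) :
  class_C k U a -> class_C k U b -> class_C k U c ->
  entrywise_C k U (fun y => vec3 0 (a y) (b y) (c y)).
Proof.
move=> Ca Cb Cc i j.
have -> : (fun y => vec3 0 (a y) (b y) (c y) i j) =
          (fun y => nth 0 [:: a y; b y; c y] i).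
  by apply/funext => y; rewrite mxE.
by case: i => [[|[|[|//]]]] hi.
Qed.

Lemma class_CX2 (k : nat) U (f : E -> R) : open U -> class_C k U f ->
  class_C k U (fun y => f y ^+ 2).
Proof. by move=> oU Cf; exact: (class_CM oU Cf Cf). Qed.

Section Frame.
Variables (b : bool) (k : nat) (U : set E) (u1 u2 : E -> R).
Hypotheses (oU : open U) (C1 : class_C k U u1) (C2 : class_C k U u2).

Let cst (a : R) : class_C k U (fun=> a) := class_C_cst _ _ _.

Lemma entrywise_C_isotropic_re : entrywise_C k U (fun y => isotropic_re b (u1 y) (u2 y)).
Proof.
apply: entrywise_C_vec3.
- apply: class_CD => //; last exact: class_CX2.
  by apply: class_CB => //; exact: class_CX2.
- apply: class_CN => //; apply: class_CM => //; apply: class_CM => //.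
  exact: class_CM.
by apply: class_CM => //; exact: class_CM.
Qed.

Lemma entrywise_C_isotropic_im : entrywise_C k U (fun y => isotropic_im b (u1 y) (u2 y)).
Proof.
apply: entrywise_C_vec3.
- by apply: class_CN => //; apply: class_CM => //; exact: class_CM.
- apply: class_CM => //; apply: class_CB => //; last exact: class_CX2.
  by apply: class_CD => //; exact: class_CX2.
by apply: class_CM => //; exact: class_CM.
Qed.

Lemma class_C_fiber_re (A : E -> 'M[R]_3) : entrywise_C k U A ->
  class_C k U (fun y => fiber_re b (u1 y) (u2 y) (A y)).
Proof.
move=> CA; apply: class_CM => //; apply: class_CB => //; apply: class_C_dot => //.
- exact: entrywise_C_isotropic_re.
- by apply: entrywise_C_mul => //; exact: entrywise_C_isotropic_re.
- exact: entrywise_C_isotropic_im.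
by apply: entrywise_C_mul => //; exact: entrywise_C_isotropic_im.
Qed.

Lemma class_C_fiber_im (A : E -> 'M[R]_3) : entrywise_C k U A ->
  class_C k U (fun y => fiber_im b (u1 y) (u2 y) (A y)).
Proof.
move=> CA; apply: class_C_dot => //; first exact: entrywise_C_isotropic_re.
by apply: entrywise_C_mul => //; exact: entrywise_C_isotropic_im.
Qed.

End Frame.

Lemma complex_class_C_stereo b (k : nat) U (s : E -> R3) : open U ->
  (forall y, U y -> stereo_den b (s y) != 0) -> entrywise_C k U s ->
  complex_class_C k U (fun y => stereo b (s y)).
Proof.
move=> oU D0 Cs.
have cst (a : R) : class_C k U (fun=> a) := class_C_cst _ _ _.
have CD : class_C k U (fun y => (stereo_den b (s y))^-1).
  by apply: class_CV => //; apply: class_CD => //; exact: class_CM.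
split; apply: class_CM => //; apply: class_CN => //.
exact: class_CM.
Qed.

Lemma complex_class_C_fiber b (k : nat) U (s : E -> R3) (A : E -> 'M[R]_3) : open U ->
  (forall y, U y -> stereo_den b (s y) != 0) -> entrywise_C k U s -> entrywise_C k U A ->
  complex_class_C k U (fun y => fiber b (s y, A y)).
Proof.
move=> oU D0 Cs CA; have [C1 C2] := complex_class_C_stereo oU D0 Cs.
by split; [exact: class_C_fiber_re|exact: class_C_fiber_im].
Qed.

Section Tangents.
Variables (b : bool) (U : set E) (s : E -> R3).
Hypotheses (oU : open U) (D0 : forall y, U y -> stereo_den b (s y) != 0).
Hypotheses (Cs : entrywise_C 1 U s) (Ss : forall y, U y -> sphere (s y)).

Lemma entry_is_derive x h i : U x -> is_derive x h (fun y => s y i 0) ('D_h s x i 0).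
Proof.
move=> Ux.
have D j l : derivable (fun y => s y j l) x h.
  by have [_ /(_ h)[d _]] := Cs j l; exact: d.
have Ds : derivable s x h by apply/derivable_mxP.
by rewrite derive_mx // mxE; apply: derivableP.
Qed.

(** Differentiate the equation of the sphere. *)
Lemma dot_derive_sphere x h : U x -> dot (s x) ('D_h s x) = 0.
Proof.
move=> Ux; have D i := entry_is_derive h i Ux.
have H := is_deriveD_fun (is_deriveD_fun (is_deriveM_fun (D 0) (D 0))
  (is_deriveM_fun (D 1) (D 1))) (is_deriveM_fun (D 2) (D 2)).
have H0 : is_derive x h (fun y => s y 0 0 * s y 0 0 + s y 1 0 * s y 1 0 + s y 2 0 * s y 2 0) 0.
  apply: near_eq_is_derive (is_derive_cst (1 : R) x h).
  apply: filterS (open_nbhs_nbhs (conj oU Ux)) => y Uy.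
  by have /sphereE := Ss Uy; rewrite dotE => ->.
have [_ E1] := H; have [_ E2] := H0.
have := etrans (esym E1) E2; rewrite dotE => E3.
by move: ('D_h s x) E3 => t E3; lra.
Qed.

Lemma stereo_derive x h : U x ->
  sq_norm1 (stereo_re b (s x)) (stereo_im b (s x)) ^+ 2 *: 'D_h s x =
  - 2 *: (Re (Cderive h (fun y => stereo b (s y)) x) *:
            isotropic_re b (stereo_re b (s x)) (stereo_im b (s x)) +
          Im (Cderive h (fun y => stereo b (s y)) x) *:
            isotropic_im b (stereo_re b (s x)) (stereo_im b (s x))).
Proof.
move=> Ux; have D i := entry_is_derive h i Ux; have d0 := D0 Ux.
have cst a := is_deriveC_fun (V := E) a x h.
have Hd := is_deriveV_fun (f := fun y => stereo_den b (s y)) d0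
  (is_deriveD_fun (cst 1) (is_deriveM_fun (cst (chart_sign R b)) (D 2))).
have [_ E1] := is_deriveM_fun (is_deriveN_fun (D 0)) Hd.
have [_ E2] := is_deriveM_fun (is_deriveN_fun (is_deriveM_fun (cst (chart_sign R b)) (D 1))) Hd.
have T := tangent_frame (Ss Ux) d0 (dot_derive_sphere h Ux).
rewrite /= in T; rewrite T; congr (_ *: (_ *: _ + _ *: _)); rewrite /=.
  by apply: etrans _ (esym E1); field.
by apply: etrans _ (esym E2); field.
Qed.

Variable A : E -> 'M[R]_3.
Hypotheses (CA : entrywise_C 1 U A) (QA : forall y, U y -> Q (s y, A y)).

(** The formula omega = Re ((- 2 du / q) w) along a map (s, A) to the bundle. *)
Lemma tangent_inv_along x h : U x -> A x != 0 ->
  fiber b (s x, A x) != 0 /\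
  tangent_inv (s x, A x) ('D_h s x) =
  Re3 ((- 2 * Cderive h (fun y => stereo b (s y)) x / fiber b (s x, A x)) *:
       isotropic b (stereo b (s x))).
Proof.
move=> Ux A0.
have sE : (s x, A x).1 = inv_stereo b (stereo_re b (s x)) (stereo_im b (s x)).
  by rewrite /= stereoK //; [exact: Ss|exact: D0].
split; first exact: fiber_neq0 (QA Ux) sE A0.
by rewrite (tangent_inv_complex (QA Ux) sE A0 (stereo_derive h Ux)) Re3_isotropic.
Qed.

Lemma derive_base_eq0 x h : U x -> Cderive h (fun y => stereo b (s y)) x = 0 -> 'D_h s x = 0.
Proof.
move=> Ux u0; have := stereo_derive h Ux; rewrite u0 !scale0r addr0 scaler0 => /eqP.
by rewrite scaler_eq0 expf_eq0 (negbTE (sq_norm1_neq0 _ _)) andbF => /eqP.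
Qed.

(** The matrix A is a rational expression in u and q by fiber_decomp, so a vector
    in the kernel of du and dq is in the kernel of dA. With derive_base_eq0 this
    shows that the coordinates (u, q) of an immersion form an immersion. *)
Lemma derive_fiber_eq0 x h : U x -> Cderive h (fun y => stereo b (s y)) x = 0 ->
  Cderive h (fun y => fiber b (s y, A y)) x = 0 -> 'D_h A x = 0.
Proof.
move=> Ux u0 q0.
have Cu := complex_class_C_stereo oU D0 Cs; have Cq := complex_class_C_fiber oU D0 Cs CA.
have [U1 U2] := is_Cderive_class h Cu Ux; have [Q1 Q2] := is_Cderive_class h Cq Ux.
rewrite u0 in U1 U2; rewrite q0 in Q1 Q2.
(* Maps whose derivative along h vanishes at x are closed under rational operations. *)
pose Z (f : E -> R) := is_derive x h f 0.
have ZM f g : Z f -> Z g -> Z (fun y => f y * g y).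
  by move=> Hf Hg; apply: is_derive_eq (is_deriveM_fun Hf Hg) _; rewrite !mulr0 addr0.
have ZD f g : Z f -> Z g -> Z (fun y => f y + g y).
  by move=> Hf Hg; apply: is_derive_eq (is_deriveD_fun Hf Hg) _; rewrite addr0.
have ZN f : Z f -> Z (fun y => - f y).
  by move=> Hf; apply: is_derive_eq (is_deriveN_fun Hf) _; rewrite oppr0.
have ZC a : Z (fun=> a) by exact: is_deriveC_fun.
have ZV f : f x != 0 -> Z f -> Z (fun y => (f y)^-1).
  by move=> f0 Hf; apply: is_derive_eq (is_deriveV_fun f0 Hf) _; rewrite oppr0 mul0r.
pose u1 y := stereo_re b (s y); pose u2 y := stereo_im b (s y).
have Z1 : Z u1 := U1; have Z2 : Z u2 := U2.
have Zn : Z (fun y => sq_norm1 (u1 y) (u2 y)).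
  by apply: (ZD _ _ (ZD _ _ (ZC 1) (ZM _ _ Z1 Z1)) (ZM _ _ Z2 Z2)).
have n0 y : sq_norm1 (u1 y) (u2 y) != 0 := sq_norm1_neq0 _ _.
have Zwr (v1 v2 : E -> R) i : Z v1 -> Z v2 -> Z (fun y => isotropic_re b (v1 y) (v2 y) i 0).
  move=> V1 V2.
  have -> : (fun y => isotropic_re b (v1 y) (v2 y) i 0) = (fun y => nth 0
     [:: 1 + - (v1 y * v1 y) + v2 y * v2 y; - (chart_sign R b * (2 * v1 y * v2 y));
         chart_sign R b * (2 * v1 y)] i) by apply/funext => y; rewrite mxE.
  case: i => [[|[|[|//]]]] hi /=.
  - exact: (ZD _ _ (ZD _ _ (ZC 1) (ZN _ (ZM _ _ V1 V1))) (ZM _ _ V2 V2)).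
  - exact: (ZN _ (ZM _ _ (ZC (chart_sign R b)) (ZM _ _ (ZM _ _ (ZC 2) V1) V2))).
  exact: (ZM _ _ (ZC (chart_sign R b)) (ZM _ _ (ZC 2) V1)).
have Zwi (v1 v2 : E -> R) i : Z v1 -> Z v2 -> Z (fun y => isotropic_im b (v1 y) (v2 y) i 0).
  move=> V1 V2.
  have -> : (fun y => isotropic_im b (v1 y) (v2 y) i 0) = (fun y => nth 0
     [:: - (2 * v1 y * v2 y); chart_sign R b * (1 + v1 y * v1 y + - (v2 y * v2 y));
         chart_sign R b * (2 * v2 y)] i) by apply/funext => y; rewrite mxE.
  case: i => [[|[|[|//]]]] hi /=.
  - exact: (ZN _ (ZM _ _ (ZM _ _ (ZC 2) V1) V2)).
  - exact: (ZM _ _ (ZC (chart_sign R b))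
      (ZD _ _ (ZD _ _ (ZC 1) (ZM _ _ V1 V1)) (ZN _ (ZM _ _ V2 V2)))).
  exact: (ZM _ _ (ZC (chart_sign R b)) (ZM _ _ (ZC 2) V2)).
have {}Zwr i := Zwr u1 u2 i Z1 Z2; have {}Zwi i := Zwi u1 u2 i Z1 Z2.
have [_ ->//] : is_derive x h A 0.
apply: is_derive_mx => i j; rewrite mxE.
pose W1 y l := isotropic_re b (u1 y) (u2 y) l 0; pose W2 y l := isotropic_im b (u1 y) (u2 y) l 0.
pose q1 y := fiber_re b (u1 y) (u2 y) (A y); pose q2 y := fiber_im b (u1 y) (u2 y) (A y).
have : Z (fun y => (sq_norm1 (u1 y) (u2 y) * sq_norm1 (u1 y) (u2 y))^-1 *
    (sq_norm1 (u1 y) (u2 y) * sq_norm1 (u1 y) (u2 y))^-1 *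
    (q1 y * (W1 y i * W1 y j + - (W2 y i * W2 y j)) +
     q2 y * (W1 y i * W2 y j + W2 y i * W1 y j))).
  have Zn2 : Z (fun y => (sq_norm1 (u1 y) (u2 y) * sq_norm1 (u1 y) (u2 y))^-1).
    apply: (ZV (fun y => sq_norm1 (u1 y) (u2 y) * sq_norm1 (u1 y) (u2 y))).
      exact: mulf_neq0.
    exact: (ZM _ _ Zn Zn).
  apply: (ZM _ _ (ZM _ _ Zn2 Zn2) (ZD _ _ (ZM _ _ Q1 _) (ZM _ _ Q2 _))).
    exact: (ZD _ _ (ZM _ _ (Zwr i) (Zwr j)) (ZN _ (ZM _ _ (Zwi i) (Zwi j)))).
  exact: (ZD _ _ (ZM _ _ (Zwr i) (Zwi j)) (ZM _ _ (Zwi i) (Zwr j))).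
apply: near_eq_is_derive; apply: filterS (open_nbhs_nbhs (conj oU Ux)) => y Uy.
have [_ sA As tA] := QA Uy; rewrite /= in sA As tA.
have As' : A y *m inv_stereo b (u1 y) (u2 y) = 0 by rewrite stereoK //; [exact: Ss|exact: D0].
have := congr1 (fun M : 'M[R]_3 => M i j) (fiber_decomp sA As' tA).
rewrite !(mxE, big_ord1) => EA.
have EA' : sq_norm1 (u1 y) (u2 y) ^+ 4 * A y i j =
    q1 y * (W1 y i * W1 y j + - (W2 y i * W2 y j)) +
     q2 y * (W1 y i * W2 y j + W2 y i * W1 y j).
  by rewrite /W1 /W2 !mxE; exact: EA.
by rewrite -EA'; move: (sq_norm1 _ _) (n0 y) => n n1; field.
Qed.

End Tangents.

End MapsToQ.

(** * Complex derivatives and real differentials *)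

Section ComplexDerivative.
Variable R : realType.
Local Notation CC := (R[i]^o).
Local Notation Re := complex.Re.
Local Notation Im := complex.Im.
Local Notation E := (R * R)%type.

(** The modulus as a real number, while the norm of a complex number is complex. *)
Definition cabs (z : CC) : R := Normc.normc z.

Lemma cabsE (z : CC) : `|z| = ((cabs z)%:C)%C.
Proof. by []. Qed.

Lemma cabs0 : cabs 0 = 0. Proof. exact: Normc.normc0. Qed.
Lemma cabs_ge0 (z : CC) : 0 <= cabs z. Proof. by case: z => a b; exact: sqrtr_ge0. Qed.
Lemma cabsM (x y : CC) : cabs (x * y) = cabs x * cabs y. Proof. exact: Normc.normcM. Qed.
Lemma cabsV (x : CC) : cabs x^-1 = (cabs x)^-1. Proof. exact: Normc.normcV. Qed.
Lemma cabsN (x : CC) : cabs (- x) = cabs x. Proof. exact: normcN. Qed.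
Lemma cabsD (x y : CC) : cabs (x + y) <= cabs x + cabs y. Proof. exact: le_normcD. Qed.
Lemma cabsB (x y : CC) : cabs (x - y) <= cabs x + cabs y.
Proof. by rewrite -(cabsN y); exact: cabsD. Qed.
Lemma cabsC (x y : CC) : cabs (x - y) = cabs (y - x).
Proof. by rewrite -cabsN opprB. Qed.

Lemma cabs_eq0 (x : CC) : (cabs x == 0) = (x == 0).
Proof.
apply/eqP/eqP => [|->]; last exact: cabs0.
exact: Normc.eq0_normc.
Qed.

Lemma cabs_gt0 (x : CC) : (0 < cabs x) = (x != 0).
Proof. by rewrite lt_def cabs_ge0 andbT cabs_eq0. Qed.

Lemma cabs_real (a : R) : cabs (toC (a, 0)) = `|a|.
Proof. by rewrite /cabs /= expr0n addr0 sqrtr_sqr. Qed.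

Lemma ofC_le_cabs (z : CC) : `|ofC z| <= cabs z.
Proof.
case: z => a b; rewrite prod_norm_le /cabs /= -!sqrtr_sqr.
by rewrite !ler_wsqrtr // ?lerDl ?lerDr sqr_ge0.
Qed.

Lemma cabs_le_ofC (z : CC) : cabs z <= 2 * `|ofC z|.
Proof.
have -> : z = toC (Re z, 0) + 'i%C * toC (Im z, 0) :> CC.
  by apply: CC_eq; rewrite ?Re_add ?Im_add ?Re_mul ?Im_mul /=; ring.
rewrite (le_trans (cabsD _ _)) // cabsM !cabs_real.
have -> : cabs 'i%C = 1 by rewrite /cabs /= expr0n add0r expr1n sqrtr1.
have [/= n1 n2] := prod_norm_ge (ofC (toC (Re z, 0) + 'i%C * toC (Im z, 0))).
move: n1 n2; rewrite !(mulr0, mul0r, subr0, add0r, addr0, mul1r, sub0r, oppr0).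
by move: `|_| `|_| `|_| => *; lra.
Qed.

Lemma toCK : cancel (@toC R) (@ofC R). Proof. by case. Qed.
Lemma ofCK : cancel (@ofC R) (@toC R). Proof. by case. Qed.
Lemma toCB (x y : E) : toC (x - y) = toC x - toC y. Proof. by []. Qed.
Lemma ofCB (x y : CC) : ofC (x - y) = ofC x - ofC y.
Proof. by case: x; case: y. Qed.

Lemma cabs_toC_le (p : E) : cabs (toC p) <= 2 * `|p|.
Proof. by rewrite -{2}(toCK p); exact: cabs_le_ofC. Qed.

Lemma nbhs_cabsP (z : CC) (P : set CC) :
  nbhs z P <-> exists2 e : R, 0 < e & forall w, cabs (w - z) < e -> P w.
Proof.
split=> [/nbhs_ballP[e /= e0 He]|[e e0 He]].
  have Ee : e = ((Re e)%:C)%C.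
    by move: e0; rewrite ltcE => /andP[/eqP Ie _]; case: (e) Ie => a c /= ->.
  have Re0 : 0 < Re e by move: e0; rewrite Ee ltcR.
  exists (Re e) => // w Hw; apply: He; rewrite -ball_normE /= Ee.
  by rewrite cabsE ltcR cabsC.
apply/nbhs_ballP; exists (e%:C)%C; first by rewrite /= ltcR.
by move=> w; rewrite -ball_normE /= cabsE ltcR cabsC; exact: He.
Qed.

Lemma nbhs_pairP (x : E) (P : set E) :
  nbhs x P <-> exists2 e : R, 0 < e & forall y, `|y - x| < e -> P y.
Proof.
split=> [/nbhs_ballP[e /= e0 He]|[e e0 He]].
  by exists e => // y Hy; apply: He; rewrite -ball_normE /= distrC.
by apply/nbhs_ballP; exists e => // y; rewrite -ball_normE /= distrC; exact: He.
Qed.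

Lemma toC_continuous : continuous (@toC R).
Proof.
move=> x P /nbhs_cabsP[e e0 He]; apply/nbhs_pairP; exists (e / 2); first by rewrite divr_gt0.
move=> y Hy; apply: He; rewrite -toCB (le_lt_trans (cabs_toC_le _)) //; lra.
Qed.

Lemma ofC_continuous : continuous (@ofC R).
Proof.
move=> x P /nbhs_pairP[e e0 He]; apply/nbhs_cabsP; exists e => // w Hw.
by apply: He; rewrite -ofCB (le_lt_trans (ofC_le_cabs _)).
Qed.

(** Complex differentiability as a first-order estimate with real bounds, ready to
    be combined with real differentials. *)
Definition Cdiff (f : CC -> CC) (z l : CC) := forall e : R, 0 < e ->
  \forall w \near z, cabs (f w - f z - l * (w - z)) <= e * cabs (w - z).

Lemma is_derive_Cdiff (f : CC -> CC) (z l : CC) : is_derive z 1 f l <-> Cdiff f z l.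
Proof.
have H : (fun h : CC => h^-1 *: (f (h *: 1 + z) - f z)) @ (0 : CC)^' --> l <-> Cdiff f z l.
  split.
    move=> /cvgrPdist_le Hc e e0.
    have /Hc : (0 : R[i]) < (e%:C)%C by rewrite ltcR.
    rewrite near_withinE => /nbhs_cabsP[d d0 Hd]; apply/nbhs_cabsP; exists d => // w Hw.
    have [->|wz] := eqVneq w z; first by rewrite !subrr mulr0 subrr !cabs0 mulr0.
    have wz0 : w - z != 0 by rewrite subr_eq0.
    have := Hd (w - z); rewrite subr0 => /(_ Hw wz0).
    rewrite [_%:A](mulr1 (w - z)) subrK cabsE lecR => Hl.
    have -> : f w - f z - l * (w - z) = - ((l - (w - z)^-1 * (f w - f z)) * (w - z)).
      by field.
    by rewrite cabsN cabsM ler_wpM2r // cabs_ge0.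
  move=> Hc; apply/cvgrPdist_le => e e0.
  have Ee : e = ((Re e)%:C)%C.
    by move: e0; rewrite ltcE => /andP[/eqP Ie _]; case: (e) Ie => a c /= ->.
  have Re0 : 0 < Re e by move: e0; rewrite Ee ltcR.
  have /nbhs_cabsP[d d0 Hd] := Hc _ Re0.
  rewrite near_withinE; apply/nbhs_cabsP; exists d => // h; rewrite subr0 => hd h0.
  have := Hd (h + z); rewrite addrK => /(_ hd) Hh.
  rewrite [_%:A](mulr1 h) Ee cabsE lecR.
  have -> : l - h^-1 *: (f (h + z) - f z) = - (h^-1 * (f (h + z) - f z - l * h)).
    by rewrite /GRing.scale /=; field.
  by rewrite cabsN cabsM cabsV ler_pdivrMl ?cabs_gt0 // [leRHS]mulrC.
split=> [[d E1]|/(H.2) Hc]; first by apply: (H.1); rewrite -E1; exact: d.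
by apply: DeriveDef; [apply/cvg_ex; exists l|exact: cvg_lim].
Qed.

Lemma Cderive_frechet (U : set E) (F : E -> CC) (x : E) : open U -> complex_class_C 1 U F -> U x ->
  forall e : R, 0 < e ->
  \forall y \near x, cabs (F y - F x - Cderive (y - x) F x) <= e * `|y - x|.
Proof.
move=> oU [F1 F2] Ux e e0.
have S1 := class_C_strictly_differentiable oU F1 Ux.
have S2 := class_C_strictly_differentiable oU F2 Ux.
have e20 : 0 < e / 2 by rewrite divr_gt0.
have [d1 d10 H1] := S1 _ e20; have [d2 d20 H2] := S2 _ e20.
apply/nbhs_pairP; exists (Num.min d1 d2); first by rewrite lt_min d10.
move=> y; rewrite lt_min => /andP[y1 y2].
have b1 : ball x d1 y by rewrite -ball_normE /= distrC.
have b2 : ball x d2 y by rewrite -ball_normE /= distrC.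
apply: le_trans (cabs_le_ofC _) _.
suff : `|ofC (F y - F x - Cderive (y - x) F x)| <= e / 2 * `|y - x|.
  by move: `|_| `|_| => *; lra.
rewrite prod_norm_le /= !Re_add !Im_add !Re_opp !Im_opp /=.
rewrite (class_C_deriveE _ oU F1 Ux) (class_C_deriveE _ oU F2 Ux).
by rewrite (H1 y x b1 (ballxx _ d10)) (H2 y x b2 (ballxx _ d20)).
Qed.

Lemma Cderive_linear (U : set E) (F : E -> CC) (x h : E) : open U -> complex_class_C 1 U F -> U x ->
  Cderive h F x = toC (h.1, 0) * Cderive (1, 0) F x + toC (h.2, 0) * Cderive (0, 1) F x.
Proof.
move=> oU [F1 F2] Ux; rewrite /Cderive.
have E1 := class_C_deriveE h oU F1 Ux; have E2 := class_C_deriveE h oU F2 Ux.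
move: ('D_h _ x) ('D_(1, 0) _ x) ('D_(0, 1) _ x) E1 => ? a b ->.
move: ('D_h _ x) ('D_(1, 0) _ x) ('D_(0, 1) _ x) E2 => ? c d ->.
by apply: CC_eq; rewrite ?Re_add ?Im_add ?Re_mul ?Im_mul /=; ring.
Qed.

(** If dF = l dg with l complex, the first-order expansion of F at x is l times
    that of g; along a Lipschitz right inverse h of g this is the expansion of
    F o h with complex derivative l. *)
Lemma derive_along_inverse (U : set E) (F g : E -> CC) (x : E) (h : CC -> E)
    (z l : CC) (K : R) :
  open U -> complex_class_C 1 U F -> complex_class_C 1 U g -> U x -> h z = x ->
  (\forall w \near z, g (h w) = w /\ `|h w - x| <= K * cabs (w - z)) ->
  (forall k, Cderive k F x = l * Cderive k g x) ->
  is_derive z 1 (F \o h) l.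
Proof.
move=> oU CF Cg Ux hz Hh Hl; apply/is_derive_Cdiff => e e0.
have l0 : 0 < 1 + cabs l by rewrite ltr_pwDl // cabs_ge0.
have K0 : 0 < 1 + `|K| by rewrite ltr_pwDl.
pose e' := e / ((1 + cabs l) * (1 + `|K|)).
have e'0 : 0 < e' by rewrite divr_gt0 // mulr_gt0.
have FF := Cderive_frechet oU CF Ux e'0; have Fg := Cderive_frechet oU Cg Ux e'0.
have gz : g x = z by rewrite -hz; have [] := nbhs_singleton Hh.
have hc : {for z, continuous h}.
  move=> P; rewrite hz => /nbhs_pairP[r r0 Hr].
  have /nbhs_cabsP[d d0 Hd] := Hh; apply/nbhs_cabsP.
  exists (Num.min d (r / (1 + `|K|))); first by rewrite lt_min d0 divr_gt0.
  move=> w; rewrite lt_min => /andP[/Hd[_ Hw]]; rewrite ltr_pdivlMr // => isotropic_re.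
  apply: Hr; apply: le_lt_trans Hw (le_lt_trans _ isotropic_re).
  rewrite mulrC ler_wpM2l ?cabs_ge0 // (le_trans (ler_norm _)) // lerDr //.
have FF' := hc _ (eq_ind_r (fun y => nbhs y _) FF hz).
have Fg' := hc _ (eq_ind_r (fun y => nbhs y _) Fg hz).
apply: filterS3 Hh FF' Fg' => w [gw hw] /= H1 H2.
rewrite hz in H1 H2 *.
have -> : F (h w) - F x - l * (w - z) =
    (F (h w) - F x - Cderive (h w - x) F x) - l * (g (h w) - g x - Cderive (h w - x) g x).
  by rewrite Hl gw gz; ring.
rewrite (le_trans (cabsB _ _)) // cabsM.
apply: (@le_trans _ _ ((1 + cabs l) * (e' * `|h w - x|))).
  by rewrite [leRHS]mulrDl mul1r; apply: lerD => //; rewrite ler_wpM2l // cabs_ge0.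
apply: (@le_trans _ _ ((1 + cabs l) * (e' * ((1 + `|K|) * cabs (w - z))))).
  rewrite ler_pM2l // ler_pM2l // (le_trans hw) // ler_wpM2r ?cabs_ge0 //.
  by rewrite (le_trans (ler_norm _)) // lerDr.
rewrite le_eqVlt; apply/orP; left; apply/eqP.
by rewrite /e'; field; rewrite !gt_eqF.
Qed.

(** The case g = id of derive_along_inverse: by the Cauchy-Riemann equation, dF is
    a complex multiple of the differential of the complex coordinate. *)
Lemma derive_of_CR (U : set E) (F : E -> CC) (z : CC) : open U -> complex_class_C 1 U F ->
  U (ofC z) -> Cderive (0, 1) F (ofC z) = 'i%C * Cderive (1, 0) F (ofC z) ->
  is_derive z 1 (F \o @ofC R) (Cderive (1, 0) F (ofC z)).
Proof.
move=> oU CF Uz CR.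
have Did x k : is_Cderive x k (@toC R) (toC k).
  by split; [exact: is_derive_fst|exact: is_derive_snd].
have DtoC x k : Cderive k (@toC R) x = toC k := is_Cderive_val (Did x k).
have CtoC : complex_class_C 1 U (@toC R).
  have cst (a : R) : class_C 0 U (fun=> a) := class_C_cst _ _ _.
  split; split.
  - by move=> x _; exact: fst_continuous.
  - move=> k; split=> [x _|]; first by have [[d _] _] := Did x k.
    apply: (class_C_ext (f := fun=> k.1)) => // x _.
    by have [[_ ->] _] := Did x k.
  - by move=> x _; exact: snd_continuous.
  move=> k; split=> [x _|]; first by have [_ [d _]] := Did x k.
  apply: (class_C_ext (f := fun=> k.2)) => // x _.
  by have [_ [_ ->]] := Did x k.
apply: (derive_along_inverse (K := 1) oU CF CtoC Uz) => //.
  apply/nbhs_cabsP; exists 1 => // w _; rewrite ofCK mul1r -ofCB; by split=> //; exact: ofC_le_cabs.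
move=> k; rewrite DtoC (Cderive_linear k oU CF Uz) CR.
have -> : toC k = toC (k.1, 0) + toC (k.2, 0) * 'i%C :> CC.
  by apply: CC_eq; rewrite ?Re_add ?Im_add ?Re_mul ?Im_mul /=; ring.
by ring.
Qed.

Lemma is_Cderive_bound (F : E -> CC) (x h : E) (d : CC) :
  is_Cderive x h F d -> forall e : R, 0 < e ->
  \forall t \near 0^', cabs (F (t *: h + x) - F x - toC (t, 0) * d) <= e * `|t|.
Proof.
move=> [[d1 e1] [d2 e2]] e e0.
have e20 : 0 < e / 2 by rewrite divr_gt0.
have L1 : (fun t : R => t^-1 *: (Re (F (t *: h + x)) - Re (F x))) @ 0^' --> Re d.
  by rewrite -e1; exact: d1.
have L2 : (fun t : R => t^-1 *: (Im (F (t *: h + x)) - Im (F x))) @ 0^' --> Im d.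
  by rewrite -e2; exact: d2.
move/cvgrPdist_le: L1 => /(_ _ e20) H1.
move/cvgrPdist_le: L2 => /(_ _ e20) H2.
have H0 : \forall t \near (0 : R)^', t != 0 by exact: nbhs_dnbhs_neq.
apply: filterS3 H0 H1 H2 => t t0 H1 H2.
apply: le_trans (cabs_le_ofC _) _.
suff : `|ofC (F (t *: h + x) - F x - toC (t, 0) * d)| <= e / 2 * `|t|.
  by move: `|_| `|_| => *; lra.
have HB (u v : R) : `|u - t^-1 *: v| <= e / 2 -> `|v - t * u| <= e / 2 * `|t|.
  move=> Hu; have -> : v - t * u = - ((u - t^-1 *: v) * t).
    by rewrite /GRing.scale /=; field.
  by rewrite normrN normrM ler_wpM2r.
rewrite prod_norm_le /= !Re_add !Im_add !Re_opp !Im_opp !Re_mul !Im_mul /=.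
by rewrite !mul0r subr0 addr0 !HB.
Qed.

Lemma is_Cderive_of_bound (F : E -> CC) (x h : E) (d : CC) : (forall e : R, 0 < e ->
  \forall t \near 0^', cabs (F (t *: h + x) - F x - toC (t, 0) * d) <= e * `|t|) ->
  is_Cderive x h F d.
Proof.
move=> HF.
suff H (p : CC -> R) : (forall z w : CC, p (z - w) = p z - p w) ->
   (forall a w, p (toC (a, 0) * w) = a * p w) -> (forall z, `|p z| <= cabs z) ->
   is_derive x h (fun y => p (F y)) (p d).
  split; apply: H.
  - by move=> z w; rewrite Re_add Re_opp.
  - by move=> a w; rewrite Re_mul /= mul0r subr0.
  - by move=> z; have [n1 _] := prod_norm_ge (ofC z); apply: le_trans n1 (ofC_le_cabs z).
  - by move=> z w; rewrite Im_add Im_opp.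
  - by move=> a w; rewrite Im_mul /= mul0r addr0.
  - by move=> z; have [_ n1] := prod_norm_ge (ofC z); apply: le_trans n1 (ofC_le_cabs z).
move=> pB pZ pn.
have H : (fun t : R => t^-1 *: (p (F (t *: h + x)) - p (F x))) @ 0^' --> p d.
  apply/cvgrPdist_le => e e0.
  have H0 : \forall t \near (0 : R)^', t != 0 by exact: nbhs_dnbhs_neq.
  apply: filterS2 H0 (HF _ e0) => t t0 Ht.
  have -> : p d - t^-1 *: (p (F (t *: h + x)) - p (F x)) =
     - (t^-1 * p (F (t *: h + x) - F x - toC (t, 0) * d)).
    by rewrite !pB pZ /GRing.scale /=; field.
  rewrite normrN normrM normfV ler_pdivrMl ?normr_gt0 //.
  by rewrite (le_trans (pn _)) // [leRHS]mulrC.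
by apply: DeriveDef; [apply/cvg_ex; exists (p d)|exact: cvg_lim].
Qed.

Lemma is_Cderive_holomorphic (f : CC -> CC) (x h : E) (l : CC) :
  is_derive (toC x) 1 f l -> is_Cderive x h (f \o @toC R) (l * toC h).
Proof.
move=> /is_derive_Cdiff Hf; apply: is_Cderive_of_bound => e e0.
have h0 : 0 < 1 + cabs (toC h) by rewrite ltr_pwDl // cabs_ge0.
have /nbhs_cabsP[d d0 Hd] := Hf _ (divr_gt0 e0 h0).
have : \forall t \near (0 : R)^', `|t| < d / (1 + cabs (toC h)).
  by apply: dnbhs0_lt; rewrite divr_gt0.
apply: filterS => t; rewrite ltr_pdivlMr // => Ht.
have Et : toC (t *: h + x) - toC x = toC (t, 0) * toC h.
  by apply: CC_eq; rewrite ?Re_add ?Im_add ?Re_opp ?Im_opp ?Re_mul ?Im_mul /=;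
     rewrite /GRing.scale /=; ring.
have := Hd (toC (t *: h + x)); rewrite Et cabsM cabs_real.
have -> : l * (toC (t, 0) * toC h) = toC (t, 0) * (l * toC h) by ring.
move=> H; apply: le_trans (H _) _.
  by apply: le_lt_trans Ht; rewrite ler_wpM2l // lerDr.
rewrite mulrCA mulrC ler_wpM2r //.
by rewrite mulrAC ler_pdivrMr // ler_wpM2l ?ltW // ltrDr.
Qed.

(** Near z, f2 w - f2 z is c/a times f1 w - f1 z up to a small multiple of the
    latter, as a is nonzero. The last hypothesis carries this relation over to F1
    and F2 near x, and dividing by the step along h gives the relation of the
    derivatives. *)
Lemma dependent_of_holomorphic (f1 f2 : CC -> CC) (F1 F2 : E -> CC) (x h : E)
    (z a c d1 d2 : CC) :
  is_derive z 1 f1 a -> is_derive z 1 f2 c -> a != 0 ->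
  is_Cderive x h F1 d1 -> is_Cderive x h F2 d2 -> f1 z = F1 x -> f2 z = F2 x ->
  (forall N, nbhs z N ->
     \forall y \near x, exists2 w, N w & f1 w = F1 y /\ f2 w = F2 y) ->
  c * d1 = a * d2.
Proof.
move=> /is_derive_Cdiff H1 /is_derive_Cdiff H2 a0 D1 D2 E1 E2 HN.
have ca : 0 < cabs a by rewrite cabs_gt0.
apply/eqP; rewrite -subr_eq0 -cabs_eq0; apply/eqP/le_anti; rewrite cabs_ge0 andbT.
pose C := 1 + (cabs a + cabs c) * (2 / cabs a) * (1 + cabs d1) + (cabs a + cabs c).
have C0 : 0 < C.
  rewrite /C addrAC -addrA ltr_pwDl // addr_ge0 ?mulr_ge0 ?addr_ge0 ?cabs_ge0 //.
  by rewrite invr_ge0 cabs_ge0.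
apply/ler_addgt0Pl => e e0; rewrite addr0.
(* The bound cabs a / 2 keeps w - z comparable to f1 w - f1 z; C collects the
   constants of the final estimate. *)
pose r := Num.min 1 (Num.min (cabs a / 2) (e / C)).
have r0 : 0 < r by rewrite !lt_min ltr01 !divr_gt0.
have [r1 ra re] : [/\ r <= 1, r <= cabs a / 2 & r <= e / C].
  by rewrite /r; split; rewrite !ge_min lexx ?orbT.
have HF : \forall y \near x,
    cabs (c * (F1 y - F1 x) - a * (F2 y - F2 x)) <=
    (cabs a + cabs c) * r * (2 / cabs a) * cabs (F1 y - F1 x).
  have NW : nbhs z [set w | cabs (f1 w - f1 z - a * (w - z)) <= r * cabs (w - z) /\
      cabs (f2 w - f2 z - c * (w - z)) <= r * cabs (w - z)].
    by apply: filterS2 (H1 _ r0) (H2 _ r0).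
  apply: filterS (HN _ NW) => y [w /= [h1 h2] [<- <-]]; rewrite -E1 -E2.
  have wz : cabs (w - z) <= 2 / cabs a * cabs (f1 w - f1 z).
    have : cabs a * cabs (w - z) <= cabs (f1 w - f1 z) + r * cabs (w - z).
      have -> : cabs a * cabs (w - z) =
          cabs ((f1 w - f1 z) - (f1 w - f1 z - a * (w - z))).
        by rewrite -cabsM; congr cabs; ring.
      by rewrite (le_trans (cabsB _ _)) // lerD2l.
    have : r * cabs (w - z) <= cabs a / 2 * cabs (w - z).
      by rewrite ler_wpM2r // cabs_ge0.
    move=> h3 h4; rewrite mulrAC ler_pdivlMr //; lra.
  have -> : c * (f1 w - f1 z) - a * (f2 w - f2 z) =
     c * (f1 w - f1 z - a * (w - z)) - a * (f2 w - f2 z - c * (w - z)) by ring.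
  apply: (@le_trans _ _ ((cabs a + cabs c) * r * cabs (w - z))).
    rewrite (le_trans (cabsB _ _)) // !cabsM -mulrA mulrDl addrC.
    by rewrite lerD // ler_wpM2l // cabs_ge0.
  rewrite -[leRHS]mulrA ler_wpM2l //.
  by rewrite mulr_ge0 ?addr_ge0 ?cabs_ge0 // ltW.
have /nbhs_pairP[dl dl0 Hdl] := HF.
have Hx : \forall t \near (0 : R)^', `|t *: h + x - x| < dl.
  have N0 : 0 < 1 + `|h| by rewrite ltr_pwDl.
  have : \forall t \near (0 : R)^', `|t| < dl / (1 + `|h|).
    by apply: dnbhs0_lt; rewrite divr_gt0.
  apply: filterS => t; rewrite ltr_pdivlMr // addrK normrZ; apply: le_lt_trans.
  by rewrite ler_wpM2l // lerDr.
have H0 : \forall t \near (0 : R)^', t != 0 by exact: nbhs_dnbhs_neq.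
have [t [t0 Ht B1 B2]] : exists t : R, [/\ t != 0, `|t *: h + x - x| < dl,
    cabs (F1 (t *: h + x) - F1 x - toC (t, 0) * d1) <= r * `|t| &
    cabs (F2 (t *: h + x) - F2 x - toC (t, 0) * d2) <= r * `|t|].
  have : \forall t \near (0 : R)^', [/\ t != 0, `|t *: h + x - x| < dl,
    cabs (F1 (t *: h + x) - F1 x - toC (t, 0) * d1) <= r * `|t| &
    cabs (F2 (t *: h + x) - F2 x - toC (t, 0) * d2) <= r * `|t|].
    have B1 := is_Cderive_bound D1 r0; have B2 := is_Cderive_bound D2 r0.
    apply: filterS2 (filterI H0 Hx) (filterI B1 B2) => t [? ?] [? ?].
    by split.
  by move=> /filter_ex[t Ht]; exists t.
have tp : 0 < `|t| by rewrite normr_gt0.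
have B3 := Hdl _ Ht.
move: B1 B2 B3; move: (F1 _ - _) (F2 _ - _) => p1 p2 B1 B2 B3.
have P1 : cabs p1 <= (1 + cabs d1) * `|t|.
  have -> : p1 = (p1 - toC (t, 0) * d1) + toC (t, 0) * d1 by rewrite subrK.
  rewrite (le_trans (cabsD _ _)) // cabsM cabs_real mulrDl mul1r lerD //.
    by rewrite (le_trans B1) // -[leRHS]mul1r ler_wpM2r // ltW.
  by rewrite mulrC.
rewrite -(ler_pM2r tp).
have -> : cabs (c * d1 - a * d2) * `|t| =
   cabs ((c * p1 - a * p2) - c * (p1 - toC (t, 0) * d1) + a * (p2 - toC (t, 0) * d2)).
  by rewrite -cabs_real -cabsM; congr cabs; ring.
apply: (@le_trans _ _ (r * C * `|t|)); last first.
  by rewrite ler_wpM2r // -ler_pdivlMr.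
rewrite (le_trans (cabsD _ _)) //.
have T1 := cabsB (c * p1 - a * p2) (c * (p1 - toC (t, 0) * d1)).
have T2 : cabs (c * (p1 - toC (t, 0) * d1)) <= cabs c * (r * `|t|).
  by rewrite cabsM ler_wpM2l // cabs_ge0.
have T3 : cabs (a * (p2 - toC (t, 0) * d2)) <= cabs a * (r * `|t|).
  by rewrite cabsM ler_wpM2l // cabs_ge0.
have T4 : (cabs a + cabs c) * r * (2 / cabs a) * cabs p1 <=
    (cabs a + cabs c) * r * (2 / cabs a) * ((1 + cabs d1) * `|t|).
  rewrite ler_wpM2l // !mulr_ge0 ?addr_ge0 ?invr_ge0 ?cabs_ge0 //.
  exact: ltW.
have rt : 0 <= r * `|t| by rewrite mulr_ge0 // ltW.
have EC : r * C * `|t| = r * `|t| + (cabs a + cabs c) * r * (2 / cabs a) * ((1 + cabs d1) * `|t|)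
   + cabs a * (r * `|t|) + cabs c * (r * `|t|) by rewrite /C; ring.
rewrite EC; move: T1 T2 T3 T4 B3 rt; clear.
move: (cabs (c * p1 - a * p2 - _)) (cabs (c * _)) (cabs (a * _)) (cabs (c * p1 - _)) => *.
lra.
Qed.

End ComplexDerivative.

(** * Holomorphic local inverses *)

Section HolomorphicInverse.
Variable R : realType.
Local Notation CC := (R[i]^o).
Local Notation Re := complex.Re.
Local Notation Im := complex.Im.
Local Notation E := (R * R)%type.

Lemma open_preimage_in (T T' : topologicalType) (U : set T) (f : T -> T') (W : set T') :
  open U -> (forall x, U x -> {for x, continuous f}) -> open W ->
  open (U `&` f @^-1` W).
Proof.
move=> oU cf oW; rewrite openE => x [Ux Wx].
apply: filterI; first exact: open_nbhs_nbhs.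
by apply: (cf x Ux); exact: open_nbhs_nbhs.
Qed.

Lemma complex_class_C_continuous (k : nat) (U : set E) (F : E -> CC) x :
  complex_class_C k U F -> U x -> {for x, continuous F}.
Proof.
move=> [F1 F2] Ux.
have c1 : {for x, continuous (fun y => Re (F y))} by case: k F1 F2 => [|k] [c _] _; exact: c.
have c2 : {for x, continuous (fun y => Im (F y))} by case: k F1 F2 => [|k] _ [c _]; exact: c.
have H : {for x, continuous (fun y => (Re (F y), Im (F y)))} by exact: (cvg_pair c1 c2).
move=> P; rewrite -[F x]ofCK => NP.
have H' : nbhs x (fun y => P (toC (ofC (F y)))) := H _ (toC_continuous NP).
suff : nbhs x (F @^-1` P) by [].
by apply: filterS H' => y; rewrite ofCK.
Qed.

(** The vectors (b, -a) and (d, -c) are annihilated when the determinant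
    a d - b c of the differential vanishes. *)
Lemma jacobian_neq0 (U : set E) (G : E -> CC) (x : E) : open U -> complex_class_C 1 U G -> U x ->
  (forall k, Cderive k G x = 0 -> k = 0) ->
  Re (Cderive (1, 0) G x) * Im (Cderive (0, 1) G x) -
  Re (Cderive (0, 1) G x) * Im (Cderive (1, 0) G x) != 0.
Proof.
move=> oU CG Ux inj.
have L k := Cderive_linear k oU CG Ux.
move: (inj) (L); move: (Cderive (1, 0) G x) (Cderive (0, 1) G x) => [a c] [b d] /= {}inj {}L.
apply/eqP => D0.
have /inj : Cderive (b, - a) G x = 0.
  rewrite L; apply: CC_eq; rewrite ?Re_add ?Im_add ?Re_mul ?Im_mul /=; first by ring.
  by transitivity (- (a * d - b * c)); [ring|rewrite D0 oppr0].
have /inj : Cderive (d, - c) G x = 0.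
  rewrite L; apply: CC_eq; rewrite ?Re_add ?Im_add ?Re_mul ?Im_mul /=; last by ring.
  by transitivity (a * d - b * c); [ring|rewrite D0].
move=> [d0 /eqP]; rewrite oppr_eq0 => /eqP c0 [b0 /eqP]; rewrite oppr_eq0 => /eqP a0.
have : Cderive (1, 0) G x = 0.
  by rewrite L a0 b0 c0 d0; apply: CC_eq; rewrite ?Re_add ?Im_add ?Re_mul ?Im_mul /=; ring.
by move=> /inj [] /eqP; rewrite oner_eq0.
Qed.

(** The inverse g of G near x makes G o g the identity, and the proportionality of
    dF and dG makes F o g holomorphic. *)
Lemma holomorphic_local_inverse (U : set E) (F G : E -> CC) (x : E) :
  open U -> complex_class_C 1 U F -> complex_class_C 1 U G -> U x ->
  (forall y h k, U y -> Cderive k F y * Cderive h G y = Cderive h F y * Cderive k G y) ->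
  (forall k, Cderive k G x = 0 -> k = 0) ->
  exists (V : set E) (D : set CC) (g : CC -> E),
  [/\ open V, V `<=` U, V x & open D] /\
  [/\ forall y, V y -> D (G y) /\ g (G y) = y,
      forall z, D z -> V (g z) /\ G (g z) = z,
      forall z, D z -> {for z, continuous g},
      forall z, D z -> derivable (F \o g) z 1 &
      forall z, D z -> is_derive z 1 (G \o g) 1].
Proof.
move=> oU CF CG Ux dep inj.
have S1 := class_C_strictly_differentiable oU CG.1 Ux.
have S2 := class_C_strictly_differentiable oU CG.2 Ux.
have J0 := jacobian_neq0 oU CG Ux inj.
have [dlt [K [dlt0 K0 Lip Op]]] := local_inverse S1 S2 J0.
have G0 : Cderive (1, 0) G x != 0.
  by apply/eqP => /inj [] /eqP; rewrite oner_eq0.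
(* On V the map G is injective and dG is nonzero in the direction (1, 0), so that
   the factor of proportionality of dF and dG is a quotient of derivatives. *)
pose V : set E := ball x dlt `&` (U `&` (Cderive (1, 0) G) @^-1` [set w | w != 0]).
have CDG : complex_class_C 0 U (Cderive (1, 0) G) := complex_class_C_derive (1, 0) CG.
have oV : open V.
  apply: openI; first exact: ball_open.
  apply: (open_preimage_in oU); first by move=> y Uy; exact: complex_class_C_continuous CDG Uy.
  by rewrite openE => w w0; exact: (near_neq0 (f := id) _ w0).
have Vx : V x by split; [exact: ballxx|split].
have LipV y y' : V y -> V y' -> `|y - y'| <= K * cabs (G y - G y').
  move=> [By _] [By' _]; apply: le_trans (Lip _ _ By By') _.
  rewrite ler_pM2l //; apply: le_trans (ofC_le_cabs _).
  by rewrite /ofC Re_add Im_add Re_opp Im_opp.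
have injV y y' : V y -> V y' -> G y = G y' -> y = y'.
  move=> Vy Vy' e; have := LipV _ _ Vy Vy'; rewrite e subrr cabs0 mulr0 normr_le0.
  by rewrite subr_eq0 => /eqP.
pose D : set CC := [set z | exists2 y, V y & G y = z].
pose g (z : CC) : E := xget x [set y | V y /\ G y = z].
have gG y : V y -> g (G y) = y.
  move=> Vy; apply: xget_unique; first by split.
  by move=> y' [Vy' e]; apply: injV.
have DgV z : D z -> V (g z) /\ G (g z) = z by move=> [y Vy <-]; rewrite gG.
have oD : open D.
  rewrite openE => z [y Vy <-].
  have /nbhs_ballP[r /= r0 Hr] : nbhs y V by apply: open_nbhs_nbhs.
  have [eta eta0 Heta] := Op y r Vy.1 r0.
  apply/nbhs_cabsP; exists eta => // w Hw.
  have [/= n1 n2] := prod_norm_ge (ofC (w - G y)).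
  have [|| y' [By' yy' e1 e2]] := Heta (Re w) (Im w).
  - rewrite distrC -Re_opp -Re_add; apply: le_lt_trans n1 _.
    exact: le_lt_trans (ofC_le_cabs _) Hw.
  - rewrite distrC -Im_opp -Im_add; apply: le_lt_trans n2 _.
    exact: le_lt_trans (ofC_le_cabs _) Hw.
  by exists y'; [exact: Hr|apply: CC_eq].
have Hg z : D z -> \forall w \near z, G (g w) = w /\ `|g w - g z| <= K * cabs (w - z).
  move=> Dz; have : nbhs z D by apply: open_nbhs_nbhs.
  apply: filterS => w Dw; have [Vz Ez] := DgV z Dz; have [Vw Ew] := DgV w Dw.
  by split=> //; have := LipV _ _ Vw Vz; rewrite Ez Ew.
exists V, D, g; split; first by split=> // y [_ []].
split.
- by move=> y Vy; split; [exists y|exact: gG].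
- exact: DgV.
- move=> z Dz P /nbhs_pairP[r r0 Hr].
  have /nbhs_cabsP[d d0 Hd] := Hg z Dz.
  apply/nbhs_cabsP; exists (Num.min d (r / K)); first by rewrite lt_min d0 divr_gt0.
  move=> w; rewrite lt_min ltr_pdivlMr // mulrC => /andP[/Hd[_ Hw] Hr2].
  by apply: Hr; exact: le_lt_trans Hr2.
- move=> z Dz; have [Vz Ez] := DgV z Dz; have [_ [Uz Gz]] := Vz.
  have Hl k : Cderive k F (g z) =
      Cderive (1, 0) F (g z) / Cderive (1, 0) G (g z) * Cderive k G (g z).
    by rewrite mulrAC; apply: (canRL (mulfK Gz)); rewrite dep.
  by have [d _] := derive_along_inverse oU CF CG Uz erefl (Hg z Dz) Hl.
move=> z Dz; have [Vz Ez] := DgV z Dz; have [_ [Uz Gz]] := Vz.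
by apply: (derive_along_inverse oU CG CG Uz erefl (Hg z Dz)) => k; rewrite mul1r.
Qed.

End HolomorphicInverse.

(** * Holomorphic maps to the bundle *)

Section Charts.
Variable R : realType.
Local Notation R3 := 'cV[R]_3.
Local Notation CC := (R[i]^o).
Local Notation QT := (R3 * 'M[R]_3)%type.
Local Notation E := (R * R)%type.
Implicit Types (b : bool) (D : set CC).

Definition chart_u b : R3 -> CC := if b then @ucoord R else @vcoord R.
Definition chart_q b : QT -> CC := if b then @qcoord R else @rcoord R.

Lemma chart_uE b s : sphere s -> stereo_den b s != 0 -> chart_u b s = stereo b s.
Proof. by case: b => *; [exact: ucoordE|exact: vcoordE]. Qed.

Lemma chart_qE b p : Q p -> stereo_den b p.1 != 0 -> chart_q b p = fiber b p.
Proof. by case: b => *; [exact: qcoordE|exact: rcoordE]. Qed.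

(** The denominators of the two charts add up to 2. *)
Lemma exists_chart (s : R3) : exists b, stereo_den b s != 0.
Proof.
have [H|H] := eqVneq (stereo_den true s) 0; last by exists true.
by exists false; move: H; rewrite /stereo_den /chart_sign => H; apply/eqP => H2; lra.
Qed.

Lemma stereo_den_continuous b : continuous (stereo_den (R := R) b).
Proof.
move=> s; have c : (s' : R3) 2 0 @[s' --> s] --> s 2 0 by exact: coord_continuous.
exact: (cvgD (cvg_cst (1 : R)) (cvgM (cvg_cst (chart_sign R b)) c)).
Qed.

Lemma open_neq0 : open [set r : R | r != 0].
Proof. by rewrite openE => r r0; exact: (near_neq0 (f := id) _ r0). Qed.

Lemma open_stereo_domain b (T : topologicalType) (U : set T) (s : T -> R3) :
  open U -> (forall x, U x -> {for x, continuous s}) ->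
  open (U `&` [set y | stereo_den b (s y) != 0]).
Proof.
move=> oU cs; apply: (open_preimage_in (f := fun y => stereo_den b (s y)) oU _ open_neq0).
by move=> x Ux; exact: (continuous_comp (cs x Ux) (@stereo_den_continuous b (s x))).
Qed.

Lemma near_chart b (T : topologicalType) (f : T -> QT) z :
  {for z, continuous f} -> stereo_den b (f z).1 != 0 ->
  \forall w \near z, stereo_den b (f w).1 != 0.
Proof.
move=> cf d0.
have c : {for z, continuous (fun w => stereo_den b (f w).1)}.
  have c1 : {for z, continuous (fun w => (f w).1)}.
    by apply: continuous_cvg cf; exact: fst_continuous.
  by apply: continuous_cvg c1; exact: stereo_den_continuous.
exact: near_neq0 c d0.
Qed.

Lemma nbhs_of_open (T : topologicalType) (D : set T) z : open D -> D z -> nbhs z D.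
Proof. by move=> oD Dz; exact: open_nbhs_nbhs. Qed.

Section Near.
Variables (b : bool) (D : set CC) (f : CC -> QT) (z : CC).
Hypotheses (oD : open D) (Qf : forall w, D w -> Q (f w)) (Dz : D z).
Hypotheses (cf : {for z, continuous f}) (d0 : stereo_den b (f z).1 != 0).

Lemma near_chart_u : \near z, chart_u b (f z).1 = stereo b (f z).1.
Proof.
apply: filterS2 (nbhs_of_open oD Dz) (near_chart cf d0) => w Dw dw.
by rewrite chart_uE //; have [] := Qf Dw.
Qed.

Lemma near_chart_q : \near z, (chart_q b \o f) z = (fiber b \o f) z.
Proof.
apply: filterS2 (nbhs_of_open oD Dz) (near_chart cf d0) => w Dw dw.
by rewrite /= chart_qE //; exact: Qf.
Qed.

End Near.

Lemma stereo_den_pole b (s : R3) :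
  sphere s -> (stereo_den b s != 0) <-> s <> (if b then - e3 R else e3 R).
Proof.
by move=> Ss; rewrite stereo_den_neq0 //; case: b; rewrite /chart_sign ?scale1r ?scaleN1r ?opprK.
Qed.

(** The coordinates of the definition coincide with the explicit ones near each
    point of a chart, and derivatives are local. *)
Lemma holomorphic_to_QP D (f : CC -> QT) : open D ->
  holomorphic_to_Q D f <-> forall z, D z -> [/\ Q (f z), {for z, continuous f} &
    forall b, stereo_den b (f z).1 != 0 ->
      derivable (fun w => stereo b (f w).1) z 1 /\ derivable (fiber b \o f) z 1].
Proof.
move=> oD; split=> H z Dz.
  have Qf w : D w -> Q (f w) by move=> /H[].
  have [Qz cf Ht Hf] := H z Dz; split=> // b d0; have [Sz _ _ _] := Qz.
  have [du dq] : derivable (fun w => chart_u b (f w).1) z 1 /\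
                 derivable (chart_q b \o f) z 1.
    by move/(stereo_den_pole b Sz): d0; case: (b) => d0; [exact: Ht|exact: Hf].
  split.
    by apply: near_eq_derivable du; exact: near_chart_u oD Qf Dz cf d0.
  by apply: near_eq_derivable dq; exact: near_chart_q oD Qf Dz cf d0.
have Qf w : D w -> Q (f w) by move=> /H[].
have [Qz cf Hb] := H z Dz; have [Sz _ _ _] := Qz.
have K b : stereo_den b (f z).1 != 0 -> derivable (fun w => chart_u b (f w).1) z 1 /\
                 derivable (chart_q b \o f) z 1.
  move=> d0; have [du dq] := Hb b d0; split.
    apply: near_eq_derivable du; apply: filterS (near_chart_u oD Qf Dz cf d0).
    by move=> w ->.
  apply: near_eq_derivable dq; apply: filterS (near_chart_q oD Qf Dz cf d0).
  by move=> w ->.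
split=> // d0.
  by apply: (K true); apply/(stereo_den_pole true Sz).
by apply: (K false); apply/(stereo_den_pole false Sz).
Qed.

Lemma holomorphic_immersion_to_QP D (f : CC -> QT) : open D ->
  (forall z, D z -> [/\ Q (f z), {for z, continuous f} &
    forall b, stereo_den b (f z).1 != 0 -> exists a c : CC,
      [/\ is_derive z 1 (fun w => stereo b (f w).1) a, is_derive z 1 (fiber b \o f) c &
         a <> 0 \/ c <> 0]]) ->
  holomorphic_immersion_to_Q D f.
Proof.
move=> oD H; split.
  apply/(holomorphic_to_QP f oD) => z Dz; have [Qz cf Hb] := H z Dz.
  split; [exact: Qz|exact: cf|] => b d0.
  have [a [c [[da _] [dc _] _]]] := Hb b d0.
  by split; [exact: da|exact: dc].
have Qf w : D w -> Q (f w) by move=> /H[].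
move=> z Dz; have [Qz cf Hb] := H z Dz; have [Sz _ _ _] := Qz.
have K b : stereo_den b (f z).1 != 0 ->
    'D_1 (fun w => chart_u b (f w).1) z <> 0 \/ 'D_1 (chart_q b \o f) z <> 0.
  move=> d0; have [a [c [[_ ea] [_ ec] ac]]] := Hb b d0.
  rewrite (near_eq_derive _ (near_chart_u oD Qf Dz cf d0)) ea.
  by rewrite (near_eq_derive _ (near_chart_q oD Qf Dz cf d0)) ec.
split=> d0.
  by apply: (K true); apply/(stereo_den_pole true Sz).
by apply: (K false); apply/(stereo_den_pole false Sz).
Qed.

Lemma derive_inv_pow4 (u q : CC -> CC) (z a c : CC) : u z != 0 ->
  is_derive z 1 u a -> is_derive z 1 q c ->
  is_derive z 1 (fun w => (u w)^-1) (- a / u z ^+ 2) /\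
  is_derive z 1 (fun w => (u w)^-1 ^+ 4 * q w)
    (c / u z ^+ 4 - 4 * q z * a / u z ^+ 5).
Proof.
move=> u0 Hu Hq; have [du eu] := Hu.
pose i w : CC := (u w)^-1.
have Hi : is_derive z 1 i (- a / u z ^+ 2).
  apply: DeriveDef; first exact: (@derivableV R[i] R[i]^o u z 1 u0 du).
  rewrite (@deriveV R[i] R[i]^o u z 1 u0 du) eu.
  by rewrite /GRing.scale /= mulNr mulrC mulNr.
split; first exact: Hi.
have M := @is_deriveM R[i] R[i]^o.
have H := M _ _ _ _ _ _ (M _ _ _ _ _ _ Hi (M _ _ _ _ _ _ Hi (M _ _ _ _ _ _ Hi Hi))) Hq.
suff E : c / u z ^+ 4 - 4 * q z * a / u z ^+ 5 =
    (i * (i * (i * i))) z *: c + q z *: (i z *: (i z *: (i z *: (- a / u z ^+ 2) +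
      i z *: (- a / u z ^+ 2)) + (i * i) z *: (- a / u z ^+ 2)) +
      (i * (i * i)) z *: (- a / u z ^+ 2)).
  by rewrite E; exact: H.
by rewrite !mulrfctE /i /GRing.scale /=; field.
Qed.

(** A nonzero derivative stays nonzero because the transition
    (u, q) |-> (1/u, q/u^4) is triangular with invertible diagonal. *)
Lemma flip_derive b (f : CC -> QT) (z a c : CC) : {for z, continuous f} ->
  (\forall w \near z, Q (f w)) -> stereo_den b (f z).1 != 0 -> stereo_den (~~ b) (f z).1 != 0 ->
  is_derive z 1 (fun w => stereo b (f w).1) a -> is_derive z 1 (fiber b \o f) c ->
  a <> 0 \/ c <> 0 -> exists a' c' : CC,
  [/\ is_derive z 1 (fun w => stereo (~~ b) (f w).1) a',
      is_derive z 1 (fiber (~~ b) \o f) c' & a' <> 0 \/ c' <> 0].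
Proof.
move=> cf Qf d1 d2 Ha Hc ac.
have [Sz _ _ _] := nbhs_singleton Qf.
have [u0 _] := stereo_flip Sz d1 d2.
have [Ha' Hc'] := derive_inv_pow4 u0 Ha Hc.
have near_d : \forall w \near z,
    [/\ Q (f w), stereo_den b (f w).1 != 0 & stereo_den (~~ b) (f w).1 != 0].
  by apply: filterS3 Qf (near_chart cf d1) (near_chart cf d2).
exists (- a / stereo b (f z).1 ^+ 2),
  (c / stereo b (f z).1 ^+ 4 - 4 * (fiber b \o f) z * a / stereo b (f z).1 ^+ 5).
split.
- apply: near_eq_is_derive Ha'; apply: filterS near_d => w [[Sw _ _ _] e1 e2].
  by have [_ ->] := stereo_flip Sw e1 e2.
- apply: near_eq_is_derive Hc'; apply: filterS near_d => w [Qw e1 e2].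
  by rewrite /= (fiber_flip Qw e1 e2).
have [a0|a0] := eqVneq a 0.
  right; rewrite a0 mulr0 mul0r subr0; case: ac => // c0.
  by apply/eqP; rewrite mulf_neq0 ?invr_eq0 ?expf_neq0 //; apply/eqP.
by left; apply/eqP; rewrite mulf_neq0 ?oppr_eq0 ?invr_eq0 ?expf_neq0.
Qed.

End Charts.

(** * Closed forms and complex curves *)

Section Curves.
Variable R : realType.
Local Notation R3 := 'cV[R]_3.
Local Notation CC := (R[i]^o).
Local Notation QT := (R3 * 'M[R]_3)%type.
Local Notation E := (R * R)%type.

Lemma continuous_entry m n (T : topologicalType) (M : T -> 'M[R]_(m, n)) x i j :
  {for x, continuous M} -> {for x, continuous (fun y => M y i j)}.
Proof.
move=> cM; exact: (continuous_comp cM (@coord_continuous R m n i j (M x))).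
Qed.

Lemma class_C_entrywise m n (k : nat) (U : set E) (M : E -> 'M[R]_(m, n)) :
  open U -> class_C k U M -> entrywise_C k U M.
Proof.
move=> oU CM i j; elim: k M CM => [|k IH] M [cM HM].
  split=> // x Ux.
  exact: continuous_entry (cM x Ux).
split=> [x Ux|h].
  exact: continuous_entry (cM x Ux).
have [dM CdM] := HM h; split=> [x Ux|].
  by have /derivable_mxP := dM x Ux; apply.
apply: (class_C_ext (f := fun y => 'D_h M y i j)) => //; last exact: IH.
by move=> x Ux; rewrite derive_mx ?mxE //; exact: dM.
Qed.

Section Surface.
Variables (U : set E) (phi : E -> QT).
Hypotheses (oU : open U) (Cphi : class_C 2 U phi).

Let s y := (phi y).1.
Let A y := (phi y).2.

Lemma phi_derivable y h : U y -> derivable phi y h.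
Proof. by move=> Uy; have [_ /(_ h)[d _]] := Cphi; exact: d. Qed.

Lemma base_derive y h : U y -> 'D_h s y = ('D_h phi y).1.
Proof.
move=> Uy.
by have [_] := derive_linear (l := @fst R3 'M[R]_3) (@fst_continuous _ _) (@phi_derivable y h Uy).
Qed.

Lemma fiber_derive y h : U y -> 'D_h A y = ('D_h phi y).2.
Proof.
move=> Uy.
by have [_] := derive_linear (l := @snd R3 'M[R]_3) (@snd_continuous _ _) (@phi_derivable y h Uy).
Qed.

Lemma entrywise_base : entrywise_C 2 U s.
Proof.
apply: (class_C_entrywise oU).
exact: (class_C_linear (l := @fst R3 'M[R]_3) oU (@fst_continuous _ _) Cphi).
Qed.

Lemma entrywise_fiber : entrywise_C 2 U A.
Proof.
apply: (class_C_entrywise oU).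
exact: (class_C_linear (l := @snd R3 'M[R]_3) oU (@snd_continuous _ _) Cphi).
Qed.

Definition chart_domain (b : bool) := U `&` [set y | stereo_den b (phi y).1 != 0].

Lemma open_chart_domain b : open (chart_domain b).
Proof.
apply: (open_stereo_domain (s := fun y => (phi y).1) b oU) => y Uy.
by have [c _] := Cphi; exact: (continuous_comp (c y Uy) (@fst_continuous _ _ (phi y))).
Qed.

End Surface.

Lemma entrywise_CS m n (k : nat) (U V : set E) (M : E -> 'M[R]_(m, n)) : V `<=` U ->
  entrywise_C k U M -> entrywise_C k V M.
Proof.
move=> VU CM i j; move: (fun y => M y i j) (CM i j) => f {CM M}.
elim: k f => [|k IH] f [cf Hf].
  by split=> // x /VU; exact: cf.
split=> [x /VU|h]; first exact: cf.
have [df Cf] := Hf h; split=> [x /VU|]; first exact: df.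
exact: IH.
Qed.

Section SurfaceChart.
Variables (U : set E) (phi : E -> QT) (b : bool).
Hypotheses (oU : open U) (Cphi : class_C 2 U phi).
Hypothesis (Qphi : forall y, U y -> Q (phi y)).
Hypothesis (phi0 : forall y, U y -> (phi y).2 != 0).

Let V := chart_domain U phi b.
Let u y := stereo b (phi y).1.
Let q y := fiber b (phi y).

Let oV : open V. Proof. exact: open_chart_domain. Qed.
Let VU : V `<=` U. Proof. by move=> y []. Qed.
Let Vd y : V y -> stereo_den b (phi y).1 != 0. Proof. by case. Qed.
Let Cs := entrywise_CS VU (entrywise_base oU Cphi).
Let CA := entrywise_CS VU (entrywise_fiber oU Cphi).
Let QV y : V y -> Q ((phi y).1, (phi y).2).
Proof. by move=> /VU Uy; rewrite -surjective_pairing; exact: Qphi. Qed.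
Let SV y : V y -> sphere (phi y).1. Proof. by move=> /QV[]. Qed.
Let lower1 m n (M : E -> 'M[R]_(m, n)) : entrywise_C 2 V M -> entrywise_C 1 V M.
Proof. by move=> CM i j; exact: class_CW. Qed.

Lemma chart_u_class : complex_class_C 2 V u.
Proof. exact: complex_class_C_stereo. Qed.

Lemma chart_q_class : complex_class_C 2 V q.
Proof. exact: (complex_class_C_fiber oV Vd Cs CA). Qed.

Let Cu1 : complex_class_C 1 V u.
Proof. by have [? ?] := chart_u_class; split; exact: class_CW. Qed.
Let Cq1 : complex_class_C 1 V q.
Proof. by have [? ?] := chart_q_class; split; exact: class_CW. Qed.

Lemma closed_chart x h k : V x ->
  'D_k (fun y => omega (phi y) ('D_h phi y)) x =
  'D_h (fun y => omega (phi y) ('D_k phi y)) x <->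
  Cderive k q x * Cderive h u x = Cderive h q x * Cderive k u x.
Proof.
move=> Vx.
have T h' y (Vy : V y) := tangent_inv_along oV Vd (lower1 Cs) SV QV h' Vy (phi0 (VU Vy)).
have W h' y : V y ->
    omega (phi y) ('D_h' phi y) = Re3 ((- 2 * Cderive h' u y / q y) *: isotropic b (u y)).
  move=> Vy; have [_] := T h' y Vy; rewrite /omega -surjective_pairing => <-.
  by rewrite (base_derive Cphi h' (VU Vy)).
apply: (exterior_derivative_inv (b := b) oV Vx chart_u_class Cq1).
- by move=> y Vy; have [+ _] := T 0 y Vy; rewrite -surjective_pairing.
- by move=> y; exact: W.
by move=> y; exact: W.
Qed.

Lemma immersion_chart x k : V x -> immersion_at phi x ->
  Cderive k u x = 0 -> Cderive k q x = 0 -> k = 0.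
Proof.
move=> Vx imm u0 q0; apply: imm.
have s0 := derive_base_eq0 oV Vd (lower1 Cs) SV Vx u0.
have A0 : 'D_k (fun y => (phi y).2) x = 0.
  apply: (derive_fiber_eq0 oV Vd (lower1 Cs) SV (lower1 CA) QV Vx u0).
  by rewrite -[RHS]q0; congr Cderive; apply/funext => y; rewrite -surjective_pairing.
rewrite (base_derive Cphi k (VU Vx)) in s0; rewrite (fiber_derive Cphi k (VU Vx)) in A0.
by rewrite [LHS]surjective_pairing s0 A0.
Qed.

(** The differentials du and dq are proportional over the complex numbers and have
    no common kernel, so the one that is nonzero at x is injective there and serves
    as the new parameter. *)
Lemma holomorphic_reparametrization x :
  V x -> immersion_at phi x ->
  (forall y h k, V y -> Cderive k q y * Cderive h u y = Cderive h q y * Cderive k u y) ->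
  exists (V' : set E) (D : set CC) (g : CC -> E) (G : E -> CC),
  [/\ open V', V' `<=` V, V' x & open D] /\
  [/\ forall y, V' y -> D (G y) /\ g (G y) = y,
      forall z, D z -> V' (g z) /\ G (g z) = z,
      forall z, D z -> {for z, continuous g},
      (forall y, V' y -> {for y, continuous G}) &
      forall z, D z -> exists a c : CC,
       [/\ is_derive z 1 (u \o g) a, is_derive z 1 (q \o g) c & a <> 0 \/ c <> 0]].
Proof.
move=> Vx imm dep.
have n10 : ((1, 0) : E) <> 0 by move=> [] /eqP; rewrite oner_eq0.
have o0 : (1 : CC) <> 0 by apply/eqP; exact: oner_neq0.
have cont (G : E -> CC) V' : V' `<=` V -> complex_class_C 1 V G ->
    forall y, V' y -> {for y, continuous G}.
  by move=> V'V CG y /V'V; exact: complex_class_C_continuous CG.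
have [u0|u0] := eqVneq (Cderive (1, 0) u x) 0; last first.
  have inj k : Cderive k u x = 0 -> k = 0.
    move=> uk; apply: (immersion_chart Vx imm uk).
    move: uk u0 (dep x (1, 0) k Vx).
    move: (Cderive k u x) (Cderive (1, 0) u x) (Cderive k q x) (Cderive (1, 0) q x).
    move=> uk u1 qk q1 -> u0.
    by rewrite mulr0 => /eqP; rewrite mulf_eq0 (negbTE u0) orbF => /eqP.
  have [V' [D [g [H1 [Hg Hz cg dF dG]]]]] :=
    holomorphic_local_inverse oV Cq1 Cu1 Vx dep inj.
  exists V', D, g, u; split; first exact: H1.
  have [oV' V'V _ _] := H1.
  split; [exact: Hg|exact: Hz|exact: cg|exact: cont V'V Cu1|] => z Dz.
  exists 1, ('D_1 (q \o g) z); split; [exact: dG| |by left].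
  by apply: derivableP; exact: dF.
have q0 : Cderive (1, 0) q x != 0.
  by apply/eqP => q0; apply: n10; exact: (immersion_chart Vx imm u0 q0).
have inj k : Cderive k q x = 0 -> k = 0.
  move=> qk; suff uk : Cderive k u x = 0 by exact: (immersion_chart Vx imm uk qk).
  move: qk q0 (dep x (1, 0) k Vx).
  move: (Cderive k u x) (Cderive (1, 0) u x) (Cderive k q x) (Cderive (1, 0) q x).
  move=> uk u1 qk q1 -> q0.
  by rewrite mul0r => /esym/eqP; rewrite mulf_eq0 (negbTE q0) => /eqP.
have dep' y h k : V y -> Cderive k u y * Cderive h q y = Cderive h u y * Cderive k q y.
  by move=> Vy; rewrite mulrC [RHS]mulrC; exact: dep.
have [V' [D [g [H1 [Hg Hz cg dF dG]]]]] :=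
  holomorphic_local_inverse oV Cu1 Cq1 Vx dep' inj.
exists V', D, g, q; split; first exact: H1.
have [oV' V'V _ _] := H1.
split; [exact: Hg|exact: Hz|exact: cg|exact: cont V'V Cq1|] => z Dz.
exists ('D_1 (u \o g) z), 1; split; [|exact: dG|by right].
by apply: derivableP; exact: dF.
Qed.

End SurfaceChart.

Lemma local_param_sub (C : set QT) U phi y : local_param C U phi -> U y -> C (phi y).
Proof.
move=> [oU _ _ [_ emb]] Uy; have [W _ EW] := emb U oU (fun _ => id).
have : (phi @` U) (phi y) by exists y.
by rewrite EW => -[].
Qed.

(** The parametrization phi composed with the inverse of the new complex parameter
    is holomorphic in the chart at hand, and in the other chart by flip_derive. *)
Lemma closed_to_curve (C : set QT) : C `<=` @Q R `\` @zero_section R ->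
  real_surface_in C -> omega_closed_on C -> complex_analytic_curve C.
Proof.
move=> CQ surf clos p Cp.
have [U [phi [lp [x Ux px]]]] := surf p Cp.
have sub y : U y -> C (phi y) := local_param_sub lp.
have [oU smooth imm [inj emb]] := lp.
have Cphi := smooth 2%N.
have Qphi y : U y -> Q (phi y) by move=> /sub/CQ[].
have phi0 y : U y -> (phi y).2 != 0 by move=> /sub/CQ[_ /eqP].
have [b db] := exists_chart (phi x).1.
have Vx : chart_domain U phi b x by split.
have [y h k Vy|V' [D [g [G [[oV' V'V V'x oD] [Hg Hz cg cG dg]]]]]] :=
  holomorphic_reparametrization oU Cphi Qphi Vx (imm x Ux).
  apply/(closed_chart oU Cphi Qphi phi0 h k Vy).
  exact: clos U phi lp y Vy.1 k h.
have V'U y : V' y -> U y by move=> /V'V[].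
exists D, (phi \o g); split; first exact: oD.
- apply: (holomorphic_immersion_to_QP oD) => z Dz.
  have [V'z _] := Hz z Dz.
  have cf : {for z, continuous (phi \o g)}.
    by apply: continuous_comp; [exact: cg|exact: Cphi.1 _ (V'U _ V'z)].
  split; [exact: Qphi (V'U _ V'z)|exact: cf|] => b' db'.
  have [a [c [Ha Hc ac]]] := dg z Dz.
  (* Either b' is the chart of the new parameter, or it is the opposite one. *)
  have [->|bb] := eqVneq b' b; first by exists a, c; split.
  have Eb : b' = ~~ b by move: bb; case: (b'); case: (b).
  rewrite Eb in db' *.
  apply: (flip_derive cf _ _ db' Ha Hc ac); last by have [] := V'V _ V'z.
  by apply: filterS (nbhs_of_open oD Dz) => w Dw; have [/V'U/Qphi] := Hz w Dw.
- split.
    move=> z z'; rewrite !inE => Dz Dz' /= e.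
    have [V'z Ez] := Hz z Dz; have [V'z' Ez'] := Hz z' Dz'.
    by rewrite -Ez -Ez'; congr G; apply: inj; rewrite ?inE //; exact: V'U.
  move=> D' oD' D'D.
  have [||W oW EW] := emb (V' `&` G @^-1` D').
  + exact: open_preimage_in.
  + by move=> y [/V'U].
  exists W => //; rewrite -EW; apply/seteqP; split=> [_ [z D'z <-]|_ [y [V'y D'y] <-]].
    have [V'z Ez] := Hz z (D'D _ D'z).
    by exists (g z) => //; split=> //; rewrite /= Ez.
  by exists (G y) => //=; have [_ ->] := Hg y V'y.
exists (G x); first by have [] := Hg x V'x.
by rewrite /= (Hg x V'x).2.
Qed.

Lemma cross_of_proportional (a c uh uk qh qk : CC) :
  a != 0 -> c * uh = a * qh -> c * uk = a * qk -> qh * uk = qk * uh.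
Proof.
move=> a0 Eh Ek; apply: (mulfI a0); rewrite !mulrA -Eh -Ek; ring.
Qed.

(** As psi is a homeomorphism onto an open part of C, the points of the surface
    near phi x are values of psi near z, which is what dependent_of_holomorphic
    needs. *)
Lemma curve_to_closed (C : set QT) : C `<=` @Q R `\` @zero_section R ->
  complex_analytic_curve C -> omega_closed_on C.
Proof.
move=> CQ curve U phi lp x Ux h k.
have sub y : U y -> C (phi y) := local_param_sub lp.
have [oU smooth imm [inj emb]] := lp.
have Cphi := smooth 2%N.
have Qphi y : U y -> Q (phi y) by move=> /sub/CQ[].
have phi0 y : U y -> (phi y).2 != 0 by move=> /sub/CQ[_ /eqP].
have [D [psi [oD [hol immC] [injpsi embpsi] [z Dz pz]]]] := curve _ (sub x Ux).
have [b db] := exists_chart (phi x).1.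
have Vx : chart_domain U phi b x by split.
apply/(closed_chart oU Cphi Qphi phi0 k h Vx).
set u := fun y => stereo b (phi y).1; set q := fun y => fiber b (phi y).
have Du m := is_Cderive_class m (chart_u_class b oU Cphi) Vx.
have Dq m := is_Cderive_class m (chart_q_class b oU Cphi) Vx.
have := (holomorphic_to_QP psi oD).1 hol z Dz; rewrite pz => -[Qz cz /(_ b db)[du dq]].
have Qpsi w : D w -> Q (psi w) by move=> /hol[].
have db' : stereo_den b (psi z).1 != 0 by rewrite pz.
have Eu := near_eq_derive (1 : CC) (near_chart_u oD Qpsi Dz cz db').
have Eq := near_eq_derive (1 : CC) (near_chart_q oD Qpsi Dz cz db').
have ac : 'D_1 (fun w => stereo b (psi w).1) z <> 0 \/ 'D_1 (fiber b \o psi) z <> 0.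
  rewrite -Eu -Eq; have [Ht Hf] := immC z Dz.
  have [Sz _ _ _] := Qpsi z Dz.
  by move/(stereo_den_pole b Sz): db'; case: (b) => db'; [exact: Ht|exact: Hf].
have HN N : nbhs z N -> \forall y \near x, exists2 w, N w & psi w = phi y.
  (* An open neighbourhood of z, which the embedding psi maps to an open part of C. *)
  move=> Nz; pose N' := (N `&` D)^°.
  have oN' : open N' by exact: open_interior.
  have N'sub : N' `<=` N `&` D by exact: interior_subset.
  have N'z : N' z by apply: filterI Nz (nbhs_of_open oD Dz).
  have [|W oW EW] := embpsi N' oN'; first by move=> w /N'sub[].
  have Wx : W (phi x).
    have : (psi @` N') (phi x) by exists z.
    by rewrite EW => -[].
  have Wn : \forall y \near x, W (phi y) by apply: (Cphi.1 x Ux); exact: nbhs_of_open.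
  apply: filterS2 (nbhs_of_open oU Ux) Wn => y Uy Wy.
  have : (C `&` W) (phi y) by split=> //; exact: sub.
  by rewrite -EW => -[w /N'sub[Nw _] ew]; exists w.
have HNuq N : nbhs z N -> \forall y \near x,
    exists2 w, N w & stereo b (psi w).1 = u y /\ (fiber b \o psi) w = q y.
  by move=> /HN; apply: filterS => y [w Nw ew]; exists w => //; rewrite /= ew.
have HNqu N : nbhs z N -> \forall y \near x,
    exists2 w, N w & (fiber b \o psi) w = q y /\ stereo b (psi w).1 = u y.
  by move=> /HN; apply: filterS => y [w Nw ew]; exists w => //; rewrite /= ew.
have Hu := derivableP du; have Hq := derivableP dq.
have eu : stereo b (psi z).1 = u x by rewrite pz.
have eq' : (fiber b \o psi) z = q x by rewrite /= pz.
case: ac => /eqP a0.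
  have L m := dependent_of_holomorphic Hu Hq a0 (Du m) (Dq m) eu eq' HNuq.
  exact: (cross_of_proportional a0 (L h) (L k)).
have L m := dependent_of_holomorphic Hq Hu a0 (Dq m) (Du m) eq' eu HNqu.
apply: etrans (mulrC _ _) (etrans _ (mulrC _ _)).
exact: (esym (cross_of_proportional a0 (L h) (L k))).
Qed.

End Curves.

(** * Dual bases *)

Section DualBasis.
Variable R : realType.
Local Notation R3 := 'cV[R]_3.

Lemma dual_basis_inverse (v w : 'I_3 -> R3) :
  (forall i j, dot (w i) (v j) = (i == j)%:R) ->
  (\matrix_(i, j) v j i 0) *m (\matrix_(i, j) w i j 0) = 1%:M.
Proof.
move=> H; apply: mulmx1C; apply/matrixP => i j; rewrite !mxE -H /dot mxE.
by apply: eq_bigr => l _; rewrite !mxE.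
Qed.

(** A family that has a dual family is a basis. *)
Lemma dual_basis_ext (v w : 'I_3 -> R3) (B : 'M[R]_3) :
  (forall i j, dot (w i) (v j) = (i == j)%:R) ->
  (forall j, B *m v j = 0) -> B = 0.
Proof.
move=> H HB; rewrite -[B]mulmx1 -(dual_basis_inverse H) mulmxA.
have -> : B *m (\matrix_(i, j) v j i 0) = 0; last by rewrite mul0mx.
apply/matrixP => i j; have := congr1 (fun M : R3 => M i 0) (HB j).
rewrite !mxE => E; apply: etrans E.
by apply: eq_bigr => l _; rewrite !mxE.
Qed.

Lemma dual_basis_orth (v w : 'I_3 -> R3) (x : R3) :
  (forall i j, dot (w i) (v j) = (i == j)%:R) ->
  (forall i, dot (v i) x = 0) -> x = 0.
Proof.
move=> H Hx; rewrite -[x]mul1mx.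
have /(congr1 trmx) := dual_basis_inverse H; rewrite trmx_mul trmx1 => <-.
rewrite -mulmxA; set y := _ *m x.
have -> : y = 0; last by rewrite mulmx0.
apply/matrixP => i j; rewrite ord1 [RHS]mxE; apply: etrans _ (Hx i).
by rewrite /dot !mxE; apply: eq_bigr => l _; rewrite !mxE.
Qed.

Lemma dot_eq0 (v : R3) : dot v v = 0 -> v = 0.
Proof.
rewrite dotE => H.
have H0 := sqr_ge0 (v 0 0); have H1 := sqr_ge0 (v 1 0); have H2 := sqr_ge0 (v 2 0).
rewrite -!expr2 in H.
by apply: col3P; rewrite mxE; apply/eqP; rewrite -sqrf_eq0; apply/eqP; lra.
Qed.

Lemma gram_neq0 (v w : R3) :
  (forall a b : R, a *: v + b *: w = 0 -> a = 0 /\ b = 0) ->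
  dot v v * dot w w - dot v w * dot v w != 0.
Proof.
move=> ind; apply/eqP => D0.
(* The square of the length of z is a multiple of the Gram determinant. *)
pose z := dot w w *: v + (- dot v w) *: w.
have /ind[w0 _] : z = 0.
  apply: dot_eq0; rewrite /z !(dotDr, dotZr) !(dotC (_ + _)) !(dotDr, dotZr) (dotC w v).
  transitivity (dot w w * (dot v v * dot w w - dot v w * dot v w)); first by ring.
  by rewrite D0 mulr0.
have w00 : w = 0 := dot_eq0 w0.
have [_ /eqP] : (0 : R) = 0 /\ (1 : R) = 0 by apply: ind; rewrite w00 scaler0 scale0r addr0.
by rewrite oner_eq0.
Qed.

(** Cramer's rule for v and w, completed by a unit normal m. *)
Lemma gram_dual (v w m : R3) :
  let d := dot v v * dot w w - dot v w * dot v w in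
  d != 0 -> dot m m = 1 -> dot m v = 0 -> dot m w = 0 ->
  forall i j : 'I_3,
  dot (nth 0 [:: d^-1 *: (dot w w *: v - dot v w *: w);
                 d^-1 *: (dot v v *: w - dot v w *: v); m] i)
      (nth 0 [:: v; w; m] j) = (i == j)%:R.
Proof.
move=> d d0 mm mv mw i j; rewrite dotC.
case: i => [[|[|[|//]]]] hi; case: j => [[|[|[|//]]]] hj /=;
  rewrite ?dotZr ?dotBr ?dotZr ?(dotC w v) ?(dotC v m) ?(dotC w m) ?mv ?mw ?mm //;
  try ring; by move: d0; rewrite /d => d0; field.
Qed.

Lemma rank_two_entry (d : R) (a v c w : R3) i j :
  (d *: (a *m v^T + c *m w^T)) i j = d * (a i 0 * v j 0 + c i 0 * w j 0).
Proof. by rewrite !mxE !big_ord1 !mxE. Qed.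

Lemma rank_two_mul (d : R) (a v c w z : R3) :
  (d *: (a *m v^T + c *m w^T)) *m z = dot (d *: v) z *: a + dot (d *: w) z *: c.
Proof.
by rewrite -scalemxAl mulmxDl !mul_dot scalerDr !scalerA -!(dotC z) !dotZr.
Qed.

Lemma nth_delta (a c : R3) (l : 'I_3) :
  ((0 : 'I_3) == l)%:R *: a + ((1 : 'I_3) == l)%:R *: c = nth 0 [:: a; c; 0] l.
Proof.
by case: l => [[|[|[|//]]]] hl /=; rewrite ?scale1r ?scale0r ?addr0 ?add0r.
Qed.

Lemma dot_nth_sym (v w m a c : R3) :
  dot v c = dot w a -> dot m a = 0 -> dot m c = 0 -> forall i j : 'I_3,
  dot (nth 0 [:: v; w; m] i) (nth 0 [:: a; c; 0] j) =
  dot (nth 0 [:: v; w; m] j) (nth 0 [:: a; c; 0] i).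
Proof.
move=> vc ma mc i j.
by case: i => [[|[|[|//]]]] hi; case: j => [[|[|[|//]]]] hj /=; rewrite ?dot0r ?ma ?mc ?vc.
Qed.

End DualBasis.

(** * The differential of the Gauss map in a chart *)

Section MinimalSurface.
Variable R : realType.
Local Notation R3 := 'cV[R]_3.
Local Notation CC := (R[i]^o).
Local Notation Re := complex.Re.
Local Notation Im := complex.Im.
Local Notation E := (R * R)%type.

Lemma derive_linear_comb (U : set E) (f : E -> R3) x h :
  open U -> entrywise_C 1 U f -> U x ->
  'D_h f x = h.1 *: 'D_(1, 0) f x + h.2 *: 'D_(0, 1) f x.
Proof.
move=> oU Cf Ux.
have D k : derivable f x k.
  by apply/derivable_mxP => i j; have [_ /(_ k)[d _]] := Cf i j; exact: d.
apply/matrixP => i j.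
have DE k : 'D_k f x i j = 'D_k (fun y => f y i j) x by rewrite (derive_mx (D k)) mxE.
have G (a c : R) (M N : R3) : (a *: M + c *: N) i j = a * M i j + c * N i j.
  by rewrite !mxE.
apply: etrans (DE h) (etrans (class_C_deriveE h oU (Cf i j) Ux) _).
apply: etrans _ (esym (G _ _ _ _)); congr (_ * _ + _ * _).
  exact: esym (DE _).
exact: esym (DE _).
Qed.

Lemma is_derive_dot (U : set E) (f g : E -> R3) x h :
  entrywise_C 1 U f -> entrywise_C 1 U g -> U x ->
  is_derive x h (fun y => dot (f y) (g y)) (dot ('D_h f x) (g x) + dot (f x) ('D_h g x)).
Proof.
move=> Cf Cg Ux.
have D (l : E -> R3) (Cl : entrywise_C 1 U l) i : is_derive x h (fun y => l y i 0) ('D_h l x i 0).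
  have d a c : derivable (fun y => l y a c) x h.
    by have [_ /(_ h)[d _]] := Cl a c; exact: d.
  have dl : derivable l x h by apply/derivable_mxP.
  by rewrite (derive_mx dl) mxE; exact: derivableP.
have H := is_deriveD_fun (is_deriveD_fun (is_deriveM_fun (D f Cf 0) (D g Cg 0))
  (is_deriveM_fun (D f Cf 1) (D g Cg 1))) (is_deriveM_fun (D f Cf 2) (D g Cg 2)).
have -> : (fun y => dot (f y) (g y)) =
  (fun y => f y 0 0 * g y 0 0 + f y 1 0 * g y 1 0 + f y 2 0 * g y 2 0).
  by apply/funext => y; rewrite dotE.
apply: is_derive_eq H _; rewrite !dotE.
by move: ('D_h f x) ('D_h g x) (f x) (g x) => *; ring.
Qed.

Lemma entrywise_C_derive (k : nat) (U : set E) (f : E -> R3) h : open U ->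
  entrywise_C k.+1 U f -> entrywise_C k U (fun y => 'D_h f y).
Proof.
move=> oU Cf i j.
apply: (class_C_ext (f := fun y => 'D_h (fun z => f z i j) y)) => //.
  move=> y Uy; have D : derivable f y h.
    by apply/derivable_mxP => a c; have [_ /(_ h)[d _]] := Cf a c; exact: d.
  by rewrite (derive_mx D) mxE.
by have [_ /(_ h)[_ ?]] := Cf i j.
Qed.

Lemma derive_comm_col (U : set E) (f : E -> R3) x h k : open U ->
  entrywise_C 2 U f -> U x ->
  'D_k (fun y => 'D_h f y) x = 'D_h (fun y => 'D_k f y) x.
Proof.
move=> oU Cf Ux.
have DD l m : 'D_m (fun y => 'D_l f y) x =
    \matrix_(i, j) 'D_m (fun y => 'D_l (fun z => f z i j) y) x.
  have D y : U y -> derivable f y l.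
    by move=> Uy; apply/derivable_mxP => a c; have [_ /(_ l)[d _]] := Cf a c; exact: d.
  have D2 : derivable (fun y => 'D_l f y) x m.
    apply/derivable_mxP => a c.
    by have [_ /(_ m)[d _]] := entrywise_C_derive l oU Cf a c; exact: d.
  rewrite (derive_mx D2); apply/matrixP => i j; rewrite mxE [RHS]mxE.
  apply: near_eq_derive; apply: filterS (nbhs_of_open oU Ux) => y Uy.
  by rewrite (derive_mx (D y Uy)) mxE.
apply: etrans (DD h k) (etrans _ (esym (DD k h))).
apply/matrixP => i j; apply: etrans (mxE _ _ _ _) (etrans _ (esym (mxE _ _ _ _))).
exact: (derive_comm k h oU (Cf i j) Ux).
Qed.

Lemma continuous_of_entries m n (T : topologicalType) (M : T -> 'M[R]_(m, n)) x :
  (forall i j, {for x, continuous (fun y => M y i j)}) -> {for x, continuous M}.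
Proof.
move=> cM; apply/cvgrPdist_le => e e0.
have : \forall y \near x, forall ij : 'I_m * 'I_n, `|M x ij.1 ij.2 - M y ij.1 ij.2| <= e.
  apply: filter_forall => -[i j] /=.
  by apply: filterS (continuous_dist (cM i j) e0) => y /ltW.
apply: filterS => y Hy.
rewrite [leLHS]/Num.Def.normr/= mx_normrE (bigmax_le _ (ltW e0))//= => ij _.
by rewrite !mxE.
Qed.

Variables (U : set E) (X n : E -> R3) (A : E -> 'M[R]_3).
Hypotheses (oU : open U) (CX : entrywise_C 2 U X) (Cn : entrywise_C 2 U n).
Hypothesis imm : forall x, U x -> immersion_at X x.
Hypothesis Sn : forall x, U x -> sphere (n x).
Hypothesis nX : forall x h, U x -> dot (n x) ('D_h X x) = 0.
Hypothesis An : forall x, U x -> A x *m n x = 0.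
Hypothesis AX : forall x h, U x -> A x *m 'D_h X x = 'D_h n x.
Hypothesis tA : forall x, U x -> \tr (A x) = 0.

Let lower m p (M : E -> 'M[R]_(m, p)) : entrywise_C 2 U M -> entrywise_C 1 U M.
Proof. by move=> CM i j; exact: class_CW. Qed.

Let X1 y := 'D_(1, 0) X y.
Let X2 y := 'D_(0, 1) X y.
Let n1 y := 'D_(1, 0) n y.
Let n2 y := 'D_(0, 1) n y.
Let D y := dot (X1 y) (X1 y) * dot (X2 y) (X2 y) - dot (X1 y) (X2 y) * dot (X1 y) (X2 y).
Let Y1 y := dot (X2 y) (X2 y) *: X1 y - dot (X1 y) (X2 y) *: X2 y.
Let Y2 y := dot (X1 y) (X1 y) *: X2 y - dot (X1 y) (X2 y) *: X1 y.

Let D0 y : U y -> D y != 0.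
Proof.
move=> Uy; apply: gram_neq0 => a c H.
have /(imm Uy) [-> ->] : 'D_(a, c) X y = 0; last by [].
by rewrite (derive_linear_comb (a, c) oU (lower CX) Uy).
Qed.

Let basis y : 'I_3 -> R3 := fun i => nth 0 [:: X1 y; X2 y; n y] i.
Let dual y : 'I_3 -> R3 := fun i => nth 0 [:: (D y)^-1 *: Y1 y; (D y)^-1 *: Y2 y; n y] i.

Let dualP y : U y -> forall i j, dot (dual y i) (basis y j) = (i == j)%:R.
Proof.
move=> Uy; apply: gram_dual.
- exact: D0.
- by apply/sphereE; exact: Sn.
- exact: nX.
exact: nX.
Qed.

Let basis_image y : U y -> forall l, A y *m basis y l = nth 0 [:: n1 y; n2 y; 0] l.
Proof.
move=> Uy l; case: l => [[|[|[|//]]]] hl.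
- exact: AX (1, 0) Uy.
- exact: AX (0, 1) Uy.
exact: An Uy.
Qed.

(** Differentiating the equation n . X_h = 0 in the direction k gives
    X_h . n_k = - n . X_hk, which is symmetric in h and k. *)
Lemma gauss_differential_sym y : U y -> (A y)^T = A y.
Proof.
move=> Uy; apply/esym/eqP; rewrite -subr_eq0; apply/eqP.
apply: (dual_basis_ext (dualP Uy)) => j.
apply: (dual_basis_orth (dualP Uy)) => i.
rewrite mulmxBl dotBr.
have -> : dot (basis y i) ((A y)^T *m basis y j) = dot (basis y j) (A y *m basis y i).
  by rewrite dotC /dot trmx_mul trmxK mulmxA.
apply/eqP; rewrite subr_eq0; apply/eqP.
have K h k : dot ('D_h X y) ('D_k n y) = dot ('D_k X y) ('D_h n y).
  have N l m : dot (n y) ('D_m (fun z => 'D_l X z) y) + dot ('D_l X y) ('D_m n y) = 0.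
    have [_ e1] := is_derive_dot m (lower Cn) (entrywise_C_derive l oU CX) Uy.
    have [_ e2] : is_derive y m (fun z => dot (n z) ('D_l X z)) 0.
      apply: near_eq_is_derive (is_derive_cst (0 : R) y m).
      by apply: filterS (nbhs_of_open oU Uy) => z Uz; rewrite nX.
    by rewrite (dotC ('D_l X y)) addrC -e2 e1.
  have N1 := N h k; have N2 := N k h.
  have C := congr1 (dot (n y)) (derive_comm_col h k oU CX Uy).
  apply: (addrI (dot (n y) ('D_k (fun z => 'D_h X z) y))).
  exact: etrans N1 (etrans (esym N2) (congr1 (fun r => r + _) (esym C))).
have ndn h : dot (n y) ('D_h n y) = 0.
  exact: (dot_derive_sphere oU (lower Cn) Sn h Uy).
have AB := basis_image Uy.
rewrite (AB j) (AB i); exact: (dot_nth_sym (K _ _) (ndn _) (ndn _)).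
Qed.

Lemma gauss_differential_Q y : U y -> Q (n y, A y).
Proof.
by move=> Uy; split; [exact: Sn|exact: gauss_differential_sym|exact: An|exact: tA].
Qed.

(** In the basis X_x, X_y, n and its dual basis, A has the values n_x, n_y, 0;
    this expresses it rationally by derivatives of X and n. *)
Lemma gauss_differential_class : entrywise_C 1 U A.
Proof.
have CX1 : entrywise_C 1 U X1 := entrywise_C_derive (1, 0) oU CX.
have CX2 : entrywise_C 1 U X2 := entrywise_C_derive (0, 1) oU CX.
have Cn1 : entrywise_C 1 U n1 := entrywise_C_derive (1, 0) oU Cn.
have Cn2 : entrywise_C 1 U n2 := entrywise_C_derive (0, 1) oU Cn.
have C11 := class_C_dot oU CX1 CX1; have C12 := class_C_dot oU CX1 CX2.
have C22 := class_C_dot oU CX2 CX2.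
have CD : class_C 1 U (fun y => (D y)^-1).
  apply: (class_CV oU D0); apply: (class_CB oU); first exact: (class_CM oU C11 C22).
  exact: (class_CM oU C12 C12).
have CY1 j : class_C 1 U (fun y => Y1 y j 0).
  have -> : (fun y => Y1 y j 0) =
      (fun y => dot (X2 y) (X2 y) * X1 y j 0 - dot (X1 y) (X2 y) * X2 y j 0).
    by apply/funext => y; rewrite !mxE.
  exact: (class_CB oU (class_CM oU C22 (CX1 j 0)) (class_CM oU C12 (CX2 j 0))).
have CY2 j : class_C 1 U (fun y => Y2 y j 0).
  have -> : (fun y => Y2 y j 0) =
      (fun y => dot (X1 y) (X1 y) * X2 y j 0 - dot (X1 y) (X2 y) * X1 y j 0).
    by apply/funext => y; rewrite !mxE.
  exact: (class_CB oU (class_CM oU C11 (CX2 j 0)) (class_CM oU C12 (CX1 j 0))).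
move=> i j.
apply: (class_C_ext (f := fun y => (D y)^-1 * (n1 y i 0 * Y1 y j 0 + n2 y i 0 * Y2 y j 0)) oU).
  move=> y Uy.
  pose B := (D y)^-1 *: (n1 y *m (Y1 y)^T + n2 y *m (Y2 y)^T).
  have AB : A y = B.
    apply/eqP; rewrite -subr_eq0; apply/eqP; apply: (dual_basis_ext (dualP Uy)) => l.
    have P := dualP Uy.
    have BB : B *m basis y l = nth 0 [:: n1 y; n2 y; 0] l.
      apply: etrans (rank_two_mul _ _ _ _ _ _) (etrans _ (nth_delta _ _ _)).
      exact: (congr2 (fun r t => r *: n1 y + t *: n2 y) (P 0 l) (P 1 l)).
    by rewrite mulmxBl BB basis_image // subrr.
  exact: esym (etrans (congr1 (fun M : 'M[R]_3 => M i j) AB) (rank_two_entry _ _ _ _ _ _ _)).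
apply: (class_CM oU CD); apply: (class_CD oU).
  exact: (class_CM oU (Cn1 i 0) (CY1 j)).
exact: (class_CM oU (Cn2 i 0) (CY2 j)).
Qed.

Variable b : bool.
Let V := U `&` [set y | stereo_den b (n y) != 0].
Let u y := stereo b (n y).
Let q y := fiber b (n y, A y).
Hypothesis hu : forall x, V x -> Cderive (0, 1) u x = 'i%C * Cderive (1, 0) u x.

Let VU : V `<=` U. Proof. by move=> y []. Qed.
Let Vd y : V y -> stereo_den b (n y) != 0. Proof. by case. Qed.

Let oV : open V.
Proof.
apply: (open_stereo_domain b oU) => y Uy.
by apply: continuous_of_entries => i j; have [c _] := Cn i j; exact: c.
Qed.

Let CAV := entrywise_CS VU gauss_differential_class.
Let QV y (Vy : V y) : Q (n y, A y) := gauss_differential_Q (VU Vy).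

Lemma chart_q_class_minimal : complex_class_C 1 V q.
Proof. exact: (complex_class_C_fiber oV Vd (entrywise_CS VU (lower Cn)) CAV). Qed.

(** Where A is invertible on the tangent plane, omega pulled back by (n, A) is dX,
    which is closed. Thus dq is proportional to du, and du is nonzero since dn
    would vanish with it. *)
Lemma chart_q_CR_regular x : V x -> A x != 0 ->
  Cderive (0, 1) q x = 'i%C * Cderive (1, 0) q x.
Proof.
move=> Vx A0.
pose V' := V `&` [set y | A y != 0].
have oV' : open V'.
  rewrite openE => y [Vy Ay]; apply: filterI; first exact: nbhs_of_open.
  have cA : {for y, continuous A}.
    apply: continuous_of_entries => i j.
    by have [c _] := gauss_differential_class i j; exact: c _ (VU Vy).
  exact: near_neq0 cA Ay.
have V'V : V' `<=` V by move=> y [].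
have V'x : V' x by split.
have V'U y (V'y : V' y) : U y := VU (V'V _ V'y).
have d' y (V'y : V' y) : stereo_den b (n y) != 0 := Vd (V'V _ V'y).
have Cn' := entrywise_CS V'U (lower Cn).
have CA' := entrywise_CS V'U gauss_differential_class.
have Q' y (V'y : V' y) : Q (n y, A y) := QV (V'V _ V'y).
have S' y (V'y : V' y) : sphere (n y) := Sn (V'U _ V'y).
have T h y (V'y : V' y) := tangent_inv_along oV' d' Cn' S' Q' h V'y V'y.2.
have W h y : V' y -> 'D_h X y = Re3 ((- 2 * Cderive h u y / q y) *: isotropic b (u y)).
  move=> V'y; have [_ <-] := T h y V'y.
  have Qy := Q' y V'y; case: (Qy) => [/= Sy sA _ _].
  have sE := stereoK Sy (d' y V'y).
  apply/esym; rewrite -{1}sE; apply: tangent_inv_eq; rewrite ?sE //.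
  - exact: An (V'U _ V'y).
  - exact: tA (V'U _ V'y).
  - exact: V'y.2.
  - exact: nX (V'U _ V'y).
  exact: AX (V'U _ V'y).
have Cu' : complex_class_C 2 V' u := complex_class_C_stereo oV' d' (entrywise_CS V'U Cn).
have Cq' : complex_class_C 1 V' q := complex_class_C_fiber oV' d' Cn' CA'.
have q0 y : V' y -> q y != 0 by move=> V'y; have [] := T 0 y V'y.
have X12 := derive_comm_col (1, 0) (0, 1) oU CX (VU Vx).
have /(_ X12) := (exterior_derivative_inv (h := (1, 0)) (k := (0, 1))
  oV' V'x Cu' Cq' q0 (W _) (W _)).1.
have u10 : Cderive (1, 0) u x != 0.
  apply/eqP => u1; move/eqP: A0; apply.
  have n0 h : 'D_h n x = 0.
    have e1 : 'D_(1, 0) n x = 0 := derive_base_eq0 oV' d' Cn' S' V'x u1.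
    have u2 : Cderive (0, 1) u x = 0 :=
      etrans (hu Vx) (etrans (congr1 (fun w => 'i%C * w) u1) (mulr0 _)).
    have e2 : 'D_(0, 1) n x = 0 := derive_base_eq0 oV' d' Cn' S' V'x u2.
    apply: etrans (derive_linear_comb h oU (lower Cn) (VU Vx)) _.
    apply: etrans (congr2 (fun v w => h.1 *: v + h.2 *: w) e1 e2) _.
    by rewrite !scaler0 addr0.
  apply: (dual_basis_ext (dualP (VU Vx))) => l.
  case: l => [[|[|[|//]]]] hl; rewrite /basis /=.
  - exact: etrans (AX (1, 0) (VU Vx)) (n0 _).
  - exact: etrans (AX (0, 1) (VU Vx)) (n0 _).
  exact: An (VU Vx).
move: (hu Vx) u10.
move: (Cderive (0, 1) q x) (Cderive (1, 0) q x) (Cderive (0, 1) u x) (Cderive (1, 0) u x).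
move=> q2 q1 u2 u1 -> u10 e.
by apply: (mulIf u10); rewrite e; ring.
Qed.

(** If the Cauchy-Riemann defect T of q were nonzero at x, it would be nonzero
    near x by continuity; by chart_q_CR_regular, A and hence q would vanish near x,
    and T with them. *)
Lemma chart_q_CR x : V x -> Cderive (0, 1) q x = 'i%C * Cderive (1, 0) q x.
Proof.
move=> Vx; apply/eqP; rewrite -subr_eq0.
pose T y : CC := Cderive (0, 1) q y - 'i%C * Cderive (1, 0) q y.
have CT : complex_class_C 0 V T.
  have Cq := chart_q_class_minimal.
  have H : complex_class_C 0 V (fun y => (-1) * ('i%C * Cderive (1, 0) q y)).
    apply: (complex_class_CM oV (complex_class_C_cst _ _ _)).
    exact: (complex_class_CM oV (complex_class_C_cst _ _ _) (complex_class_C_derive _ Cq)).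
  have [H1 H2] := H; have [G1 G2] := complex_class_C_derive (0, 1) Cq.
  split.
    have -> : (fun y => Re (T y)) = (fun y =>
        Re (Cderive (0, 1) q y) + Re ((-1) * ('i%C * Cderive (1, 0) q y))).
      by apply/funext => y; rewrite /T Re_add mulN1r.
    exact: class_CD.
  have -> : (fun y => Im (T y)) = (fun y =>
        Im (Cderive (0, 1) q y) + Im ((-1) * ('i%C * Cderive (1, 0) q y))).
    by apply/funext => y; rewrite /T Im_add mulN1r.
  exact: class_CD.
rewrite -/(T x); apply/negPn/negP => T0.
have cT := complex_class_C_continuous CT Vx.
have NT : \forall y \near x, T y != 0 := near_neq0 cT T0.
have Nq : \forall y \near x, 0 = q y.
  apply: filterS2 NT (nbhs_of_open oV Vx) => y Ty Vy.
  have [A0|A0] := eqVneq (A y) 0; last first.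
    by move: Ty; rewrite /T chart_q_CR_regular // subrr eqxx.
  by rewrite /q /fiber /= A0 /fiber_re /fiber_im !mul0mx !dot0r subrr mulr0.
have z0 h : Cderive h q x = 0.
  apply: is_Cderive_val; split.
    apply: near_eq_is_derive (is_derive_cst (0 : R) x h).
    by apply: filterS Nq => y <-.
  apply: near_eq_is_derive (is_derive_cst (0 : R) x h).
  by apply: filterS Nq => y <-.
by move: T0; rewrite /T !z0 mulr0 subrr eqxx.
Qed.

End MinimalSurface.

(** * Minimal surfaces *)

Section GaussMap.
Variable R : realType.
Local Notation R3 := 'cV[R]_3.
Local Notation CC := (R[i]^o).
Local Notation QT := (R3 * 'M[R]_3)%type.
Local Notation E := (R * R)%type.

Lemma gauss_differential_analytic (M : topologicalType) (At : set (chart R M))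
    (X n : M -> R3) (n' : M -> 'M[R]_3) :
  riemann_surface At -> smooth_immersion At X -> gauss_map At X n ->
  gauss_differential At X n n' -> minimal n' -> analytic_to_S At n ->
  analytic_to_Q At (fun p => (n p, n' p)).
Proof.
move=> [_ _ charts _ _] [smX imX] [smn Sn tang] [n'n n'X] mini holn c Ac.
have [_ oD _ _] := charts c Ac.
pose U : set E := @toC R @^-1` chart_cod c.
have oU : open U.
  by rewrite openE => x Ux; apply: (toC_continuous (nbhs_of_open oD Ux)).
pose Xc := in_chart c X; pose nc := in_chart c n; pose Nc := in_chart c n'.
have CX : entrywise_C 2 U Xc := class_C_entrywise oU (smX c Ac 2%N).
have Cn : entrywise_C 2 U nc := class_C_entrywise oU (smn c Ac 2%N).
have imm x : U x -> immersion_at Xc x by move=> Ux; exact: imX.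
have Snc x : U x -> sphere (nc x) by move=> _; exact: Sn.
have nX x h : U x -> dot (nc x) ('D_h Xc x) = 0.
  by move=> Ux; apply/tangentE; exact: tang.
have An x : U x -> Nc x *m nc x = 0 by move=> _; exact: n'n.
have AX x h : U x -> Nc x *m 'D_h Xc x = 'D_h nc x by move=> Ux; exact: n'X.
have tA x : U x -> \tr (Nc x) = 0 by move=> _; exact: mini.
have QU : forall x, U x -> Q (nc x, Nc x) := gauss_differential_Q oU CX Cn imm Snc nX An AX tA.
have CN : entrywise_C 1 U Nc := gauss_differential_class oU CX Cn imm Snc nX An AX.
pose f := (fun p => (n p, n' p)) \o chart_param c.
have fE z : f z = (nc (ofC z), Nc (ofC z)) by rewrite /f /nc /Nc /in_chart /= ofCK.
have Uof z : chart_cod c z -> U (ofC z) by rewrite /U /= ofCK.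
have Qf z : chart_cod c z -> Q (f z) by move=> /Uof; rewrite fE; exact: QU.
have cf z : chart_cod c z -> {for z, continuous f}.
  move=> /Uof Uz.
  have c1 : {for ofC z, continuous nc} by have [c1 _] := smn c Ac 0%N; exact: c1.
  have c2 : {for ofC z, continuous Nc}.
    by apply: continuous_of_entries => i j; have [c2 _] := CN i j; exact: c2.
  have c3 : {for ofC z, continuous (fun y : E => (nc y, Nc y))} by exact: (cvg_pair c1 c2).
  have -> : f = (fun y => (nc y, Nc y)) \o @ofC R by apply/funext => w; exact: fE.
  have c0 : {for z, continuous (@ofC R)} := @ofC_continuous R z.
  exact: (continuous_comp c0 c3).
have du b z : chart_cod c z -> stereo_den b (f z).1 != 0 ->
    derivable (fun w => stereo b (f w).1) z 1.
  move=> Dz d0; have [Sz _ _ _] := Qf z Dz.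
  have [_ _ Ht Hf] := holn c Ac z Dz.
  have du : derivable (fun w => chart_u b (f w).1) z 1.
    by move/(stereo_den_pole b Sz): (d0); case: (b) => H; [exact: Ht|exact: Hf].
  by apply: near_eq_derivable du; exact: near_chart_u oD Qf Dz (cf z Dz) d0.
apply/(holomorphic_to_QP f oD) => z Dz.
split; [exact: Qf|exact: cf|] => b d0; split; first exact: du.
pose V := U `&` [set y | stereo_den b (nc y) != 0].
have hu x : V x -> Cderive (0, 1) (fun y => stereo b (nc y)) x =
    'i%C * Cderive (1, 0) (fun y => stereo b (nc y)) x.
  move=> [Ux dx].
  have Hd := derivableP (du b (toC x) Ux dx).
  have H k : is_Cderive x k (fun y => stereo b (nc y)) (_ * toC k) := is_Cderive_holomorphic k Hd.
  rewrite (is_Cderive_val (H (0, 1))) (is_Cderive_val (H (1, 0))).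
  have -> : toC (0, 1) = 'i%C :> CC by [].
  have -> : toC (1, 0) = 1 :> CC by [].
  by rewrite mulr1 mulrC.
have Vz : V (ofC z) by split; [exact: Uof|move: d0; rewrite fE].
have oV : open V.
  by apply: (open_stereo_domain b oU); have [c1 _] := smn c Ac 0%N.
have Cq := chart_q_class_minimal oU CX Cn imm Snc nX An AX b.
have CR := chart_q_CR oU CX Cn imm Snc nX An AX tA hu Vz.
have [d _] := derive_of_CR oV Cq Vz CR.
have -> : fiber b \o f = (fun y => fiber b (nc y, Nc y)) \o @ofC R.
  by apply/funext => w; rewrite /= -fE.
exact: d.
Qed.

End GaussMap.

(** * The proposition *)

Theorem proposition2p1 (R : realType) :
  (forall C : set ('cV[R]_3 * 'M[R]_3),
     C `<=` @Q R `\` @zero_section R ->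
     real_surface_in C ->
     (omega_closed_on C <-> complex_analytic_curve C)) /\
  (forall (M : topologicalType) (At : set (chart R M))
     (X n : M -> 'cV[R]_3) (n' : M -> 'M[R]_3),
     riemann_surface At ->
     smooth_immersion At X ->
     gauss_map At X n ->
     gauss_differential At X n n' ->
     minimal n' ->
     analytic_to_S At n ->
     analytic_to_Q At (fun p => (n p, n' p))).
Proof.
split; last exact: gauss_differential_analytic.
move=> C CQ surf; split; first exact: closed_to_curve CQ surf.
exact: curve_to_closed CQ.
Qed.
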